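(* Let $t, k, N \in \mathbb{Z}_{\geq 1}$ and let $Q(x)$ be a polynomial (with complex coefficients) of degree less than $\phi(N)k$ satisfying $Q(0) = 0$ and \[ Q(x) = \begin{cases} (-x)^k Q(1/x) & \text{if } N = 1, \\ x^{\phi(N)k} Q(1/x) & \text{if } N \geq 2. \end{cases} \] Then the following hold. (1) $\mathcal{U}_{k; N}(Q; q)$ is a mixed-weight quasimodular form of weight at most $k$ and level at most $N$. (2) $\mathcal{U}_{t, k; N}(Q; q)$ and $\mathcal{U}_{t, k; N}^{\star}(Q; q)$ are isobaric polynomials of weight $t$ in the variables $\mathcal{U}_{sk; N}(Q^s; q)$ for $1 \leq s \leq t$; that is, each is a linear combination, with constant coefficients, of monomials of the form \[ \mathcal{U}_{k; N}(Q; q)^{s_1}\, \mathcal{U}_{2k; N}(Q^2; q)^{s_2} \cdots \mathcal{U}_{tk; N}(Q^t; q)^{s_t} \] with integers $s_1,\dots,s_t \geq 0$ satisfying $s_1 + 2s_2 + \cdots + ts_t = t$. Consequently, both $\mathcal{U}_{t, k; N}(Q; q)$ and $\mathcal{U}_{t, k; N}^{\star}(Q; q)$ are mixed-weight quasimodular forms of weight at most $tk$ and level at most $N$.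
   Context: $\mathbb{H} = \{z \in \mathbb{C} : \operatorname{Im}(z) > 0\}$, and $q = e^{2\pi i \tau}$ for $\tau \in \mathbb{H}$; $q$-series are regarded as functions of $\tau\in\mathbb{H}$. $\phi$ is Euler's totient function and $\Phi_N(x)$ is the $N$-th cyclotomic polynomial (so $\Phi_1(x) = x-1$, $\Phi_2(x)=x+1$). For $t,k,N \in \mathbb{Z}_{\geq 1}$ and a polynomial $Q(x)$, \[ \mathcal{U}_{t, k; N}(Q; q) = \sum_{1 \leq n_1 < n_2 < \cdots < n_t}\prod_{j = 1}^{t}\frac{Q(q^{n_j})}{\Phi_N(q^{n_j})^k}, \qquad \mathcal{U}_{t, k; N}^{\star}(Q; q) = \sum_{1 \leq n_1 \leq n_2 \leq \cdots \leq n_t}\prod_{j = 1}^{t}\frac{Q(q^{n_j})}{\Phi_N(q^{n_j})^k}, \] and $\mathcal{U}_{k; N}(Q; q) = \mathcal{U}_{1, k; N}(Q; q) = \sum_{n \geq 1}\frac{Q(q^n)}{\Phi_N(q^n)^k}$. $Q^s$ denotes the $s$-th power of the polynomial $Q$. Quasimodular forms: a holomorphic function $f: \mathbb{H} \to \mathbb{C}$ is a quasimodular form of weight $w$ and character $\chi$ (a Dirichlet character modulo $M$) on $\Gamma_0(M)$ if (i) there exist $s \in \mathbb{Z}_{\geq 0}$ and holomorphic functions $f_i: \mathbb{H} \to \mathbb{C}$ ($0 \leq i \leq s$) such that for every $\begin{pmatrix} a & b \\ c & d \end{pmatrix} \in \Gamma_0(M)$, \[ f\left(\frac{a\tau + b}{c\tau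 + d}\right) = \chi(d)(c\tau + d)^w\sum_{i = 0}^{s}f_i(\tau)\left(\frac{c}{c\tau + d}\right)^i, \] and (ii) $f$ is holomorphic at all cusps of $\Gamma_0(M)$. The space of these is $\widetilde{M}_w(\Gamma_0(M), \chi)$. A mixed-weight quasimodular form of weight at most $K$ and level at most $N$ is a finite sum of elements of spaces $\widetilde{M}_w(\Gamma_0(M), \chi)$ with $0 \leq w \leq K$, $M \leq N$ and $\chi$ a Dirichlet character modulo $M$ (constants count as weight $0$). *)

(* Defs.v *)
From HB Require Import structures.
From mathcomp Require Import all_boot all_order all_algebra all_field.
From mathcomp Require Import complex.
From mathcomp Require Import all_classical all_reals all_analysis.

Set Implicit Arguments.
Unset Strict Implicit.
Unset Printing Implicit Defensive.

Import Order.TTheory GRing.Theory Num.Theory.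
Import numFieldNormedType.Exports.

Local Open Scope ring_scope.
Local Open Scope complex_scope.

Definition in_uhp (R : realType) (tau : R[i]) : Prop := 0 < complex.Im tau.

Definition cexp (R : realType) (z : R[i]) : R[i] :=
  (expR (complex.Re z))%:C * (cos (complex.Im z) +i* sin (complex.Im z)).

Definition nome (R : realType) (tau : R[i]) : R[i] :=
  cexp (2 * (pi : R)%:C * 'i * tau).

Definition U_term (R : realType) (k N : nat) (Q : {poly R[i]}) (x : R[i]) :
    R[i] :=
  Q.[x] / (map_poly intr 'Phi_N).[x] ^+ k.

(* The topology (and, for [derivable], the normed space structure over itself) of
   the complex plane is carried by the regular module (R[i])^o.

   The multiple sums are the ordinary series in the outermost index n_t, whose
   partial sums are the finite sums over 1 <= n_1 < ... < n_t <= m (the series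
   converge absolutely for |q| < 1, hence the order of summation is
   immaterial). *)
Definition U (R : realType) (t k N : nat) (Q : {poly R[i]}) (q : R[i]) : R[i] :=
  limn (fun m : nat =>
    (\sum_(n : t.-tuple 'I_m.+1 | path ltn 0%N (map val n))
      \prod_(j < t) U_term k N Q (q ^+ tnth n j)) : (R[i])^o).

Definition Ustar (R : realType) (t k N : nat) (Q : {poly R[i]}) (q : R[i]) :
    R[i] :=
  limn (fun m : nat =>
    (\sum_(n : t.-tuple 'I_m.+1 | path leq 1%N (map val n))
      \prod_(j < t) U_term k N Q (q ^+ tnth n j)) : (R[i])^o).

Definition U1 (R : realType) (k N : nat) (Q : {poly R[i]}) (q : R[i]) : R[i] :=
  U 1 k N Q q.

Definition holomorphic_uhp (R : realType) (f : R[i] -> R[i]) : Prop :=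
  forall tau : R[i], in_uhp tau -> derivable (f : (R[i])^o -> (R[i])^o) tau 1.

Definition SL2Z (a b c d : int) : Prop := a * d - b * c = 1.

Definition Gamma0 (M : nat) (a b c d : int) : Prop :=
  SL2Z a b c d /\ (M %| c)%Z.

Definition cocycle (R : realType) (c d : int) (tau : R[i]) : R[i] :=
  c%:~R * tau + d%:~R.

Definition moebius (R : realType) (a b c d : int) (tau : R[i]) : R[i] :=
  (a%:~R * tau + b%:~R) / (c%:~R * tau + d%:~R).

Definition dirichlet_character (R : realType) (M : nat) (chi : int -> R[i]) :
    Prop :=
  [/\ chi 1 = 1,
      forall m n : int, chi (m * n) = chi m * chi n,
      forall m n : int, (m = n %[mod M])%Z -> chi m = chi n
    & forall n : int, (chi n != 0) = coprimez n M].

Definition bounded_at_ioo (R : realType) (f : R[i] -> R[i]) : Prop :=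
  exists A B : R, forall tau : R[i],
    in_uhp tau -> A <= complex.Im tau -> `|f tau| <= B%:C.

(* Every cusp is g(oo) for some g in SL2(Z), and f is holomorphic there when
   (f |_w g)(tau) = (c tau + d)^-w f(g tau) is bounded as Im tau -> oo (uniformly
   in Re tau).  For f as in [quasimodular], f |_w g is a polynomial in
   c / (c tau + d) whose coefficients are periodic functions of tau; since all
   real parts are allowed, the bound says exactly that each of these coefficients
   is holomorphic at oo, i.e. has no negative powers in its q-expansion. *)
Definition holomorphic_at_cusps (R : realType) (w : nat) (f : R[i] -> R[i]) :
    Prop :=
  forall a b c d : int, SL2Z a b c d ->
    bounded_at_ioo
      (fun tau => (cocycle c d tau) ^- w * f (moebius a b c d tau)).

Definition quasimodular (R : realType) (w M : nat) (chi : int -> R[i])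
    (f : R[i] -> R[i]) : Prop :=
  [/\ holomorphic_uhp f,
      exists (s : nat) (F : 'I_s.+1 -> R[i] -> R[i]),
        (forall i, holomorphic_uhp (F i)) /\
        forall a b c d : int, Gamma0 M a b c d ->
        forall tau : R[i], in_uhp tau ->
          f (moebius a b c d tau) =
          chi d * cocycle c d tau ^+ w *
          \sum_(i < s.+1) F i tau * (c%:~R / cocycle c d tau) ^+ i
    & holomorphic_at_cusps w f].

Definition mixed_weight_quasimodular (R : realType) (K L : nat)
    (f : R[i] -> R[i]) : Prop :=
  exists (r : nat) (w M : 'I_r -> nat) (chi : 'I_r -> int -> R[i])
      (g : 'I_r -> R[i] -> R[i]),
    (forall i, [/\ (w i <= K)%N, (0 < M i <= L)%N,
                   dirichlet_character (M i) (chi i)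
                 & quasimodular (w i) (M i) (chi i) (g i)]) /\
    forall tau : R[i], in_uhp tau -> f tau = \sum_(i < r) g i tau.

(* The exponent of V_(j+1) is s j; the constraint forces s j <= t, so bounding
   the exponents by t loses no monomial. *)
Definition isobaric_polynomial (R : realType) (t : nat)
    (V : nat -> R[i] -> R[i]) (f : R[i] -> R[i]) : Prop :=
  exists a : {ffun 'I_t -> 'I_t.+1} -> R[i],
  forall tau : R[i], in_uhp tau ->
    f tau = \sum_(s : {ffun 'I_t -> 'I_t.+1} | (\sum_(j < t) j.+1 * s j == t)%N)
              a s * \prod_(j < t) V j.+1 tau ^+ s j.

(* Main.v *)
(** Decomposing U_term into partial fractions in x = e(z) = exp(2 pi i z), and using
    its invariance under x -> 1/x, writes 2 U_term as a linear combination of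
    h_i(z - b/N) + (-1)^(i+1) h_i(z + b/N), 0 <= i < k, b prime to N, where h_i(z) is
    the continuation of sum_(m >= 1) m^i e(m z); the constant term vanishes because
    Q(0) = 0 and deg Q < phi(N) k.  Summing over z = n tau gives, up to constants, the
    N-torsion values of
      W_i(z, tau) = h_i(z) + sum_(n >= 1) (h_i(n tau + z) + (-1)^(i+1) h_i(n tau - z)) + [i = 0]/2.
    W_0 is essentially the Weierstrass zeta function.  Its transformation under
    tau -> -1/tau follows from Euler's expansion of the cotangent by exchanging the
    order of an absolutely convergent double sum, and that of W_i by differentiating
    in z.  So the torsion values are Eisenstein series of weight i + 1, which
    SL2(Z) permutes up to the quasimodular correction of weight 2; on Gamma0(N) the row
    (0, b) goes to (0, d b), and diagonalizing b -> d b splits them according to the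
    Dirichlet characters mod N.  For N = 1 only odd i occur, and the singular
    torsion point 0 is replaced by the sum over the three points of order 2.

    The multiple sums are limits of elementary and complete symmetric polynomials in
    the U_term(q^n), whose power sums tend to the U_(sk; N)(Q^s; q); Newton's
    identities, which pass to the limit, express them isobarically in these. *)

Require Import Defs.
From HB Require Import structures.
From mathcomp Require Import all_boot all_order all_algebra all_field.
From mathcomp Require Import complex.
From mathcomp Require Import all_classical all_reals all_analysis.
From mathcomp Require Import ring lra zify.

Set Implicit Arguments.
Unset Strict Implicit.
Unset Printing Implicit Defensive.

Import Order.TTheory GRing.Theory Num.Theory.
Import numFieldNormedType.Exports.

Local Open Scope ring_scope.
Local Open Scope complex_scope.

(** * Complex exponential, limits and derivatives *)

Section ComplexModulus.
Variable R : realType.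
Implicit Types (x y z : R[i]) (a b : R).

(** Parity is what makes the sums modular. Up to a constant for [i = 0], [h i (- z)] is
    [(-1) ^+ i.+1 * h i z], so the symmetry of the summand pairs each one-sided series [T i] at a
    torsion point with the one at the opposite point, and exactly such pairs occur in [W i]. The
    obstacle is low weight: the lattice sums behind weights 1 and 2 do not converge absolutely.
    Hence a single lattice identity, the one for [W 0], is proved by summation, after subtracting a
    reference point where both sides are known; higher weights need no further lattice sum. The
    linear term [- z] in that identity is the source of both anomalies: in weight 1 it is absorbed
    by the correction in the definition of [eis], in weight 2 its derivative is the quasimodular
    term, and one more derivative removes it. Transformation laws are stated for all nonzero rows
    mod [N] at once, because the generators of SL2(Z) mix the rows; the same laws then control every
    cusp. *)

Definition cabs z : R := Normc.normc z.

(** The norm on [R[i]] takes its values in [R[i]], whose order is only partial; all estimates are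
    therefore made with the real number [cabs z]. *)
Lemma normE z : `|z| = (cabs z)%:C. Proof. by case: z. Qed.

Lemma cabs_ge0 z : 0 <= cabs z. Proof. by case: z => a b; exact: sqrtr_ge0. Qed.

Lemma cabs0 : cabs 0 = 0. Proof. exact: Normc.normc0. Qed.
Lemma cabs1 : cabs 1 = 1. Proof. exact: Normc.normc1. Qed.

Lemma cabs_eq0 z : (cabs z == 0) = (z == 0).
Proof.
by apply/eqP/eqP => [/Normc.eq0_normc //|->]; exact: cabs0.
Qed.

Lemma cabs_gt0 z : (0 < cabs z) = (z != 0).
Proof. by rewrite lt_neqAle cabs_ge0 andbT eq_sym cabs_eq0. Qed.

Lemma cabsM x y : cabs (x * y) = cabs x * cabs y. Proof. exact: Normc.normcM. Qed.
Lemma cabsV x : cabs x^-1 = (cabs x)^-1. Proof. exact: Normc.normcV. Qed.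
Lemma cabsN x : cabs (- x) = cabs x. Proof. exact: normcN. Qed.
Lemma cabsD x y : cabs (x + y) <= cabs x + cabs y. Proof. exact: le_normcD. Qed.
Lemma cabsB x y : cabs (x - y) <= cabs x + cabs y.
Proof. by rewrite -(cabsN y) cabsD. Qed.
Lemma cabsBC x y : cabs (x - y) = cabs (y - x).
Proof. by rewrite -cabsN opprB. Qed.

Lemma cabsX x n : cabs (x ^+ n) = cabs x ^+ n.
Proof. by elim: n => [|n IH]; rewrite ?expr0 ?cabs1// !exprS cabsM IH. Qed.

Lemma cabs_real a : cabs a%:C = `|a|.
Proof. by rewrite /cabs /= expr0n /= addr0 sqrtr_sqr. Qed.

Lemma cabs_nat n : cabs n%:R = n%:R.
Proof. by rewrite -[n%:R](rmorph_nat (real_complex R)) cabs_real ger0_norm. Qed.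

Lemma cabs_i : cabs 'i = 1.
Proof. by rewrite /cabs /= expr0n expr1n /= add0r sqrtr1. Qed.

Lemma cabs_sum I (r : seq I) (P : pred I) (F : I -> R[i]) :
  cabs (\sum_(i <- r | P i) F i) <= \sum_(i <- r | P i) cabs (F i).
Proof.
elim/big_ind2: _ => [|u a v b Hu Hv|//]; first by rewrite cabs0.
exact: le_trans (cabsD _ _) (lerD Hu Hv).
Qed.

Lemma cabs_lbD x y : cabs x - cabs y <= cabs (x + y).
Proof. by have := cabsB (x + y) y; rewrite addrK lerBlDr. Qed.

Lemma cabs_lbB x y : cabs x - cabs y <= cabs (x - y).
Proof. by have := cabs_lbD x (- y); rewrite cabsN. Qed.

Lemma ReC z : (complex.Re z)%:C + 'i * (complex.Im z)%:C = z.
Proof. by rewrite -complexE. Qed.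

Lemma Re_le_cabs z : `|complex.Re z| <= cabs z.
Proof. by have := normc_ge_Re z; rewrite normE lecR. Qed.

Lemma Im_le_cabs z : `|complex.Im z| <= cabs z.
Proof.
by have := Re_le_cabs (z * 'i); rewrite cabsM cabs_i mulr1 ReiNIm normrN.
Qed.

Lemma cabs_le_ReIm z : cabs z <= `|complex.Re z| + `|complex.Im z|.
Proof.
rewrite -{1}(ReC z); apply: le_trans (cabsD _ _) _.
by rewrite cabsM cabs_i mul1r !cabs_real.
Qed.

Lemma ReD x y : complex.Re (x + y) = complex.Re x + complex.Re y.
Proof. by case: x; case: y. Qed.
Lemma ImD x y : complex.Im (x + y) = complex.Im x + complex.Im y.
Proof. by case: x; case: y. Qed.
Lemma ReN x : complex.Re (- x) = - complex.Re x. Proof. by case: x. Qed.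
Lemma ImN x : complex.Im (- x) = - complex.Im x. Proof. by case: x. Qed.
Lemma ReB x y : complex.Re (x - y) = complex.Re x - complex.Re y.
Proof. by rewrite ReD ReN. Qed.
Lemma ImB x y : complex.Im (x - y) = complex.Im x - complex.Im y.
Proof. by rewrite ImD ImN. Qed.
Lemma ReMr a x : complex.Re (a%:C * x) = a * complex.Re x.
Proof. by case: x => u v /=; rewrite mul0r subr0. Qed.
Lemma ImMr a x : complex.Im (a%:C * x) = a * complex.Im x.
Proof. by case: x => u v /=; rewrite mul0r addr0. Qed.
Lemma Re_real a : complex.Re a%:C = a. Proof. by []. Qed.
Lemma Im_real a : complex.Im a%:C = 0. Proof. by []. Qed.
Lemma Re_sum I (r : seq I) (P : pred I) (F : I -> R[i]) :
  complex.Re (\sum_(i <- r | P i) F i) = \sum_(i <- r | P i) complex.Re (F i).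
Proof. by rewrite (big_morph _ ReD (erefl : complex.Re 0 = 0)). Qed.
Lemma Im_sum I (r : seq I) (P : pred I) (F : I -> R[i]) :
  complex.Im (\sum_(i <- r | P i) F i) = \sum_(i <- r | P i) complex.Im (F i).
Proof. by rewrite (big_morph _ ImD (erefl : complex.Im 0 = 0)). Qed.
Lemma natC n : (n%:R : R)%:C = n%:R. Proof. by rewrite rmorph_nat. Qed.
Lemma intC (n : int) : (n%:~R : R)%:C = n%:~R. Proof. by rewrite rmorph_int. Qed.

Lemma complex_eqP x y :
  complex.Re x = complex.Re y -> complex.Im x = complex.Im y -> x = y.
Proof. by case: x y => a b [c d] /= -> ->. Qed.

Lemma cabs_le_eps x : (forall e : R, 0 < e -> cabs x <= e) -> x = 0.
Proof.
move=> H; apply/eqP; rewrite -cabs_eq0; apply/eqP/le_anti.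
rewrite cabs_ge0 andbT leNgt; apply/negP => h.
by have /H := divr_gt0 h (ltr0n R 2); lra.
Qed.

End ComplexModulus.

(** * Elementary bounds for sine, cosine and the real exponential *)

Section RealBounds.
Variable R : realType.
Implicit Types a b x : R.

Lemma sin_le_id x : 0 <= x -> sin x <= x.
Proof.
move=> x0; have [->|xn] := eqVneq x 0; first by rewrite sin0.
have xp : 0 < x by rewrite lt_neqAle eq_sym xn.
have [c _] := @MVT R sin cos 0 x xp (fun u _ => is_derive_sin u)
   (continuous_subspaceT (@continuous_sin R)).
rewrite sin0 !subr0 => ->.
by have := cos_le1 c => h; rewrite -[leRHS]mul1r ler_wpM2r.
Qed.

Lemma norm_sin_le x : `|sin x| <= `|x|.
Proof.
wlog x0 : x / 0 <= x => [H|].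
  have [|/ltW] := leP 0 x; first exact: H.
  by rewrite -oppr_ge0 => /H; rewrite sinN !normrN.
rewrite (ger0_norm x0) ler_norml sin_le_id // andbT.
have [xs|xl] := leP x 1; last by have := sin_geN1 x; lra.
have := sin_ge0_pi (x := x); have := pi_ge2 R => h1 h2.
by have : 0 <= sin x by [apply: h2; lra]; lra.
Qed.

Lemma cos_sub1_le x : `|cos x - 1| <= x ^+ 2.
Proof.
have -> : cos x - 1 = - (2 * sin (x / 2) ^+ 2).
  have -> : cos x = cos ((x / 2) *+ 2) by rewrite -mulr_natr divfK.
  by rewrite cos_mulr2n cos2sin2; ring.
rewrite normrN normrM normrX (ger0_norm (_ : 0 <= 2)) //.
have h : `|sin (x / 2)| ^+ 2 <= `|x / 2| ^+ 2.
  by rewrite ler_pXn2r ?nnegrE //; exact: norm_sin_le.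
rewrite !real_normK ?num_real // in h *.
have -> : x ^+ 2 = 4 * (x / 2) ^+ 2 by field.
by have := sqr_ge0 (x / 2); lra.
Qed.

(** For [x > 0] the mean value theorem gives the difference as [(cos c - 1) * x] with [0 < c < x]. A
    remainder of order 2 is all that the expansion of [cexp] asks for. *)
Lemma sin_sub_le x : `|x| <= 1 -> `|sin x - x| <= x ^+ 2.
Proof.
wlog x0 : x / 0 <= x => [H|].
  have [|/ltW] := leP 0 x; first exact: H.
  rewrite -oppr_ge0 => /H; rewrite sinN !normrN sqrrN => {}H h.
  by rewrite -normrN opprB addrC; have := H h; rewrite opprK.
move=> x1; have [->|xn] := eqVneq x 0; first by rewrite sin0 subr0 normr0 expr0n.
have xp : 0 < x by rewrite lt_neqAle eq_sym xn.
have [c ci] := @MVT R sin cos 0 x xp (fun u _ => is_derive_sin u)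
   (continuous_subspaceT (@continuous_sin R)).
move: ci; rewrite in_itv /= => /andP[c0 cx].
rewrite sin0 !subr0 => ->.
have -> : cos c * x - x = (cos c - 1) * x by ring.
have hc := cos_sub1_le c; rewrite (ger0_norm x0) in x1.
rewrite normrM (ger0_norm x0); have : c ^+ 2 <= x by nra.
by move=> h; rewrite expr2 ler_wpM2r //; exact: le_trans hc h.
Qed.

(** Rests on [1 + x <= expR x] alone, taken at [a] for the lower bound and at [- a] for the upper
    one, [expR a * (1 - a) <= 1]. *)
Lemma expR_sub_le a : `|a| <= 1 / 2 -> `|expR a - 1 - a| <= 2 * a ^+ 2.
Proof.
move=> ha; have h1 := expR_ge1Dx a; have h2 := expR_ge1Dx (- a).
have /andP[a1 a2] : - (1/2) <= a <= 1/2 by rewrite -ler_norml.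
have ep := expR_gt0 a.
have : expR a * (1 - a) <= 1.
  have e1 : expR a * expR (- a) = 1 by rewrite -expRD subrr expR0.
  by rewrite -[leRHS]e1 ler_wpM2l // ltW.
rewrite ger0_norm; last lra.
move=> h; have : expR a <= 2 by nra.
have : (expR a - 1 - a) * (1 - a) <= a ^+ 2 by nra.
nra.
Qed.

End RealBounds.

Section ComplexExponential.
Variable R : realType.
Implicit Types z w : R[i].

Lemma cexpD z w : cexp (z + w) = cexp z * cexp w.
Proof.
rewrite /cexp ReD ImD expRD cosD sinD mulrACA -rmorphM; congr (_ * _).
by apply/eqP; rewrite eq_complex /= !eqxx /= addrC.
Qed.

Lemma cexp0 : cexp (0 : R[i]) = 1.
Proof. by rewrite /cexp /= expR0 cos0 sin0 mul1r. Qed.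

Lemma cabs_cexp z : cabs (cexp z) = expR (complex.Re z).
Proof.
rewrite /cexp cabsM cabs_real ger0_norm ?expR_ge0 // /cabs /=.
by rewrite cos2Dsin2 sqrtr1 mulr1.
Qed.

Lemma cexp_neq0 z : cexp z != 0.
Proof. by rewrite -cabs_gt0 cabs_cexp expR_gt0. Qed.

Lemma cexpN z : cexp (- z) = (cexp z)^-1.
Proof.
by apply: (mulfI (cexp_neq0 z)); rewrite -cexpD subrr cexp0 mulfV ?cexp_neq0.
Qed.

(** The real and the imaginary part contribute at most [4 * m ^+ 2] each, so 10 is a generous
    constant. *)
Lemma cexp_sub1_sub_le w :
  cabs w <= 1 / 2 -> cabs (cexp w - 1 - w) <= 10 * cabs w ^+ 2.
Proof.
move=> hw; set m := cabs w; have m0 : 0 <= m := cabs_ge0 w.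
set a := complex.Re w; set b := complex.Im w.
have ha : `|a| <= m := Re_le_cabs w.
have hb : `|b| <= m := Im_le_cabs w.
have e2 : `|expR a - 1 - a| <= 2 * m ^+ 2.
  apply: le_trans (expR_sub_le (le_trans ha hw)) _.
  by rewrite ler_pM2l // -real_normK ?num_real // ler_pXn2r ?nnegrE.
have e1 : `|expR a - 1| <= 2 * m.
  have -> : expR a - 1 = (expR a - 1 - a) + a by ring.
  by apply: le_trans (ler_normD _ _) _; rewrite -/m in hw; nra.
have e0 : 0 <= expR a <= 2.
  rewrite expR_ge0 /=; have := ler_norm (expR a - 1); rewrite -/m in hw; lra.
have hb2 : b ^+ 2 <= m ^+ 2 by rewrite -real_normK ?num_real // ler_pXn2r ?nnegrE.
have c1 : `|cos b - 1| <= m ^+ 2 := le_trans (cos_sub1_le b) hb2.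
have s1 : `|sin b - b| <= m ^+ 2.
  apply: le_trans (sin_sub_le _) hb2; rewrite -/m in hw; lra.
apply: le_trans (cabs_le_ReIm _) _.
have -> : complex.Re (cexp w - 1 - w) = (expR a - 1 - a) + expR a * (cos b - 1).
  by rewrite !ReB /cexp ReMr /= -/a -/b; ring.
have -> : complex.Im (cexp w - 1 - w) = expR a * (sin b - b) + (expR a - 1) * b.
  by rewrite !ImB /cexp ImMr /= -/a -/b; ring.
move/andP: e0 => [e00 e02].
have t1 : `|(expR a - 1 - a) + expR a * (cos b - 1)| <= 2 * m ^+ 2 + 2 * m ^+ 2.
  apply: le_trans (ler_normD _ _) _; rewrite normrM (ger0_norm e00).
  by apply: lerD => //; apply: ler_pM.
have t2 : `|expR a * (sin b - b) + (expR a - 1) * b| <= 2 * m ^+ 2 + 2 * m * m.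
  apply: le_trans (ler_normD _ _) _; rewrite !normrM (ger0_norm e00).
  by apply: lerD => //; apply: ler_pM.
nra.
Qed.

End ComplexExponential.

(** * The nome and its modulus *)

Section Nome.
Variable R : realType.
Implicit Types z w : R[i].

Definition tpi : R[i] := 0 +i* (2 * pi).

(** The modulus of [nome z] as a function of [Im z]; all decay towards the cusp at infinity is
    measured by it. *)
Definition rho (y : R) : R := expR (- (2 * pi * y)).

Lemma tpiE : 2 * (pi : R)%:C * 'i = tpi.
Proof.
apply: complex_eqP; rewrite -natC -rmorphM ?ReMr ?ImMr /=.
  by rewrite mulr0.
by rewrite mulr1.
Qed.

Lemma nomeE z : nome z = cexp (tpi * z). Proof. by rewrite /nome tpiE. Qed.

Lemma tpi_neq0 : tpi != 0.
Proof.
by rewrite eq_complex /= eqxx /= mulf_neq0 // ?pnatr_eq0 // gt_eqF ?pi_gt0.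
Qed.

Lemma Re_tpiM z : complex.Re (tpi * z) = - (2 * pi * complex.Im z).
Proof. by case: z => a b /=; rewrite mul0r sub0r. Qed.

Lemma Im_tpiM z : complex.Im (tpi * z) = 2 * pi * complex.Re z.
Proof. by case: z => a b /=; rewrite mul0r add0r. Qed.

Lemma nomeD z w : nome (z + w) = nome z * nome w.
Proof. by rewrite !nomeE mulrDr cexpD. Qed.

Lemma nome0 : nome (0 : R[i]) = 1. Proof. by rewrite nomeE mulr0 cexp0. Qed.

Lemma nomeN z : nome (- z) = (nome z)^-1.
Proof. by rewrite !nomeE mulrN cexpN. Qed.

Lemma nomeB z w : nome (z - w) = nome z / nome w.
Proof. by rewrite nomeD nomeN. Qed.

Lemma nome_neq0 z : nome z != 0. Proof. exact: cexp_neq0. Qed.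

Lemma cabs_nome z : cabs (nome z) = rho (complex.Im z).
Proof. by rewrite nomeE cabs_cexp Re_tpiM. Qed.

Lemma nomeX z n : nome z ^+ n = nome (n%:R * z).
Proof.
elim: n => [|n IH]; first by rewrite expr0 mul0r nome0.
by rewrite exprS IH -nomeD -[in RHS]natr1 mulrDl mul1r addrC.
Qed.

Lemma nome1 : nome (1 : R[i]) = 1.
Proof.
rewrite nomeE mulr1 /cexp /= expR0 mul1r.
by rewrite mulr_natl cos2pi sin2pi.
Qed.

Lemma nome_nat n : nome (n%:R : R[i]) = 1.
Proof. by rewrite -[n%:R]mulr1 -nomeX nome1 expr1n. Qed.

Lemma nome_int (n : int) : nome (n%:~R : R[i]) = 1.
Proof.
case: n => n; first by rewrite -pmulrn nome_nat.
by rewrite NegzE mulrNz -pmulrn nomeN nome_nat invr1.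
Qed.

Lemma nomeDint z (n : int) : nome (z + n%:~R) = nome z.
Proof. by rewrite nomeD nome_int mulr1. Qed.

Lemma rho_ge0 y : 0 <= rho y. Proof. exact: expR_ge0. Qed.

Lemma rhoD x y : rho (x + y) = rho x * rho y.
Proof. by rewrite /rho -expRD; congr expR; ring. Qed.

Lemma rho_nat n y : rho (n%:R * y) = rho y ^+ n.
Proof.
elim: n => [|n IH]; first by rewrite expr0 mul0r /rho mulr0 oppr0 expR0.
by rewrite exprS -IH -rhoD -[in LHS]natr1 mulrDl mul1r addrC.
Qed.

Lemma rho_lt1 y : 0 < y -> rho y < 1.
Proof.
by move=> y0; rewrite /rho expR_lt1 oppr_lt0 !mulr_gt0 ?pi_gt0.
Qed.

Lemma rho_le x y : x <= y -> rho y <= rho x.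
Proof. by move=> xy; rewrite ler_expR lerN2 ler_wpM2l // mulr_ge0 ?pi_ge0. Qed.

Lemma rho_le1 y : 0 <= y -> rho y <= 1.
Proof. by move=> /rho_le; rewrite {2}/rho mulr0 oppr0 expR0. Qed.

Lemma nome_neq1_Im z : complex.Im z != 0 -> nome z != 1.
Proof.
move=> h; apply/eqP => /(congr1 (@cabs R)); rewrite cabs_nome cabs1.
have {}h : - (2 * pi * complex.Im z) != 0.
  by rewrite oppr_eq0 !mulf_neq0 ?pnatr_eq0 // gt_eqF ?pi_gt0.
rewrite /rho => e; have : ln (expR (- (2 * pi * complex.Im z))) = 0.
  by rewrite e ln1.
by rewrite expRK => /eqP; rewrite (negPf h).
Qed.

(** The real part of [nome b] is [1 - 2 * sin (pi * b) ^+ 2], and [sin] has no zero strictly between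
    0 and [pi]. *)
Lemma nome_real_neq1 (b : R) : b != 0 -> `|b| < 1 -> nome b%:C != 1.
Proof.
wlog b0 : b / 0 < b => [H bn b1|].
  have [b0|b0] := ltP 0 b; first exact: H.
  have : nome (- b)%:C != 1 :> R[i].
    by apply: H; rewrite ?oppr_eq0 ?normrN // oppr_gt0 lt_neqAle bn.
  by apply: contra => /eqP E; rewrite rmorphN nomeN E invr1.
move=> _ b1; apply/eqP; rewrite nomeE /cexp.
have -> : tpi * b%:C = 0 +i* (2 * pi * b) :> R[i].
  by apply/eqP; rewrite eq_complex /= !mulr0 !mul0r subrr add0r !eqxx.
rewrite /= expR0 mul1r => /eqP; rewrite eq_complex /= => /andP[/eqP + _].
have -> : 2 * pi * b = (pi * b) *+ 2 by ring.
rewrite cos_mulr2n cos2sin2 => h.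
have s0 : sin (pi * b) = 0 by apply/eqP; rewrite -sqrf_eq0; apply/eqP; lra.
have : 0 < sin (pi * b).
  apply: sin_gt0_pi; rewrite mulr_gt0 ?pi_gt0 //=.
  by rewrite -[ltRHS]mulr1 ltr_pM2l ?pi_gt0 // -(ger0_norm (ltW b0)).
by rewrite s0 ltxx.
Qed.

Lemma nome_sub1_le w : cabs (tpi * w) <= 1 / 2 ->
  cabs (nome w - 1 - tpi * w) <= 10 * cabs (tpi * w) ^+ 2.
Proof. rewrite nomeE; exact: cexp_sub1_sub_le. Qed.

(** On this range the quadratic remainder is at most 5 times the modulus, to which the linear term
    adds 1. *)
Lemma nome_sub1_lin w : cabs (tpi * w) <= 1 / 2 ->
  cabs (nome w - 1) <= 6 * cabs (tpi * w).
Proof.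
move=> h; have h2 := nome_sub1_le h.
have -> : nome w - 1 = (nome w - 1 - tpi * w) + tpi * w by ring.
apply: le_trans (cabsD _ _) _; have := cabs_ge0 (tpi * w) => h0.
apply: le_trans (lerD h2 (lexx _)) _; nra.
Qed.

End Nome.

Arguments tpi {R}.

(** * Limits of complex sequences *)

Section Limits.
Variable R : realType.
Implicit Types (u v : nat -> R[i]) (l k : R[i]) (e : R).

(** Convergence with real tolerances; [ccvg_limn] translates it into the [limn] that defines the
    multiple sums. *)
Definition ccvg u l := forall e, 0 < e ->
  exists n0, forall n, (n0 <= n)%N -> cabs (u n - l) <= e.

Lemma ccvg_unique u l k : ccvg u l -> ccvg u k -> l = k.
Proof.
move=> hl hk; apply/eqP; rewrite -subr_eq0; apply/eqP/cabs_le_eps => e e0.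
have [n1 h1] := hl _ (divr_gt0 e0 (ltr0n R 2)).
have [n2 h2] := hk _ (divr_gt0 e0 (ltr0n R 2)).
have {}h1 := h1 _ (leq_maxl n1 n2); have {}h2 := h2 _ (leq_maxr n1 n2).
set n := maxn n1 n2 in h1 h2.
have -> : l - k = (u n - k) - (u n - l) by ring.
by apply: le_trans (cabsB _ _) _; lra.
Qed.

Lemma ccvg_cst l : ccvg (fun=> l) l.
Proof. by move=> e e0; exists 0%N => n _; rewrite subrr cabs0 ltW. Qed.

Lemma ccvg_eq n0 u v l : (forall n, (n0 <= n)%N -> u n = v n) ->
  ccvg u l -> ccvg v l.
Proof.
move=> uv hu e /hu[n1 h]; exists (maxn n0 n1) => n; rewrite geq_max.
by move=> /andP[/uv <- /h].
Qed.

Lemma ccvg_ext u v l : (forall n, u n = v n) -> ccvg u l -> ccvg v l.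
Proof. by move=> uv; apply: (@ccvg_eq 0%N) => n _. Qed.

Lemma ccvg_comp u l (p : nat -> nat) :
  (forall n, (n <= p n)%N) -> ccvg u l -> ccvg (fun n => u (p n)) l.
Proof.
move=> hp hu e /hu[n0 h]; exists n0 => n hn; apply: h.
exact: leq_trans hn (hp n).
Qed.

Lemma ccvgD u v l k : ccvg u l -> ccvg v k -> ccvg (fun n => u n + v n) (l + k).
Proof.
move=> hl hk e e0.
have [n1 h1] := hl _ (divr_gt0 e0 (ltr0n R 2)).
have [n2 h2] := hk _ (divr_gt0 e0 (ltr0n R 2)).
exists (maxn n1 n2) => n; rewrite geq_max => /andP[/h1 {}h1 /h2 {}h2].
have -> : u n + v n - (l + k) = (u n - l) + (v n - k) by ring.
by apply: le_trans (cabsD _ _) _; lra.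
Qed.

Lemma ccvg_sub u l : ccvg (fun n => u n - l) 0 -> ccvg u l.
Proof. by move=> h e /h[n0 {}h]; exists n0 => n /h; rewrite subr0. Qed.

Lemma ccvg_bound u l (c : R) : ccvg u l -> (forall n, cabs (u n) <= c) ->
  cabs l <= c.
Proof.
move=> hl hc; apply/ler_addgt0Pr => e /hl[n /(_ n (leqnn n)) h].
have -> : l = u n - (u n - l) by ring.
by apply: le_trans (cabsB _ _) _; apply: lerD.
Qed.

Lemma ccvg_bound_ev n0 u l (c : R) : ccvg u l ->
  (forall n, (n0 <= n)%N -> cabs (u n) <= c) -> cabs l <= c.
Proof.
move=> hl hc; apply: (@ccvg_bound (fun n => u (n + n0)%N)).
  by apply: ccvg_comp hl => n; exact: leq_addr.
by move=> n; apply: hc; exact: leq_addl.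
Qed.

Lemma ccvg_bounded u l : ccvg u l ->
  exists2 n0, 0 < cabs l + 1 & forall n, (n0 <= n)%N -> cabs (u n) <= cabs l + 1.
Proof.
move=> /(_ 1 ltr01)[n0 h]; exists n0; first by have := cabs_ge0 l; lra.
move=> n /h hn; have -> : u n = l + (u n - l) by ring.
by apply: le_trans (cabsD _ _) _; lra.
Qed.

Lemma ccvgM u v l k : ccvg u l -> ccvg v k -> ccvg (fun n => u n * v n) (l * k).
Proof.
move=> hl hk e e0.
have [n0 B0 hB] := ccvg_bounded hl.
have K0 : 0 < cabs k + 1 by have := cabs_ge0 k; lra.
have [n1 h1] := hl _ (divr_gt0 (divr_gt0 e0 (ltr0n R 2)) K0).
have [n2 h2] := hk _ (divr_gt0 (divr_gt0 e0 (ltr0n R 2)) B0).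
exists (maxn n0 (maxn n1 n2)) => n; rewrite !geq_max.
move=> /and3P[/hB {}hB /h1 {}h1 /h2 {}h2].
have -> : u n * v n - l * k = u n * (v n - k) + (u n - l) * k by ring.
apply: le_trans (cabsD _ _) _; rewrite !cabsM.
have -> : e = (cabs l + 1) * (e / 2 / (cabs l + 1))
            + (e / 2 / (cabs k + 1)) * (cabs k + 1).
  by field; rewrite !gt_eqF.
apply: lerD; apply: ler_pM; rewrite ?cabs_ge0 //.
by have := cabs_ge0 k; lra.
Qed.

Lemma ccvgZ a u l : ccvg u l -> ccvg (fun n => a * u n) (a * l).
Proof. exact/ccvgM/ccvg_cst. Qed.

Lemma ccvgN u l : ccvg u l -> ccvg (fun n => - u n) (- l).
Proof.
by move=> /(ccvgZ (-1)); rewrite mulN1r; apply: ccvg_ext => n; rewrite mulN1r.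
Qed.

Lemma ccvgB u v l k : ccvg u l -> ccvg v k -> ccvg (fun n => u n - v n) (l - k).
Proof. by move=> hu /ccvgN; exact: ccvgD. Qed.

Lemma ccvg_sum I (r : seq I) (P : pred I) (F : nat -> I -> R[i]) (L : I -> R[i]) :
  (forall i, P i -> ccvg (F ^~ i) (L i)) ->
  ccvg (fun n => \sum_(i <- r | P i) F n i) (\sum_(i <- r | P i) L i).
Proof.
move=> h; elim: r => [|i r IH].
  by rewrite big_nil; apply: ccvg_ext (ccvg_cst 0) => n; rewrite big_nil.
rewrite big_cons; case: ifP => Pi; last first.
  by apply: ccvg_ext IH => n; rewrite big_cons Pi.
by apply: ccvg_ext (ccvgD (h i Pi) IH) => n; rewrite big_cons Pi.
Qed.

Lemma ccvgV u l : l != 0 -> ccvg u l -> ccvg (fun n => (u n)^-1) l^-1.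
Proof.
rewrite -cabs_gt0 => l0 hu e e0.
have [n1 h1] := hu _ (divr_gt0 l0 (ltr0n R 2)).
have ee : 0 < e * (cabs l ^+ 2 / 2) by rewrite mulr_gt0 // divr_gt0 // exprn_gt0.
have [n2 h2] := hu _ ee.
exists (maxn n1 n2) => n; rewrite geq_max => /andP[/h1 {}h1 /h2 {}h2].
have hn : cabs l / 2 <= cabs (u n).
  have -> : u n = l + (u n - l) by ring.
  by have := cabs_lbD l (u n - l); lra.
have un0 : u n != 0 by rewrite -cabs_gt0; lra.
have ln0 : l != 0 by rewrite -cabs_gt0.
have -> : (u n)^-1 - l^-1 = - (u n - l) / (u n * l) by field; rewrite ?un0 ?ln0.
rewrite cabsM cabsV cabsN cabsM ler_pdivrMr ?mulr_gt0 ?cabs_gt0 //.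
apply: le_trans h2 _; rewrite ler_pM2l //; nra.
Qed.

Lemma ccvg_cvg u l : ccvg u l ->
  ((u : nat -> (R[i])^o) @ \oo --> (l : (R[i])^o))%classic.
Proof.
move=> h; apply/cvgrPdist_le => /= e e0.
have er : (complex.Re e)%:C = e by apply: RRe_real; rewrite gtr0_real.
have /h[n0 {}h] : 0 < complex.Re e by rewrite -ltcR er.
near=> n; rewrite -opprB normrN normE -er lecR; apply: h.
by near: n; exact: nbhs_infty_ge.
Unshelve. all: by end_near. Qed.

Lemma ccvg_limn u l : ccvg u l -> limn (u : nat -> (R[i])^o) = l.
Proof. by move=> /ccvg_cvg; exact: cvg_lim. Qed.

End Limits.

(** * Dominated series *)

Section Series.
Variable R : realType.
Implicit Types (f g : nat -> R[i]) (b : nat -> R).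

Definition sumbd b := exists M : R, forall n, \sum_(i < n) b i <= M.

(** Taken componentwise so that completeness of [R] yields convergence; every property of it is
    proved under a summable majorant. *)
Definition csum f : R[i] :=
  limn (series (fun n => complex.Re (f n))) +i*
  limn (series (fun n => complex.Im (f n))).

Lemma sumbd_le b1 b2 : (forall n, b1 n <= b2 n) -> sumbd b2 -> sumbd b1.
Proof.
move=> h [M hM]; exists M => n; apply: le_trans (hM n).
by apply: ler_sum => i _.
Qed.

Lemma sumbdZ b a : 0 <= a -> sumbd b -> sumbd (fun n => a * b n).
Proof.
move=> a0 [M hM]; exists (a * M) => n; rewrite -mulr_sumr ler_wpM2l //.
Qed.

Lemma sumbdD b1 b2 : sumbd b1 -> sumbd b2 -> sumbd (fun n => b1 n + b2 n).
Proof.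
move=> [M hM] [K hK]; exists (M + K) => n; rewrite big_split /=.
exact: lerD (hM n) (hK n).
Qed.

Lemma real_cvg_bd (u : nat -> R) b : (forall n, `|u n| <= b n) -> sumbd b ->
  cvgn (series u).
Proof.
move=> ub [M hM]; apply: normed_cvg.
apply: nondecreasing_is_cvgn.
  by apply: nondecreasing_series => n _ _; exact: normr_ge0.
exists M => _ [n _ <-]; apply: le_trans (hM n).
have -> : [normed series u] n = \sum_(0 <= k < n) `|u k| by [].
by rewrite big_mkord; apply: ler_sum.
Qed.

Lemma csum_cvg f b : (forall n, cabs (f n) <= b n) -> sumbd b ->
  ccvg (fun n => \sum_(i < n) f i) (csum f).
Proof.
move=> fb hb e e0.
have hre : cvgn (series (fun n => complex.Re (f n))).
  by apply: real_cvg_bd hb => n; exact: le_trans (Re_le_cabs _) (fb n).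
have him : cvgn (series (fun n => complex.Im (f n))).
  by apply: real_cvg_bd hb => n; exact: le_trans (Im_le_cabs _) (fb n).
have e2 : 0 < e / 2 by lra.
move/cvgrPdist_le: hre => /(_ _ e2)[n1 _ h1].
move/cvgrPdist_le: him => /(_ _ e2)[n2 _ h2].
exists (maxn n1 n2) => n; rewrite geq_max => /andP[/h1 {}h1 /h2 {}h2].
move: h1 h2; rewrite !seriesEord /= => h1 h2.
rewrite -cabsN opprB; apply: le_trans (cabs_le_ReIm _) _.
rewrite ReB ImB Re_sum Im_sum /csum !seriesEord /=; lra.
Qed.

Lemma csum_unique f b l : (forall n, cabs (f n) <= b n) -> sumbd b ->
  ccvg (fun n => \sum_(i < n) f i) l -> csum f = l.
Proof. by move=> h1 h2; apply: ccvg_unique; exact: csum_cvg h1 h2. Qed.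

Lemma csum_le f b M : (forall n, cabs (f n) <= b n) ->
  (forall n, \sum_(i < n) b i <= M) -> cabs (csum f) <= M.
Proof.
move=> fb hM; apply: (ccvg_bound (csum_cvg fb _)); first by exists M.
move=> n; apply: le_trans (cabs_sum _ _ _) _; apply: le_trans (hM n).
by apply: ler_sum.
Qed.

Lemma csumZ a f b : (forall n, cabs (f n) <= b n) -> sumbd b ->
  csum (fun n => a * f n) = a * csum f.
Proof.
move=> hf hb; apply: (@csum_unique _ (fun n => cabs a * b n)).
- by move=> n; rewrite cabsM ler_wpM2l ?cabs_ge0.
- by apply: sumbdZ => //; exact: cabs_ge0.
- by apply: ccvg_ext (ccvgZ a (csum_cvg hf hb)) => n; rewrite mulr_sumr.
Qed.

Lemma csumS f b : (forall n, cabs (f n) <= b n) -> sumbd b ->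
  csum f = f 0%N + csum (fun n => f n.+1).
Proof.
move=> hf [M hb].
have hS : sumbd (fun n => b n.+1).
  exists M => n; apply: le_trans (hb n.+1).
  by rewrite big_ord_recl lerDr (le_trans (cabs_ge0 _) (hf 0%N)).
apply: (csum_unique hf); first by exists M.
have h := ccvgD (ccvg_cst (f 0%N)) (csum_cvg (fun n => hf n.+1) hS).
move=> e /h[n0 {}h]; exists n0.+1 => -[//|n] /h.
by rewrite big_ord_recl.
Qed.

Lemma eq_csum f g : (forall n, f n = g n) -> csum f = csum g.
Proof. by move=> h; congr csum; apply/funext. Qed.

Lemma sumbd_geom (r : R) : 0 <= r < 1 -> sumbd (fun n => r ^+ n).
Proof.
move=> /andP[r0 r1]; exists (1 - r)^-1 => n.
have p : 0 < 1 - r by lra.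
rewrite -(ler_pM2l p) divff ?gt_eqF //.
have -> : (1 - r) * (\sum_(i < n) r ^+ i) = 1 - r ^+ n.
  by rewrite -[1 in RHS](expr1n _ n) subrXX; congr (_ * _); apply: eq_bigr => i _; rewrite expr1n mul1r.
by rewrite gerBl exprn_ge0.
Qed.

Lemma sumbd_invsq : sumbd (fun n => (n.+1%:R ^+ 2)^-1).
Proof.
(* The bound 2 alone is not inductive; the sharper one telescopes. *)
have h n : \sum_(i < n.+1) ((i.+1%:R ^+ 2)^-1 : R) <= 2 - n.+1%:R^-1.
  elim: n => [|n IH]; first by rewrite big_ord1 expr1n invr1; lra.
  rewrite big_ord_recr /=; apply: le_trans (lerD IH (lexx _)) _.
  have p1 : 0 < n.+1%:R :> R by rewrite ltr0n.
  rewrite -[n.+2%:R]natr1; set x : R := n.+1%:R in p1 *.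
  rewrite -subr_ge0.
  have -> : 2 - (x + 1)^-1 - (2 - x^-1 + ((x + 1) ^+ 2)^-1) = (x * (x + 1) ^+ 2)^-1.
    by field; rewrite !gt_eqF //=; lra.
  by rewrite invr_ge0 mulr_ge0 ?sqr_ge0 // ltW.
exists 2 => -[|n]; first by rewrite big_ord0.
by apply: le_trans (h n) _; rewrite gerBl invr_ge0.
Qed.

End Series.

(** * Complex derivatives by first-order remainders *)

Section ComplexDerivative.
Variable R : realType.
Implicit Types (f g : R[i] -> R[i]) (z w l k a : R[i]).

(** Without a quotient, [h = 0] is no exception and remainders can be added and multiplied
    directly. *)
Definition cder f z l := forall e : R, 0 < e -> exists2 d : R, 0 < d &
  forall h, cabs h <= d -> cabs (f (z + h) - f z - h * l) <= e * cabs h.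

Lemma cder_local d f g z l : 0 < d ->
  (forall h, cabs h <= d -> f (z + h) = g (z + h)) -> cder f z l -> cder g z l.
Proof.
move=> d0 fg hf e /hf[d1 d10 h1]; exists (Num.min d d1); first by rewrite lt_min d0.
move=> h; rewrite le_min => /andP[hd hd1].
have := fg 0; rewrite cabs0 addr0 => <-; last exact: ltW.
by rewrite -fg //; exact: h1.
Qed.

Lemma cder_ext f g z l : (forall x, f x = g x) -> cder f z l -> cder g z l.
Proof. by move=> fg; apply: (cder_local ltr01) => h _. Qed.

(** With [cder_local], this allows an identity valid near [z] to be differentiated, which is how the
    laws for [h i] and [W i] pass from [i] to [i.+1]. *)
Lemma cder_unique f z l k : cder f z l -> cder f z k -> l = k.
Proof.
move=> hl hk; apply/eqP; rewrite -subr_eq0; apply/eqP/cabs_le_eps => e e0.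
have e2 : 0 < e / 2 by lra.
have [d1 d10 h1] := hl _ e2; have [d2 d20 h2] := hk _ e2.
set d := Num.min d1 d2; have d0 : 0 < d by rewrite lt_min d10.
have hd : cabs d%:C = d by rewrite cabs_real ger0_norm // ltW.
have {}h1 : cabs (f (z + d%:C) - f z - d%:C * l) <= e / 2 * d.
  by rewrite -[X in _ <= _ * X]hd; apply: h1; rewrite hd /d ge_min lexx.
have {}h2 : cabs (f (z + d%:C) - f z - d%:C * k) <= e / 2 * d.
  by rewrite -[X in _ <= _ * X]hd; apply: h2; rewrite hd /d ge_min lexx orbT.
rewrite -(ler_pM2l d0) -{1}hd -cabsM.
have -> : d%:C * (l - k) = (f (z + d%:C) - f z - d%:C * k)
  - (f (z + d%:C) - f z - d%:C * l) by ring.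
by apply: le_trans (cabsB _ _) _; lra.
Qed.

(** Quadratic remainders are what term-by-term estimates of a series supply, since their constants
    can be summed. *)
Lemma cder_sq f z l (d C : R) : 0 < d ->
  (forall h, cabs h <= d -> cabs (f (z + h) - f z - h * l) <= C * cabs h ^+ 2) ->
  cder f z l.
Proof.
move=> d0 H e e0; have C0 : 0 < `|C| + 1 by have := normr_ge0 C; lra.
exists (Num.min d (e / (`|C| + 1))); first by rewrite lt_min d0 divr_gt0.
move=> h; rewrite le_min => /andP[/H {}H hd]; apply: le_trans H _.
rewrite expr2 mulrA ler_wpM2r ?cabs_ge0 //.
apply: (@le_trans _ _ ((`|C| + 1) * cabs h)).
  by rewrite ler_wpM2r ?cabs_ge0 //; have := ler_norm C; lra.
by rewrite mulrC -ler_pdivlMr.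
Qed.

Lemma cder_cst k z : cder (fun=> k) z 0.
Proof.
apply: (@cder_sq _ _ _ 1 0) => // h _.
by rewrite subrr mulr0 subr0 cabs0 mul0r.
Qed.

Lemma cder_id z : cder id z 1.
Proof.
apply: (@cder_sq _ _ _ 1 0) => // h _.
have -> : id (z + h) - id z - h * 1 = 0 by rewrite /=; ring.
by rewrite cabs0 mul0r.
Qed.

Lemma cderD f g z l k : cder f z l -> cder g z k ->
  cder (fun x => f x + g x) z (l + k).
Proof.
move=> hf hg e e0; have e2 : 0 < e / 2 by lra.
have [d1 d10 h1] := hf _ e2; have [d2 d20 h2] := hg _ e2.
exists (Num.min d1 d2); first by rewrite lt_min d10.
move=> h; rewrite le_min => /andP[/h1 {}h1 /h2 {}h2].
have -> : f (z + h) + g (z + h) - (f z + g z) - h * (l + k) =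
  (f (z + h) - f z - h * l) + (g (z + h) - g z - h * k) by ring.
by apply: le_trans (cabsD _ _) _; lra.
Qed.

Lemma cder_lip f z l : cder f z l -> exists2 d : R, 0 < d &
  forall h, cabs h <= d -> cabs (f (z + h) - f z) <= (cabs l + 1) * cabs h.
Proof.
move=> /(_ 1 ltr01)[d d0 H]; exists d => // h /H {}H.
have -> : f (z + h) - f z = (f (z + h) - f z - h * l) + h * l by ring.
apply: le_trans (cabsD _ _) _; rewrite cabsM.
by have := cabs_ge0 h; nra.
Qed.

Lemma cder_cont f z l : cder f z l -> forall e : R, 0 < e -> exists2 d : R, 0 < d &
  forall h, cabs h <= d -> cabs (f (z + h) - f z) <= e.
Proof.
move=> /cder_lip[d d0 H] e e0; have L0 : 0 < cabs l + 1 by have := cabs_ge0 l; lra.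
exists (Num.min d (e / (cabs l + 1))); first by rewrite lt_min d0 divr_gt0.
move=> h; rewrite le_min => /andP[/H {}H hd]; apply: le_trans H _.
by rewrite mulrC -ler_pdivlMr.
Qed.

Lemma cderM f g z l k : cder f z l -> cder g z k ->
  cder (fun x => f x * g x) z (l * g z + f z * k).
Proof.
move=> hf hg e e0.
have G0 : 0 < cabs (g z) + 1 by have := cabs_ge0 (g z); lra.
have F0 : 0 < cabs (f z) + 1 by have := cabs_ge0 (f z); lra.
have K0 : 0 < cabs l + 1 by have := cabs_ge0 l; lra.
have e3 : 0 < e / 3 by lra.
have [d1 d10 h1] := hf _ (divr_gt0 e3 G0).
have [d2 d20 h2] := hg _ (divr_gt0 e3 F0).
have [d3 d30 h3] := cder_cont hg (divr_gt0 e3 K0).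
have [d4 d40 h4] := cder_cont hg ltr01.
exists (Num.min (Num.min d1 d2) (Num.min d3 d4)).
  by rewrite !lt_min d10 d20 d30.
move=> h; rewrite !le_min => /andP[/andP[/h1 {}h1 /h2 {}h2] /andP[/h3 {}h3 /h4 {}h4]].
have -> : f (z + h) * g (z + h) - f z * g z - h * (l * g z + f z * k) =
  (f (z + h) - f z - h * l) * g (z + h) + f z * (g (z + h) - g z - h * k)
  + h * l * (g (z + h) - g z) by ring.
have hg4 : cabs (g (z + h)) <= cabs (g z) + 1.
  have -> : g (z + h) = g z + (g (z + h) - g z) by ring.
  by apply: le_trans (cabsD _ _) _; lra.
have ch := cabs_ge0 h.
have -> : e * cabs h = e / 3 / (cabs (g z) + 1) * cabs h * (cabs (g z) + 1)
   + (cabs (f z) + 1) * (e / 3 / (cabs (f z) + 1) * cabs h)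
   + cabs h * (cabs l + 1) * (e / 3 / (cabs l + 1)).
  by field; rewrite !gt_eqF.
apply: le_trans (cabsD _ _) _; apply: lerD; first apply: le_trans (cabsD _ _) _.
  apply: lerD; rewrite cabsM; apply: ler_pM => //; rewrite ?cabs_ge0 //; lra.
rewrite !cabsM; apply: ler_pM => //; rewrite ?mulr_ge0 ?cabs_ge0 //.
by rewrite ler_wpM2l //; lra.
Qed.

Lemma cderZ a f z l : cder f z l -> cder (fun x => a * f x) z (a * l).
Proof.
by move=> h; have := cderM (cder_cst a z) h; rewrite mul0r add0r.
Qed.

Lemma cderN f z l : cder f z l -> cder (fun x => - f x) z (- l).
Proof.
move=> /(cderZ (-1)); rewrite mulN1r; apply: cder_ext => x; exact: mulN1r.
Qed.

Lemma cderB f g z l k : cder f z l -> cder g z k ->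
  cder (fun x => f x - g x) z (l - k).
Proof. by move=> hf /cderN; exact: cderD. Qed.

Lemma cder_lin f a b z l : cder f (a * z + b) l ->
  cder (fun x => f (a * x + b)) z (a * l).
Proof.
move=> hf e e0; have A0 : 0 < cabs a + 1 by have := cabs_ge0 a; lra.
have [d d0 H] := hf _ (divr_gt0 e0 A0).
exists (d / (cabs a + 1)); first exact: divr_gt0.
move=> h hd; have -> : a * (z + h) + b = a * z + b + a * h by ring.
have -> : h * (a * l) = a * h * l by ring.
have ch := cabs_ge0 h.
have ah : cabs (a * h) <= (cabs a + 1) * cabs h.
  by rewrite cabsM ler_wpM2r //; lra.
apply: le_trans (H _ _) _.
  by apply: le_trans ah _; rewrite mulrC -ler_pdivlMr.
apply: le_trans (ler_wpM2l _ ah) _; first by rewrite divr_ge0 // ltW.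
by rewrite mulrA divfK // gt_eqF.
Qed.

Lemma cderV f z l : f z != 0 -> cder f z l ->
  cder (fun x => (f x)^-1) z (- l / f z ^+ 2).
Proof.
move=> f0 hf e e0; have F0 : 0 < cabs (f z) by rewrite cabs_gt0.
set F := cabs (f z) in F0 *; set L := cabs l.
have L0 : 0 < L + 1 by have := cabs_ge0 l; rewrite /L; lra.
(* The remainder is a fraction with denominator at least [F ^+ 3 / 2] in modulus, so each of the two
   summands of its numerator may take [e * F ^+ 3 / 4] times [cabs h]. *)
have e1 : 0 < e * F ^+ 2 / 4 by rewrite divr_gt0 // mulr_gt0 // exprn_gt0.
have e2 : 0 < e * F ^+ 3 / (4 * (L + 1)).
  by rewrite divr_gt0 ?mulr_gt0 // exprn_gt0.
have [d1 d10 h1] := hf _ e1.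
have [d2 d20 h2] := cder_cont hf e2.
have [d3 d30 h3] := cder_cont hf (divr_gt0 F0 (ltr0n R 2)).
exists (Num.min d1 (Num.min d2 d3)); first by rewrite !lt_min d10 d20.
move=> h; rewrite !le_min => /and3P[/h1 {}h1 /h2 {}h2 /h3 {}h3].
have fh : F / 2 <= cabs (f (z + h)).
  have -> : f (z + h) = f z + (f (z + h) - f z) by ring.
  by have := cabs_lbD (f z) (f (z + h) - f z); rewrite -/F; lra.
have fh0 : f (z + h) != 0 by rewrite -cabs_gt0; lra.
have -> : (f (z + h))^-1 - (f z)^-1 - h * (- l / f z ^+ 2) =
  (- (f (z + h) - f z - h * l) * f z + h * l * (f (z + h) - f z))
   / (f (z + h) * f z ^+ 2) by field; rewrite ?f0 ?fh0.
have ch := cabs_ge0 h.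
rewrite cabsM cabsV ler_pdivrMr ?cabs_gt0 ?mulf_neq0 ?expf_neq0 //.
apply: le_trans (cabsD _ _) _; rewrite [cabs (_ * f z ^+ 2)]cabsM cabsX !cabsM cabsN -/F -/L.
have t1 : cabs (f (z + h) - f z - h * l) * F <= e * F ^+ 3 / 4 * cabs h.
  have -> : e * F ^+ 3 / 4 * cabs h = e * F ^+ 2 / 4 * cabs h * F by ring.
  by rewrite ler_wpM2r // ltW.
have t2 : cabs h * L * cabs (f (z + h) - f z) <= e * F ^+ 3 / 4 * cabs h.
  have -> : e * F ^+ 3 / 4 * cabs h =
     cabs h * (L + 1) * (e * F ^+ 3 / (4 * (L + 1))) by field; rewrite gt_eqF.
  apply: ler_pM; rewrite ?mulr_ge0 ?cabs_ge0 //.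
  by rewrite ler_wpM2l //; lra.
have t3 : e * cabs h * (F / 2 * F ^+ 2) <= e * cabs h * (cabs (f (z + h)) * F ^+ 2).
  apply: ler_wpM2l; first by apply: mulr_ge0 => //; exact: ltW.
  by apply: ler_wpM2r => //; apply: exprn_ge0; exact: ltW.
apply: le_trans (lerD t1 t2) _; apply: le_trans t3.
by rewrite le_eqVlt; apply/orP; left; apply/eqP; field.
Qed.

Lemma cder_nome z : cder (@nome R) z (tpi * nome z).
Proof.
have T0 : 0 < cabs (tpi : R[i]) by rewrite cabs_gt0 tpi_neq0.
apply: (@cder_sq _ _ _ (1 / 2 / cabs tpi) (cabs (nome z) * (10 * cabs tpi ^+ 2))).
  by rewrite divr_gt0.
move=> h; rewrite ler_pdivlMr // -cabsM mulrC => hh.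
have -> : nome (z + h) - nome z - h * (tpi * nome z) =
  nome z * (nome h - 1 - tpi * h) by rewrite nomeD; ring.
rewrite cabsM -mulrA ler_wpM2l ?cabs_ge0 //.
by apply: le_trans (nome_sub1_le hh) _; rewrite cabsM exprMn mulrA.
Qed.

Lemma cder_poly (p : {poly R[i]}) f z l : cder f z l ->
  cder (fun x => p.[f x]) z (l * p^`().[f z]).
Proof.
move=> hf; elim/poly_ind: p => [|p c IH].
  rewrite deriv0 horner0 mulr0; apply: cder_ext (cder_cst 0 z) => x.
  by rewrite horner0.
have := cderD (cderM IH hf) (cder_cst c z).
have -> : l * p^`().[f z] * f z + p.[f z] * l + 0 = l * (p * 'X + c%:P)^`().[f z].
  by rewrite derivD derivM derivX derivC !hornerE; ring.
by apply: cder_ext => x; rewrite !hornerE.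
Qed.

Lemma cder_derivable f z l : cder f z l ->
  derivable (f : (R[i])^o -> (R[i])^o) z 1.
Proof.
move=> hf; apply/cvg_ex; exists (l : (R[i])^o).
apply/cvgrPdist_le => /= e e0.
have er : (complex.Re e)%:C = e by apply: RRe_real; rewrite gtr0_real.
have /hf[d d0 {}hf] : 0 < complex.Re e by rewrite -ltcR er.
exists (d%:C); first by rewrite /= ltcR.
move=> h /=; rewrite sub0r normrN normE ltcR => hd h0.
have -> : l - h^-1 *: (f (h *: 1 + z) - f z) = - ((f (z + h) - f z - h * l) / h).
  have -> : h *: (1 : R[i]) + z = z + h by rewrite addrC /GRing.scale /= mulr1.
  rewrite /GRing.scale /=; field; exact: h0.
rewrite normrN normE -er lecR cabsM cabsV ler_pdivrMr ?cabs_gt0 //.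
exact/hf/ltW.
Qed.

End ComplexDerivative.

(** * The functions h_i and their sums over translates *)

Local Definition hrnE :=
  (hornerD, hornerM, hornerX, hornerC, hornerXn, hornerZ, hornerN).

Section EulerianFunctions.
Variable R : realType.
Implicit Types (f g : R[i] -> R[i]) (z w : R[i]) (p : {poly R[i]}).

Definition decaying f := forall d : R, 0 < d -> exists2 C : R, 0 <= C &
  forall z, d <= complex.Im z -> cabs (f z) <= C * rho (complex.Im z).

Definition taylor2 f g := forall d : R, 0 < d -> exists2 C : R, 0 <= C &
  forall z w, d <= complex.Im z -> d <= complex.Im w ->
  cabs (f w - f z - (w - z) * g z) <=
  C * cabs (w - z) ^+ 2 * (rho (complex.Im z) + rho (complex.Im w)).

(* First-order expansion on every half-plane Im z >= d > 0, with a remainder that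
   keeps the exponential decay at i*oo: this makes it summable over the translates
   z + n tau, also when the step w - z grows linearly in n. *)
Definition UD f g := [/\ decaying f, decaying g & taylor2 f g].

Lemma decayingD f g : decaying f -> decaying g -> decaying (fun z => f z + g z).
Proof.
move=> hf hg d d0; have [C C0 H] := hf d d0; have [K K0 H'] := hg d d0.
exists (C + K); first exact: addr_ge0.
move=> z hz; apply: le_trans (cabsD _ _) _; rewrite mulrDl.
by apply: lerD; [exact: H|exact: H'].
Qed.

Lemma decayingZ a f : decaying f -> decaying (fun z => a * f z).
Proof.
move=> hf d d0; have [C C0 H] := hf d d0.
exists (cabs a * C); first by rewrite mulr_ge0 ?cabs_ge0.
by move=> z hz; rewrite cabsM -mulrA ler_wpM2l ?cabs_ge0 // H.
Qed.

Lemma decayingM f g : decaying f -> decaying g -> decaying (fun z => f z * g z).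
Proof.
move=> hf hg d d0; have [C C0 H] := hf d d0; have [K K0 H'] := hg d d0.
exists (C * K); first exact: mulr_ge0.
move=> z hz; rewrite cabsM -mulrA; apply: le_trans (ler_pM _ _ (H z hz) (H' z hz)) _;
  rewrite ?cabs_ge0 //.
have r0 := rho_ge0 (complex.Im z); have r1 : rho (complex.Im z) <= 1.
  by apply: rho_le1; apply: le_trans hz; exact: ltW.
rewrite -mulrA ler_wpM2l // mulrCA ler_wpM2l //.
by rewrite -[leRHS]mul1r ler_wpM2r.
Qed.

Lemma UDZ a f g : UD f g -> UD (fun z => a * f z) (fun z => a * g z).
Proof.
case=> hf hg ht; split; [exact: decayingZ|exact: decayingZ|].
move=> d d0; have [C C0 H] := ht d d0.
exists (cabs a * C); first by rewrite mulr_ge0 ?cabs_ge0.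
move=> z w hz hw.
have -> : a * f w - a * f z - (w - z) * (a * g z) =
          a * (f w - f z - (w - z) * g z) by ring.
have -> (m S : R) : cabs a * C * m * S = cabs a * (C * m * S) by ring.
by rewrite cabsM ler_wpM2l ?cabs_ge0 // H.
Qed.

Lemma UDD f1 g1 f2 g2 : UD f1 g1 -> UD f2 g2 ->
  UD (fun z => f1 z + f2 z) (fun z => g1 z + g2 z).
Proof.
case=> hf1 hg1 ht1 [hf2 hg2 ht2]; split; [exact: decayingD|exact: decayingD|].
move=> d d0; have [C C0 H] := ht1 d d0; have [K K0 H'] := ht2 d d0.
exists (C + K); first exact: addr_ge0.
move=> z w hz hw.
have -> : f1 w + f2 w - (f1 z + f2 z) - (w - z) * (g1 z + g2 z) =
  (f1 w - f1 z - (w - z) * g1 z) + (f2 w - f2 z - (w - z) * g2 z) by ring.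
have -> (m S : R) : (C + K) * m * S = C * m * S + K * m * S by ring.
apply: le_trans (cabsD _ _) _.
by apply: lerD; [exact: H|exact: H'].
Qed.

(** Steps of length at least 1 are covered by boundedness, shorter ones by the Taylor remainder,
    where the square of the step is at most the step. *)
Lemma UD_lip f g : UD f g -> forall d : R, 0 < d -> exists2 C : R, 0 <= C &
  forall z w, d <= complex.Im z -> d <= complex.Im w ->
  cabs (f w - f z) <= C * cabs (w - z).
Proof.
case=> hf hg ht d d0.
have [C1 C10 H1] := hf d d0; have [C2 C20 H2] := hg d d0.
have [C3 C30 H3] := ht d d0.
exists (2 * C1 + C2 + 2 * C3); first by rewrite !addr_ge0 ?mulr_ge0.
move=> z w hz hw; set m := cabs (w - z); have m0 : 0 <= m := cabs_ge0 _.
have rz : rho (complex.Im z) <= 1 by apply: rho_le1; apply: le_trans hz; exact: ltW.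
have rw : rho (complex.Im w) <= 1 by apply: rho_le1; apply: le_trans hw; exact: ltW.
have rz0 := rho_ge0 (complex.Im z); have rw0 := rho_ge0 (complex.Im w).
have bw : cabs (f w) <= C1.
  by apply: le_trans (H1 w hw) _; rewrite -[leRHS]mulr1 ler_wpM2l.
have bz : cabs (f z) <= C1.
  by apply: le_trans (H1 z hz) _; rewrite -[leRHS]mulr1 ler_wpM2l.
have [m1|m1] := leP 1 m.
  by apply: le_trans (cabsB _ _) _; nra.
have -> : f w - f z = (f w - f z - (w - z) * g z) + (w - z) * g z by ring.
apply: le_trans (cabsD _ _) _.
have t1 : cabs ((w - z) * g z) <= m * C2.
  rewrite cabsM ler_wpM2l //; apply: le_trans (H2 z hz) _.
  by rewrite -[leRHS]mulr1 ler_wpM2l.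
have t2 : C3 * m ^+ 2 * (rho (complex.Im z) + rho (complex.Im w)) <= C3 * m * 2.
  apply: ler_pM; rewrite ?mulr_ge0 ?exprn_ge0 ?addr_ge0 //; last lra.
  rewrite ler_wpM2l //; nra.
have := H3 z w hz hw; rewrite -/m => t3.
have := mulr_ge0 C10 m0; lra.
Qed.

Lemma UDM f1 g1 f2 g2 : UD f1 g1 -> UD f2 g2 ->
  UD (fun z => f1 z * f2 z) (fun z => g1 z * f2 z + f1 z * g2 z).
Proof.
move=> U1 U2; have := (U1, U2) => -[[hf1 hg1 ht1] [hf2 hg2 ht2]].
split; [exact: decayingM|by apply: decayingD; exact: decayingM|].
move=> d d0.
have [C1 C10 H1] := ht1 d d0; have [C2 C20 H2] := ht2 d d0.
have [L L0 HL] := UD_lip U1 d0.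
have [B1 B10 HB1] := hf1 d d0; have [B2 B20 HB2] := hf2 d d0.
have [D2 D20 HD2] := hg2 d d0.
exists (C1 * B2 + B1 * C2 + D2 * L).
  by rewrite !addr_ge0 ?mulr_ge0.
move=> z w hz hw; set m := cabs (w - z); have m0 : 0 <= m := cabs_ge0 _.
have rz : rho (complex.Im z) <= 1 by apply: rho_le1; apply: le_trans hz; exact: ltW.
have rw : rho (complex.Im w) <= 1 by apply: rho_le1; apply: le_trans hw; exact: ltW.
have rz0 := rho_ge0 (complex.Im z); have rw0 := rho_ge0 (complex.Im w).
set S := rho (complex.Im z) + rho (complex.Im w).
have S0 : 0 <= S by exact: addr_ge0.
(* In the last summand the second factor [w - z] comes from the Lipschitz bound for [f1], and the
   decay from [g2]. *)
have -> : f1 w * f2 w - f1 z * f2 z - (w - z) * (g1 z * f2 z + f1 z * g2 z) =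
  (f1 w - f1 z - (w - z) * g1 z) * f2 z
  + f1 w * (f2 w - f2 z - (w - z) * g2 z)
  + (w - z) * (g2 z * (f1 w - f1 z)) by ring.
have b1 : cabs (f1 w) <= B1.
  by apply: le_trans (HB1 w hw) _; rewrite -[leRHS]mulr1 ler_wpM2l.
have b2 : cabs (f2 z) <= B2.
  by apply: le_trans (HB2 z hz) _; rewrite -[leRHS]mulr1 ler_wpM2l.
have b3 : cabs (g2 z) <= D2 * S.
  by apply: le_trans (HD2 z hz) _; rewrite ler_wpM2l // /S lerDl.
have -> : (C1 * B2 + B1 * C2 + D2 * L) * m ^+ 2 * S =
  (C1 * m ^+ 2 * S) * B2 + B1 * (C2 * m ^+ 2 * S) + m * (D2 * S * (L * m)) by ring.
apply: le_trans (cabsD _ _) _; apply: lerD; first apply: le_trans (cabsD _ _) _.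
  apply: lerD; rewrite cabsM; apply: ler_pM; rewrite ?cabs_ge0 //.
    exact: H1.
  exact: H2.
rewrite !cabsM ler_wpM2l //; apply: ler_pM; rewrite ?cabs_ge0 //.
exact: HL.
Qed.

(** The closed form of the geometric series in [nome z]. Every [h i] is a polynomial in this one
    function. *)
Definition cq z : R[i] := nome z / (1 - nome z).

Lemma one_sub_nome_lb (d : R) z : d <= complex.Im z -> 1 - rho d <= cabs (1 - nome z).
Proof.
move=> hz; apply: le_trans (cabs_lbB _ _); rewrite cabs1 cabs_nome.
by rewrite lerB // rho_le.
Qed.

Lemma UD_cq : UD cq (fun z => tpi * (cq z + cq z * cq z)).
Proof.
have dc : decaying cq.
  move=> d d0; have e0 : 0 < 1 - rho d by rewrite subr_gt0 rho_lt1.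
  exists (1 - rho d)^-1; first by rewrite invr_ge0 ltW.
  move=> z hz; rewrite /cq cabsM cabsV cabs_nome mulrC ler_wpM2r ?rho_ge0 //.
  rewrite lef_pV2 ?posrE //; last exact: lt_le_trans (one_sub_nome_lb hz).
  exact: one_sub_nome_lb.
split=> //; first by apply/decayingZ/decayingD/decayingM.
move=> d d0; set n := 1 - rho d; have n0 : 0 < n by rewrite subr_gt0 rho_lt1.
have n1 : n <= 1 by have := rho_ge0 d; rewrite /n; lra.
set T := cabs (tpi : R[i]); have T0 : 0 <= T := cabs_ge0 _.
(* [26 = 20 + 6] is what a short step costs; [n ^+ 3] bounds the denominator
   [(1 - y) ^+ 2 * (1 - v)] from below. *)
exists (26 * T ^+ 2 / n ^+ 3).
  by rewrite divr_ge0 ?mulr_ge0 ?exprn_ge0 // ltW.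
move=> z w hz hw; set y := nome z; set v := nome w.
set u := tpi * (w - z).
have hy : n <= cabs (1 - y) := one_sub_nome_lb hz.
have hv : n <= cabs (1 - v) := one_sub_nome_lb hw.
have y1 : 1 - y != 0 by rewrite -cabs_gt0; exact: lt_le_trans hy.
have v1 : 1 - v != 0 by rewrite -cabs_gt0; exact: lt_le_trans hv.
set ry := rho (complex.Im z); set rv := rho (complex.Im w).
have ey : cabs y = ry := cabs_nome z.
have ev : cabs v = rv := cabs_nome w.
have ry0 : 0 <= ry := rho_ge0 _; have rv0 : 0 <= rv := rho_ge0 _.
have ry1 : ry <= 1 by apply: rho_le1; apply: le_trans hz; exact: ltW.
set U := cabs u; have U0 : 0 <= U := cabs_ge0 u.
have -> : cq w - cq z - (w - z) * (tpi * (cq z + cq z * cq z)) =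
  ((v - y - u * y) * (1 - y) + u * y * (v - y)) * (((1 - y) ^+ 2)^-1 * (1 - v)^-1).
  by rewrite /cq -/y -/v /u; field; rewrite y1 v1.
have -> : 26 * T ^+ 2 / n ^+ 3 * cabs (w - z) ^+ 2 * (ry + rv) =
  26 * U ^+ 2 * (ry + rv) * ((n ^+ 2)^-1 * n^-1).
  by rewrite /U /u cabsM -/T exprMn; field; rewrite gt_eqF.
rewrite 2!cabsM !cabsV cabsX.
apply: ler_pM; rewrite ?mulr_ge0 ?invr_ge0 ?exprn_ge0 ?cabs_ge0 //; last first.
  apply: ler_pM; rewrite ?invr_ge0 ?exprn_ge0 ?cabs_ge0 // lef_pV2 ?posrE //.
  - by rewrite ler_pXn2r ?nnegrE ?cabs_ge0 // ltW.
  - by rewrite exprn_gt0 // cabs_gt0.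
  - by rewrite exprn_gt0.
  - by rewrite cabs_gt0.
have b1 : cabs (1 - y) <= 2 by apply: le_trans (cabsB _ _) _; rewrite cabs1 ey; lra.
have [hU|hU] := leP U (1 / 2).
  have E : v = y * nome (w - z) by rewrite /v /y -nomeD subrKC.
  have a1 : cabs (v - y - u * y) <= 10 * U ^+ 2 * ry.
    have -> : v - y - u * y = (nome (w - z) - 1 - u) * y by rewrite E; ring.
    by rewrite cabsM ey ler_wpM2r //; exact: nome_sub1_le.
  have a2 : cabs (v - y) <= 6 * U * ry.
    have -> : v - y = (nome (w - z) - 1) * y by rewrite E; ring.
    by rewrite cabsM ey ler_wpM2r //; exact: nome_sub1_lin.
  apply: le_trans (cabsD _ _) _.
  rewrite (cabsM _ (1 - y)) (cabsM _ (v - y)) (cabsM u y) ey -/U.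
  have t1 : cabs (v - y - u * y) * cabs (1 - y) <= 10 * U ^+ 2 * ry * 2.
    by apply: ler_pM; rewrite ?cabs_ge0.
  have t2 : U * ry * cabs (v - y) <= U * ry * (6 * U).
    rewrite ler_wpM2l ?mulr_ge0 //; apply: le_trans a2 _.
    by rewrite -[leRHS]mulr1 ler_wpM2l ?mulr_ge0.
  have := mulr_ge0 (sqr_ge0 U) rv0; have := mulr_ge0 (sqr_ge0 U) ry0; lra.
(* A long step needs no cancellation: the trivial bounds suffice, since constants and [U] are
   dominated by [U ^+ 2]. *)
have U2 : 1 <= 4 * U ^+ 2 by nra.
have UU : U <= 2 * U ^+ 2 by nra.
have -> : (v - y - u * y) * (1 - y) + u * y * (v - y) =
  (v - y) * (1 - y) - u * y * (1 - v) by ring.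
have b2 : cabs (v - y) <= rv + ry by apply: le_trans (cabsB _ _) _; rewrite ev ey.
have b3 : cabs (1 - v) <= 2.
  apply: le_trans (cabsB _ _) _; rewrite cabs1 ev.
  suff : rv <= 1 by lra.
  by apply: rho_le1; apply: le_trans hw; exact: ltW.
apply: le_trans (cabsB _ _) _.
rewrite (cabsM _ (1 - y)) (cabsM _ (1 - v)) (cabsM u y) ey -/U.
have t1 : cabs (v - y) * cabs (1 - y) <= (rv + ry) * 2.
  by apply: ler_pM; rewrite ?cabs_ge0.
have t2 : U * ry * cabs (1 - v) <= U * ry * 2.
  by rewrite ler_wpM2l ?mulr_ge0.
have t3 : (rv + ry) * 1 <= (rv + ry) * (4 * U ^+ 2).
  by rewrite ler_wpM2l ?addr_ge0.
have t4 : U * ry <= 2 * U ^+ 2 * ry by rewrite ler_wpM2r.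
have := mulr_ge0 (sqr_ge0 U) rv0; have := mulr_ge0 (sqr_ge0 U) ry0; lra.
Qed.

(** As [cq] has derivative [tpi * (cq + cq ^+ 2)], the operator [tpi^-1 * d/dz] acts on polynomials
    in [cq] as [('X + 'X^2)] times the formal derivative; these are its iterates on ['X]. *)
Fixpoint eulerP (i : nat) : {poly R[i]} :=
  if i is j.+1 then ('X + 'X^2) * (eulerP j)^`() else 'X.

(* h i is the analytic continuation of sum_(m >= 1) m^i e(m z). *)
Definition h (i : nat) z : R[i] := (eulerP i).[cq z].

Lemma eulerP_root0 i : (eulerP i).[0] = 0.
Proof.
case: i => [|i] /=; first by rewrite hornerX.
by rewrite hornerM !hrnE; ring.
Qed.

(** A vanishing constant term is what gives decay, [cq] being small at infinity. The induction runs
    on the cofactor [r] in [p = r * 'X], so that all intermediate functions decay too. *)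
Lemma UD_poly p : p.[0] = 0 ->
  UD (fun z => p.[cq z]) (fun z => tpi * (('X + 'X^2) * p^`()).[cq z]).
Proof.
have H (r : {poly R[i]}) : UD (fun z => (r * 'X).[cq z])
    (fun z => tpi * (('X + 'X^2) * (r * 'X)^`()).[cq z]).
  elim/poly_ind: r => [|r c IH].
    have := UDZ 0 UD_cq; congr UD; apply/funext => z.
      by rewrite !mul0r horner0.
    by rewrite !mul0r deriv0 mulr0 horner0 mulr0.
  have := UDD (UDM IH UD_cq) (UDZ c UD_cq); congr UD; apply/funext => z.
    by rewrite !hrnE; ring.
  by rewrite !(derivD, derivM, derivX, derivC) !hrnE; ring.
move=> p0; have /factor_theorem[r ->] : root p 0 by rewrite /root p0.
by rewrite subr0; exact: H.
Qed.

Lemma UD_h i : UD (h i) (fun z => tpi * h i.+1 z).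
Proof. exact: UD_poly (eulerP_root0 i). Qed.

Lemma cder_cq z : nome z != 1 -> cder cq z (tpi * (cq z + cq z ^+ 2)).
Proof.
move=> h1; have h0 : 1 - nome z != 0 by rewrite subr_eq0 eq_sym.
have h2 := cderB (cder_cst 1 z) (cder_nome z).
have := cderM (cder_nome z) (cderV (f := fun x => 1 - nome x) h0 h2).
by congr cder; rewrite /cq; field.
Qed.

Lemma cder_h i z : nome z != 1 -> cder (h i) z (tpi * h i.+1 z).
Proof.
move=> /cder_cq/(cder_poly (eulerP i)); congr cder.
by rewrite /h /= !hrnE; ring.
Qed.

Lemma cqN z : nome z != 1 -> cq (- z) = - 1 - cq z.
Proof.
move=> h1; have h0 : 1 - nome z != 0 by rewrite subr_eq0 eq_sym.
rewrite /cq nomeN; field.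
by rewrite h0 nome_neq0 -opprB oppr_eq0 h0.
Qed.

Lemma hDint i z (n : int) : h i (z + n%:~R) = h i z.
Proof. by rewrite /h /cq nomeDint. Qed.

Let poly_ring (A : comNzRingType) (x : A) :
  - 1 - x + (- 1 - x) ^+ 2 = x + x ^+ 2.
Proof. ring. Qed.

(** ['X + 'X^2] is fixed by the substitution of [- 1 - 'X] while the formal derivative changes sign.
    The extra constant exists only at [i = 0], because differentiation kills it. *)
Lemma eulerP_reflect i :
  eulerP i \Po (- 1 - 'X) = (-1) ^+ i.+1 *: eulerP i - (i == 0%N)%:R%:P.
Proof.
elim: i => [|i IH] /=.
  by rewrite comp_polyX expr1 scaleN1r addrC.
have d1 : (- 1 - 'X : {poly R[i]})^`() = - 1.
  by rewrite derivD !derivN derivX -polyC1 derivC oppr0 add0r.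
have := congr1 deriv IH; rewrite deriv_comp d1 mulrN1 derivD derivN derivC derivZ.
rewrite oppr0 addr0 => E.
have E2 : (eulerP i)^`() \Po (- 1 - 'X) = (-1) ^+ i.+2 *: (eulerP i)^`().
  by rewrite exprS -scalerA scaleN1r -E opprK.
rewrite addr0 comp_polyM comp_polyD comp_polyX comp_Xn_poly E2 -scalerAr.
congr (_ *: (_ * _)).
exact: poly_ring.
Qed.

Lemma hN i z : nome z != 1 -> h i (- z) = (-1) ^+ i.+1 * h i z - (i == 0%N)%:R.
Proof.
move=> h1; rewrite /h cqN //.
have := congr1 (fun p : {poly R[i]} => p.[cq z]) (eulerP_reflect i).
by rewrite horner_comp !hrnE.
Qed.

End EulerianFunctions.

(** * One-sided series over translates: convergence and derivatives *)

Section TranslateSeries.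
Variable R : realType.
Implicit Types (z w tau : R[i]).

Lemma cder_csum (F : nat -> R[i] -> R[i]) (G : nat -> R[i]) z (d : R) (b m : nat -> R) :
  0 < d -> sumbd b -> sumbd m ->
  (forall n k, cabs k <= d -> cabs (F n (z + k)) <= b n) ->
  (forall n, cabs (G n) <= b n) ->
  (forall n k, cabs k <= d ->
     cabs (F n (z + k) - F n z - k * G n) <= cabs k ^+ 2 * m n) ->
  cder (fun x => csum (F ^~ x)) z (csum G).
Proof.
move=> d0 hb [M hm] hF hG hT; apply: (cder_sq (C := M) d0) => k kd.
have hF0 n : cabs (F n z) <= b n.
  by rewrite -[z]addr0; apply: hF; rewrite cabs0 ltW.
have H := ccvgB (ccvgB (csum_cvg (hF ^~ k ^~ kd) hb) (csum_cvg hF0 hb))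
  (ccvgZ k (csum_cvg hG hb)).
apply: (ccvg_bound H) => n; rewrite mulr_sumr -!sumrB.
apply: le_trans (cabs_sum _ _ _) _.
apply: (@le_trans _ _ (\sum_(i < n) cabs k ^+ 2 * m i)).
  by apply: ler_sum => i _; exact: hT.
by rewrite -mulr_sumr mulrC ler_wpM2r ?exprn_ge0 ?cabs_ge0.
Qed.

(** Half of the exponent absorbs the square, by [u * expR (- u) <= 1]; the other half leaves a
    geometric series. *)
Lemma sumbd_sqgeom (y : R) : 0 < y -> sumbd (fun n => n.+1%:R ^+ 2 * rho y ^+ n.+1).
Proof.
move=> y0; set a := 2 * pi * y; have a0 : 0 < a by rewrite !mulr_gt0 ?pi_gt0.
have /sumbd_geom hg : 0 <= rho (y / 2) < 1 by rewrite rho_ge0 rho_lt1 //; lra.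
apply: sumbd_le (sumbdZ (sqr_ge0 (4 / a)) hg) => n.
have n0 : 0 < n.+1%:R :> R by rewrite ltr0n.
set u := n.+1%:R * a / 4; have u0 : 0 < u by rewrite divr_gt0 // mulr_gt0.
have -> : rho y ^+ n.+1 = expR (- u) ^+ 2 * rho (y / 2) ^+ n.+1.
  rewrite -(rho_nat _ y) -(rho_nat _ (y / 2)) /rho expr2 -!expRD; congr expR.
  by rewrite /u /a; field.
have e1 : n.+1%:R * expR (- u) <= 4 / a.
  have := expR_ge1Dx u; have := expR_gt0 (- u) => p1 p2.
  have e1 : expR u * expR (- u) = 1 by rewrite -expRD subrr expR0.
  have : u * expR (- u) <= 1 by rewrite -[leRHS]e1 ler_wpM2r ?ltW //; lra.
  rewrite /u => h; rewrite ler_pdivlMr //; lra.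
rewrite mulrA -exprMn; apply: ler_pM.
- by rewrite sqr_ge0.
- by rewrite exprn_ge0 ?rho_ge0.
- have p1 : 0 <= n.+1%:R * expR (- u) by rewrite mulr_ge0 ?expR_ge0.
  by rewrite ler_pXn2r ?nnegrE //; exact: le_trans e1.
- rewrite exprS -[leRHS]mul1r ler_wpM2r ?exprn_ge0 ?rho_ge0 //.
  by rewrite rho_le1 // ltW // divr_gt0.
Qed.

(** The term [n = 0] is kept apart: it can hit the pole of [h i], whereas this series converges as
    soon as [z + tau] is in the upper half-plane. *)
Definition T (i : nat) z tau : R[i] := csum (fun n => h i (z + n.+1%:R * tau)).

Lemma Im_nat n z : complex.Im (n%:R * z) = n%:R * complex.Im z.
Proof. by rewrite -natC ImMr. Qed.

Lemma Im_translate n z tau : complex.Im (z + n.+1%:R * tau) =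
  complex.Im (z + tau) + n%:R * complex.Im tau.
Proof. by rewrite !ImD Im_nat -natr1; ring. Qed.

Lemma Im_translate_ge n z tau (d : R) : 0 < complex.Im tau ->
  d <= complex.Im (z + tau) -> d <= complex.Im (z + n.+1%:R * tau).
Proof.
move=> t0 h; rewrite Im_translate; apply: le_trans h _.
by rewrite lerDl mulr_ge0 // ltW.
Qed.

Lemma rho_translate n z tau : 0 <= complex.Im (z + tau) ->
  rho (complex.Im (z + n.+1%:R * tau)) <= rho (complex.Im tau) ^+ n.
Proof.
by move=> h; rewrite Im_translate -rho_nat rho_le // lerDr.
Qed.

Lemma T_dom i (d : R) : 0 < d -> exists2 C : R, 0 <= C &
  forall z tau, 0 < complex.Im tau -> d <= complex.Im (z + tau) ->
  forall n, cabs (h i (z + n.+1%:R * tau)) <= C * rho (complex.Im tau) ^+ n.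
Proof.
move=> d0; have [C C0 H] := (let: And3 x _ _ := UD_h R i in x) d d0; exists C => // z tau t0 hd n.
apply: le_trans (H _ (Im_translate_ge n t0 hd)) _.
by rewrite ler_wpM2l // rho_translate // ltW // (lt_le_trans d0).
Qed.

Lemma sumbd_rho (C : R) tau : 0 <= C -> 0 < complex.Im tau ->
  sumbd (fun n => C * rho (complex.Im tau) ^+ n).
Proof.
by move=> C0 t0; apply: sumbdZ => //; apply: sumbd_geom; rewrite rho_ge0 rho_lt1.
Qed.

Lemma T_cvg i z tau : 0 < complex.Im tau -> 0 < complex.Im (z + tau) ->
  ccvg (fun m => \sum_(n < m) h i (z + n.+1%:R * tau)) (T i z tau).
Proof.
move=> t0 z0; have [C C0 H] := T_dom i z0.
exact: csum_cvg (H z tau t0 (lexx _)) (sumbd_rho C0 t0).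
Qed.

Lemma T_bounded i (d A : R) : 0 < d -> 0 < A -> exists C : R,
  forall z tau, A <= complex.Im tau -> d <= complex.Im (z + tau) ->
  cabs (T i z tau) <= C.
Proof.
move=> d0 A0; have [C C0 H] := T_dom i d0.
have /sumbd_geom/(sumbdZ C0)[M hM] : 0 <= rho A < 1 by rewrite rho_ge0 rho_lt1.
exists M => z tau hA hd; have t0 := lt_le_trans A0 hA.
apply: (csum_le (b := fun n => C * rho A ^+ n)) hM => n; apply: le_trans (H z tau t0 hd n) _.
apply: ler_wpM2l => //; by apply: lerXn2r; rewrite ?nnegrE ?rho_ge0 ?rho_le.
Qed.

Lemma T_shift i z tau : 0 < complex.Im tau -> 0 < complex.Im (z + tau) ->
  T i z tau = h i (z + tau) + T i (z + tau) tau.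
Proof.
move=> t0 z0; have [C C0 H] := T_dom i z0.
rewrite /T (csumS (H z tau t0 (lexx _)) (sumbd_rho C0 t0)) mul1r; congr (_ + _).
by apply: eq_csum => n; congr h; rewrite -[in LHS]natr1; ring.
Qed.

Lemma T_Dint i z tau (n : int) : T i (z + n%:~R) tau = T i z tau.
Proof.
by apply: eq_csum => m; rewrite -[RHS](hDint _ _ n); congr h; rewrite addrAC.
Qed.

Lemma cder_T_z i z tau : 0 < complex.Im tau -> 0 < complex.Im (z + tau) ->
  cder (fun x => T i x tau) z (tpi * T i.+1 z tau).
Proof.
move=> t0 z0; set d := complex.Im (z + tau) / 2; have d0 : 0 < d by rewrite /d; lra.
have [C C0 H] := T_dom i d0; have [K K0 H'] := T_dom i.+1 d0.
have [L L0 HL] := (let: And3 _ _ x := UD_h R i in x) d d0.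
have hk k : cabs k <= d -> d <= complex.Im (z + k + tau).
  move=> kd; have := le_trans (Im_le_cabs k) kd; rewrite ler_norml => /andP[k1 _].
  by move: k1; rewrite /d !ImD; lra.
have hz : d <= complex.Im (z + tau) by rewrite /d; lra.
have T0 : 0 <= cabs (tpi : R[i]) := cabs_ge0 _.
have -> : tpi * T i.+1 z tau = csum (fun n => tpi * h i.+1 (z + n.+1%:R * tau)).
  by rewrite (csumZ _ (H' z tau t0 hz) (sumbd_rho K0 t0)).
apply: (@cder_csum (fun n x => h i (x + n.+1%:R * tau)) _ z d
  (fun n => (C + cabs (tpi : R[i]) * K) * rho (complex.Im tau) ^+ n)
  (fun n => L * 2 * rho (complex.Im tau) ^+ n)) => //.
- by apply: sumbd_rho => //; rewrite addr_ge0 ?mulr_ge0.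
- by apply: sumbd_rho => //; rewrite mulr_ge0.
- move=> n k kd; apply: le_trans (H _ _ t0 (hk k kd) n) _.
  by rewrite ler_wpM2r ?exprn_ge0 ?rho_ge0 // lerDl mulr_ge0.
- move=> n; rewrite cabsM; apply: le_trans (ler_wpM2l T0 (H' _ _ t0 hz n)) _.
  by rewrite mulrA ler_wpM2r ?exprn_ge0 ?rho_ge0 // lerDr.
move=> n k kd; set w := z + k + n.+1%:R * tau.
have hw : d <= complex.Im w by apply: Im_translate_ge => //; exact: hk.
have hv : d <= complex.Im (z + n.+1%:R * tau) by exact: Im_translate_ge.
have := HL _ _ hv hw.
have -> : w - (z + n.+1%:R * tau) = k by rewrite /w; ring.
move=> h1; apply: le_trans h1 _.
have -> (m S : R) : L * m * S = m * (L * S) by ring.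
have -> (m S : R) : m * (L * 2 * S) = m * (L * (2 * S)) by ring.
apply: ler_wpM2l; first by rewrite exprn_ge0 ?cabs_ge0.
apply: ler_wpM2l => //.
have r1 : rho (complex.Im (z + n.+1%:R * tau)) <= rho (complex.Im tau) ^+ n.
  by apply: rho_translate; exact: ltW.
have r2 : rho (complex.Im w) <= rho (complex.Im tau) ^+ n.
  by apply: rho_translate; apply: le_trans (hk k kd); exact: ltW.
lra.
Qed.

(** A step [k] in [tau] moves the argument of index [n] by [n.+1 * k], so the remainders carry
    [n.+1 ^+ 2]; since [z] is real, the decay is geometric in [n.+1] and [sumbd_sqgeom] applies. *)
Lemma cder_T_tau i z tau : 0 < complex.Im tau -> complex.Im z = 0 ->
  exists l, cder (T i z) tau l.
Proof.
move=> t0 z0; set d := complex.Im tau / 2; have d0 : 0 < d by rewrite /d; lra.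
have [C C0 H] := (let: And3 x _ _ := UD_h R i in x) d d0.
have [K K0 H'] := (let: And3 _ x _ := UD_h R i in x) d d0.
have [L L0 HL] := (let: And3 _ _ x := UD_h R i in x) d d0.
have hk k : cabs k <= d -> d <= complex.Im (tau + k).
  move=> kd; have := le_trans (Im_le_cabs k) kd; rewrite ler_norml => /andP[k1 _].
  by move: k1; rewrite /d !ImD; lra.
have hz : d <= complex.Im tau by rewrite /d; lra.
have im n x : complex.Im (z + n.+1%:R * x) = n.+1%:R * complex.Im x.
  by rewrite ImD z0 add0r Im_nat.
have ge n x : d <= complex.Im x -> d <= complex.Im (z + n.+1%:R * x).
  move=> dx; have x0 : 0 <= complex.Im x by apply: le_trans dx; exact: ltW.
  by rewrite im; apply: le_trans dx _; rewrite ler_peMl // ler1n.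
have rr n x : d <= complex.Im x -> rho (complex.Im (z + n.+1%:R * x)) <= rho d ^+ n.+1.
  by move=> dx; rewrite im rho_nat ler_pXn2r ?nnegrE ?rho_ge0 // rho_le.
have s1 n : 1 <= n.+1%:R ^+ 2 :> R by rewrite expr_ge1 ?ler1n.
have n1 n : 1 <= n.+1%:R :> R by rewrite ler1n.
have rn n : 0 <= rho d ^+ n.+1 by rewrite exprn_ge0 ?rho_ge0.
exists (csum (fun n => n.+1%:R * (tpi * h i.+1 (z + n.+1%:R * tau)))).
apply: (@cder_csum (fun n x => h i (z + n.+1%:R * x)) _ tau d
  (fun n => (C + K) * (n.+1%:R ^+ 2 * rho d ^+ n.+1))
  (fun n => L * 2 * (n.+1%:R ^+ 2 * rho d ^+ n.+1))) => //.
- by apply: sumbdZ; [exact: addr_ge0|exact: sumbd_sqgeom].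
- by apply: sumbdZ; [exact: mulr_ge0|exact: sumbd_sqgeom].
- move=> n k kd; apply: le_trans (H _ (ge n _ (hk k kd))) _.
  apply: ler_pM; rewrite ?rho_ge0 ?lerDl //.
  by apply: le_trans (rr n _ (hk k kd)) _; rewrite ler_peMl.
- move=> n; rewrite cabsM cabs_nat.
  apply: le_trans (ler_wpM2l _ (H' _ (ge n _ hz))) _; first by rewrite ler0n.
  rewrite mulrCA; apply: ler_pM; rewrite ?mulr_ge0 ?rho_ge0 ?lerDr //.
  apply: ler_pM; rewrite ?rho_ge0 ?rr //.
  by rewrite expr2 ler_peMl.
move=> n k kd.
have := HL _ _ (ge n _ hz) (ge n _ (hk k kd)).
have -> : z + n.+1%:R * (tau + k) - (z + n.+1%:R * tau) = n.+1%:R * k by ring.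
have -> (x : R[i]) : n.+1%:R * k * x = k * (n.+1%:R * x) by ring.
move=> h1; apply: le_trans h1 _; rewrite cabsM cabs_nat exprMn.
set S := rho _ + rho _; have hS : S <= 2 * rho d ^+ n.+1.
  by have := rr n _ hz; have := rr n _ (hk k kd); rewrite /S; lra.
have -> : L * (n.+1%:R ^+ 2 * cabs k ^+ 2) * S = cabs k ^+ 2 * (L * n.+1%:R ^+ 2) * S.
  by ring.
have -> : cabs k ^+ 2 * (L * 2 * (n.+1%:R ^+ 2 * rho d ^+ n.+1)) =
  cabs k ^+ 2 * (L * n.+1%:R ^+ 2) * (2 * rho d ^+ n.+1) by ring.
by apply: ler_wpM2l => //; rewrite !mulr_ge0 ?exprn_ge0 ?cabs_ge0.
Qed.

End TranslateSeries.

(** * Expansion of the cotangent and the transformation law *)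

Section SymmetricPartialSums.
Variable R : realType.
Implicit Types (f g : int -> R[i]) (z w : R[i]).

Lemma sumbd_tail (g : nat -> R) : (forall k, 0 <= g k) -> sumbd g ->
  forall e : R, 0 < e -> exists K, forall m, \sum_(k < m) g k <= \sum_(k < K) g k + e.
Proof.
move=> g0 [M hM] e e0.
pose S : set R := [set x | exists m, x = \sum_(k < m) g k]%classic.
have hS : has_sup S.
  split; first by exists 0, 0%N; rewrite big_ord0.
  by exists M => _ [m ->].
have [_ [K ->] hK] := sup_adherent e0 hS.
exists K => m; have hm : S (\sum_(k < m) g k) by exists m.
by have := ub_le_sup hS.2 hm; lra.
Qed.

Lemma sum_ord_split (V : zmodType) (F : nat -> V) (K n : nat) : (K <= n)%N ->
  \sum_(k < n) F k = \sum_(k < K) F k + \sum_(K <= k < n) F k.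
Proof. by move=> Kn; rewrite -!(big_mkord xpredT) -big_cat_nat. Qed.

(** Only the difference of partial sums is controlled, so the limit series need not be known to
    converge. The threshold [K0] allows a majorant that fails for the first few indices. *)
Lemma tannery (a : nat -> nat -> R[i]) (l : nat -> R[i]) (g : nat -> R) (K0 : nat) :
  (forall k, 0 <= g k) -> sumbd g -> (forall k, ccvg (a ^~ k) (l k)) ->
  (forall n k, (K0 <= k < n)%N -> cabs (a n k) <= g k) ->
  ccvg (fun n => \sum_(k < n) a n k - \sum_(k < n) l k) 0.
Proof.
move=> g0 hg hl ha e e0; have e3 : 0 < e / 3 by lra.
have lg k : (K0 <= k)%N -> cabs (l k) <= g k.
  move=> hk; apply: (ccvg_bound_ev (n0 := k.+1) (hl k)) => n hn.
  by apply: ha; rewrite hk.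
have [K1 hK1] := sumbd_tail g0 hg e3.
set K := maxn K0 K1.
have hK m : (K <= m)%N -> \sum_(K <= k < m) g k <= e / 3.
  move=> Km; have := hK1 m; rewrite (sum_ord_split _ Km).
  rewrite (sum_ord_split g (leq_maxr K0 K1)) -/K => H.
  have : 0 <= \sum_(K1 <= k < K) g k by apply: sumr_ge0.
  lra.
have /(_ _ e3)[n1 h1] : ccvg (fun n => \sum_(k < K) (a n k - l k)) (\sum_(k < K) (l k - l k)).
  by apply: ccvg_sum => k _; apply: ccvgB (hl k) (ccvg_cst _).
exists (maxn n1 K) => n; rewrite geq_max => /andP[/h1 {}h1 Kn].
move: h1; rewrite [X in _ - X]big1; last by move=> k _; rewrite subrr.
rewrite !subr0 -sumrB => h1.
rewrite (sum_ord_split (fun k => a n k - l k) Kn).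
apply: le_trans (cabsD _ _) _; apply: le_trans (lerD h1 (lexx _)) _.
have : cabs (\sum_(K <= k < n) (a n k - l k)) <= \sum_(K <= k < n) (g k + g k).
  apply: le_trans (cabs_sum _ _ _) _; rewrite !big_nat; apply: ler_sum => k.
  move=> /andP[Kk kn]; have K0k : (K0 <= k)%N := leq_trans (leq_maxl K0 K1) Kk.
  apply: le_trans (cabsB _ _) _; apply: lerD; last exact: lg.
  by apply: ha; rewrite K0k.
rewrite [leRHS]big_split => h2; have := le_trans h2 (lerD (hK n Kn) (hK n Kn)).
lra.
Qed.

(** The range [- A .. A], that is, Eisenstein summation: the cotangent series and its row sums
    converge only in this order. *)
Definition symsum (A : nat) f : R[i] :=
  f 0 + \sum_(k < A) (f (k.+1 : int) + f (- (k.+1 : int))).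

Lemma eq_symsum A f g : (forall k, f k = g k) -> symsum A f = symsum A g.
Proof.
by move=> fg; rewrite /symsum fg; congr (_ + _); apply: eq_bigr => k _; rewrite !fg.
Qed.

Lemma symsumN A f : symsum A (fun k => f (- k)) = symsum A f.
Proof.
rewrite /symsum oppr0; congr (_ + _); apply: eq_bigr => k _.
by rewrite opprK addrC.
Qed.

Lemma symsumD A f g : symsum A (fun k => f k + g k) = symsum A f + symsum A g.
Proof.
rewrite /symsum addrACA -big_split; congr (_ + _); apply: eq_bigr => k _.
by rewrite addrACA.
Qed.

Lemma symsumZ A (c : R[i]) f : symsum A (fun k => c * f k) = c * symsum A f.
Proof.
by rewrite /symsum mulrDr mulr_sumr; congr (_ + _); apply: eq_bigr => k _; ring.
Qed.

Lemma symsumB A f g : symsum A (fun k => f k - g k) = symsum A f - symsum A g.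
Proof.
rewrite -mulN1r -symsumZ -symsumD; apply: eq_symsum => k.
by rewrite mulN1r.
Qed.

Lemma symsum_exchange A B (f : int -> int -> R[i]) :
  symsum A (fun n => symsum B (f n)) = symsum B (fun m => symsum A (f ^~ m)).
Proof.
have H n : (\sum_(k < n) (symsum B (f k.+1) + symsum B (f (- (k.+1 : int))))) =
  symsum B (fun m => \sum_(k < n) (f k.+1 m + f (- (k.+1 : int)) m)).
  elim: n => [|n IH].
    rewrite big_ord0 /symsum big_ord0 add0r big1 // => i _.
    by rewrite !big_ord0 addr0.
  rewrite big_ord_recr /= IH -!symsumD; apply: eq_symsum => m.
  by rewrite big_ord_recr.
by rewrite {1}/symsum H -symsumD.
Qed.

End SymmetricPartialSums.

(** * Partial fractions of the cotangent *)

Section Cotangent.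
Variable R : realType.
Implicit Types (z w : R[i]).

(** Each fraction is a truncated geometric series over the common denominator [1 - y ^+ n], minus 1.
    On summing over [k], orthogonality of roots of unity leaves only the exponent [l = 0]. *)
Lemma sum_cyclotomic_fractions (F : fieldType) (n : nat) (zeta y : F) :
  (0 < n)%N -> zeta ^+ n = 1 -> (forall l, (0 < l < n)%N -> zeta ^+ l != 1) ->
  y ^+ n != 1 ->
  \sum_(k < n) (y * zeta ^+ k) / (1 - y * zeta ^+ k) = n%:R * (y ^+ n / (1 - y ^+ n)).
Proof.
move=> n0 zn zl yn; have y0 : 1 - y ^+ n != 0 by rewrite subr_eq0 eq_sym.
have pw k : (y * zeta ^+ k) ^+ n = y ^+ n.
  by rewrite exprMn exprAC zn expr1n mulr1.
have dk (k : 'I_n) : 1 - y * zeta ^+ k != 0.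
  rewrite subr_eq0 eq_sym; apply: contra yn => /eqP E.
  by rewrite -(pw k) E expr1n.
have H (k : 'I_n) : (y * zeta ^+ k) / (1 - y * zeta ^+ k) =
  (\sum_(l < n) (y * zeta ^+ k) ^+ l) / (1 - y ^+ n) - 1.
  have : (1 - y * zeta ^+ k) * (\sum_(l < n) (y * zeta ^+ k) ^+ l) = 1 - y ^+ n.
    rewrite -(pw k) -[1 in RHS](expr1n _ n) subrXX; congr (_ * _).
    by apply: eq_bigr => i _; rewrite expr1n mul1r.
  move=> E; have d := dk k; set S := \sum_(l < n) _ in E *.
  have -> : S = (1 - y ^+ n) / (1 - y * zeta ^+ k) by rewrite -E; field.
  by field; rewrite y0 d.
rewrite (eq_bigr _ (fun k _ => H k)) sumrB -mulr_suml exchange_big /=.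
rewrite (bigD1 (Ordinal n0)) //= [X in (_ + X) / _]big1 ?addr0; last first.
  move=> l l0; rewrite (eq_bigr (fun k : 'I_n => y ^+ l * (zeta ^+ l) ^+ k)); last first.
    by move=> k _; rewrite exprMn exprAC.
  rewrite -mulr_sumr; apply/eqP; rewrite mulf_eq0; apply/orP; right.
  have l1 : zeta ^+ l - 1 != 0.
    rewrite subr_eq0; apply: zl; rewrite ltn_ord andbT lt0n.
    by apply: contra l0 => /eqP E; apply/eqP/val_inj.
  rewrite -(mulIr_eq0 _ (mulIf l1)) mulrC.
  have := subrX1 (zeta ^+ l) n; rewrite exprAC zn expr1n subrr => E.
  by rewrite -E.
under eq_bigr do rewrite expr0.
rewrite !sumr_const card_ord; field; exact: y0.
Qed.

Lemma nome_root (n l : nat) : (0 < l < n)%N -> nome (n%:R^-1 : R[i]) ^+ l != 1.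
Proof.
move=> /andP[l0 ln]; have n0 : (0 < n)%N := leq_trans l0 (ltnW ln).
have -> : nome (n%:R^-1 : R[i]) ^+ l = nome (l%:R / n%:R : R)%:C.
  by rewrite nomeX rmorphM fmorphV /= !natC.
apply: nome_real_neq1.
  by rewrite mulf_neq0 ?invr_eq0 ?pnatr_eq0 -?lt0n.
by rewrite ger0_norm ?divr_ge0 // ltr_pdivrMr ?ltr0n // mul1r ltr_nat.
Qed.

Lemma nome_root1 (n : nat) : (0 < n)%N -> nome (n%:R^-1 : R[i]) ^+ n = 1.
Proof. by move=> n0; rewrite nomeX divff ?nome1 // pnatr_eq0 -lt0n. Qed.

(* pi * cot (pi z) *)
Definition ct z : R[i] := - tpi * (1 / 2 + cq z).

Lemma ctDint z (n : int) : ct (z + n%:~R) = ct z.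
Proof. by rewrite /ct /cq nomeDint. Qed.

Lemma ct_mult n z : (0 < n)%N -> nome z != 1 ->
  \sum_(k < n) ct ((z + k%:R) / n%:R) = n%:R * ct z.
Proof.
move=> n0 z1; have nn : n%:R != 0 :> R[i] by rewrite pnatr_eq0 -lt0n.
have E k : nome ((z + k%:R) / n%:R) = nome (z / n%:R) * nome (n%:R^-1) ^+ k.
  by rewrite nomeX -nomeD mulrDl.
have yn : nome (z / n%:R) ^+ n = nome z by rewrite nomeX mulrC divfK.
rewrite /ct -mulr_sumr big_split /= sumr_const card_ord /cq.
under [X in _ * (_ + X)]eq_bigr do rewrite E.
rewrite (sum_cyclotomic_fractions n0 (nome_root1 n0) (@nome_root n)) ?yn //.
by rewrite -mulr_natr; ring.
Qed.

(** An odd modulus [2p + 1] has the symmetric system of residues [- p .. p]; the period 1 of [ct]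
    allows this choice of representatives. *)
Lemma ct_symsum (p : nat) z : nome z != 1 ->
  symsum p (fun k => ct ((z + k%:~R) / p.*2.+1%:R)) = p.*2.+1%:R * ct z.
Proof.
move=> z1; rewrite -(ct_mult (n := p.*2.+1)) // /symsum.
set n := p.*2.+1; have nn : n%:R != 0 :> R[i] by rewrite pnatr_eq0.
have En : n = (p.+1 + p)%N by rewrite /n -addnn addSn.
pose F (j : nat) := ct ((z + j%:R) / n%:R).
have EF : \sum_(k < n) F k = \sum_(k < p.+1 + p) F k by clearbody F; rewrite En.
rewrite -[RHS]/(\sum_(k < n) F k) EF big_split_ord /= big_ord_recl /= -addrA; congr (_ + _).
rewrite [X in _ + X](reindex_inj rev_ord_inj) -big_split /=; apply: eq_bigr => k _.
rewrite /F /bump /= add1n; congr (_ + _).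
rewrite -[LHS](ctDint _ 1); congr ct.
have -> : (p.+1 + (p - k.+1) = n - k.+1)%N by have := ltn_ord k; rewrite En; lia.
rewrite natrB; last by have := ltn_ord k; rewrite En; lia.
by rewrite mulrNz -pmulrn; field.
Qed.

Lemma ccvg_nome_sub1 w :
  ccvg (fun n => n.+1%:R * (nome (w / n.+1%:R) - 1)) (tpi * w).
Proof.
apply: ccvg_sub => e e0; set m := cabs (tpi * w); have m0 : 0 <= m := cabs_ge0 _.
(* The summand [2 * m] brings the argument into the range of the quadratic estimate, the other one
   makes the resulting error at most [e]. *)
have [n0 hn0] : exists n0 : nat, 2 * m + 10 * m ^+ 2 / e <= n0%:R.
  exists (Num.trunc (2 * m + 10 * m ^+ 2 / e)).+1; apply: ltW.
  exact: truncnS_gt.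
exists n0 => n hn; rewrite subr0.
have N0 : 0 < n.+1%:R :> R by rewrite ltr0n.
have hN : 2 * m + 10 * m ^+ 2 / e <= n.+1%:R.
  by apply: le_trans hn0 _; rewrite ler_nat; exact: leqW.
have t0 : 0 <= 10 * m ^+ 2 / e by rewrite divr_ge0 ?mulr_ge0 ?sqr_ge0 // ltW.
have nc : n.+1%:R != 0 :> R[i] by rewrite pnatr_eq0.
have hw : cabs (tpi * (w / n.+1%:R)) = m / n.+1%:R.
  by rewrite mulrA cabsM cabsV cabs_nat.
have hs : cabs (tpi * (w / n.+1%:R)) <= 1 / 2.
  by rewrite hw ler_pdivrMr //; lra.
have := nome_sub1_le hs.
have -> : n.+1%:R * (nome (w / n.+1%:R) - 1) - tpi * w =
  n.+1%:R * (nome (w / n.+1%:R) - 1 - tpi * (w / n.+1%:R)) by field.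
rewrite hw => H; rewrite cabsM cabs_nat; apply: le_trans (ler_wpM2l (ltW N0) H) _.
have -> : n.+1%:R * (10 * (m / n.+1%:R) ^+ 2) = 10 * m ^+ 2 / n.+1%:R.
  by field; rewrite gt_eqF.
rewrite ler_pdivrMr // [leRHS]mulrC -ler_pdivrMr //; lra.
Qed.

Lemma ct_neq1E w : nome w != 1 -> ct w = - tpi / 2 * (1 + nome w) / (1 - nome w).
Proof.
move=> w1; have h0 : 1 - nome w != 0 by rewrite subr_eq0 eq_sym.
by rewrite /ct /cq; field.
Qed.

(** A simple pole with residue 1 at the origin, seen along the points [w / n]. *)
Lemma ct_pole w : w != 0 ->
  ccvg (fun n => n.+1%:R^-1 * ct (w / n.+1%:R)) w^-1.
Proof.
move=> w0; have tw : tpi * w != 0 :> R[i] by rewrite mulf_neq0 ?tpi_neq0.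
have h1 := ccvg_nome_sub1 w.
have hinv : ccvg (fun n => (n.+1%:R^-1 : R[i])) 0.
  move=> e e0; exists (Num.trunc e^-1).+1 => n hn; rewrite subr0 cabsV cabs_nat.
  rewrite -[leRHS]invrK lef_pV2 ?posrE ?invr_gt0 ?ltr0n //.
  apply: le_trans (ltW (truncnS_gt _)) _; rewrite ler_nat; exact: leqW.
have h2 : ccvg (fun n => 1 + nome (w / n.+1%:R)) 2.
  have := ccvgD (ccvg_cst 2) (ccvgM hinv h1); rewrite mul0r addr0.
  by apply: ccvg_ext => n; rewrite mulrA mulVf ?pnatr_eq0 // mul1r; ring.
have := ccvgM (ccvgZ (tpi / 2) h2) (ccvgV tw h1).
have -> : tpi / 2 * 2 * (tpi * w)^-1 = w^-1 by field; rewrite w0 tpi_neq0.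
have [n0 hn0] : exists n0, forall n, (n0 <= n)%N -> nome (w / n.+1%:R) != 1.
  have tw2 : 0 < cabs (tpi * w) / 2 by rewrite divr_gt0 ?cabs_gt0.
  have [n0 H] := h1 _ tw2; exists n0 => n /H; apply: contraTneq => ->.
  by rewrite subrr mulr0 sub0r cabsN -ltNge; lra.
apply: (ccvg_eq (n0 := n0)) => n /hn0 hn; rewrite (ct_neq1E hn).
have nc : n.+1%:R != 0 :> R[i] by rewrite pnatr_eq0.
have h0 : 1 - nome (w / n.+1%:R) != 0 by rewrite subr_eq0 eq_sym.
field.
by rewrite nat1r nc h0 -opprB oppr_eq0 h0.
Qed.

(** Doubling the angle and the mean value theorem give [sin x = cos (x / 2) * cos c * x] with
    [c < x / 2]. The product of cosines is at least [cos (x / 2) ^+ 2], hence at least 1/2 because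
    [cos x >= 0]. *)
Lemma sin_ge_half (x : R) : 0 <= x <= pi / 2 -> x / 2 <= sin x.
Proof.
move=> /andP[x0 x1]; have pp := pi_gt0 R.
have [->|xn] := eqVneq x 0; first by rewrite sin0 mul0r.
have xp : 0 < x / 2 by rewrite divr_gt0 // lt_neqAle eq_sym xn.
have [c ci] := @MVT R sin cos 0 (x / 2) xp (fun u _ => is_derive_sin u)
   (continuous_subspaceT (@continuous_sin R)).
move: ci; rewrite in_itv /= => /andP[c0 cx]; rewrite sin0 !subr0 => E.
have hc : cos (x / 2) <= cos c.
  by apply/ltW; rewrite ltr_cos // in_itv /=; apply/andP; split; lra.
have c20 : 0 <= cos (x / 2) by apply: cos_ge0_pihalf; lra.
have Ex : x = (x / 2) *+ 2 by rewrite -mulr_natr divfK.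
have hs : 1 / 2 <= cos (x / 2) ^+ 2.
  have : 0 <= cos x by apply: cos_ge0_pihalf; lra.
  by rewrite {1}Ex cos_mulr2n; lra.
have -> : sin x = (cos (x / 2) * cos c) * x.
  by rewrite {1}Ex sin_mulr2n E; field.
have h1 : cos (x / 2) ^+ 2 <= cos (x / 2) * cos c by rewrite expr2 ler_wpM2l.
by have := ler_wpM2r x0 (le_trans hs h1); rewrite div1r mulrC.
Qed.

Lemma one_sub_nome_real_lb (b : R) : 0 <= b <= 1 / 2 -> 2 * b <= cabs (1 - nome b%:C).
Proof.
move=> /andP[b0 b1]; have pp := pi_gt0 R; have p2 := pi_ge2 R.
have hs : pi * b / 2 <= sin (pi * b).
  by apply: sin_ge_half; rewrite mulr_ge0 ?pi_ge0 //=; nra.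
have hb : b <= sin (pi * b) by apply: le_trans hs; nra.
have E : complex.Re (1 - nome b%:C) = 2 * sin (pi * b) ^+ 2.
  rewrite ReB nomeE /cexp ReMr Re_tpiM Im_tpiM /= mulr0 oppr0 expR0 mul1r.
  have -> : 2 * pi * b = (pi * b) *+ 2 by ring.
  by rewrite cos_mulr2n cos2sin2; ring.
have F : complex.Im (1 - nome b%:C) = - (2 * sin (pi * b) * cos (pi * b)).
  rewrite ImB nomeE /cexp ImMr Re_tpiM Im_tpiM /= mulr0 oppr0 expR0 mul1r.
  have -> : 2 * pi * b = (pi * b) *+ 2 by ring.
  by rewrite sin_mulr2n; ring.
have -> : cabs (1 - nome b%:C) = Num.sqrt ((2 * sin (pi * b)) ^+ 2).
  move: E F; case: (1 - nome b%:C) => u v /= -> ->.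
  by congr Num.sqrt; rewrite sqrrN !exprMn cos2sin2; ring.
by rewrite sqrtr_sqr ger0_norm ?ler_pM2l // mulr_ge0 //; lra.
Qed.

(** With [n = 2p + 1], adding the terms at [k.+1] and [- k.+1] leaves the numerator [1 - X ^+ 2], of
    order [1 / n], while both denominators are at least [k.+1 / n]: the bound is then free of [n].
    The threshold [K0] makes [M <= k.+1], so that the distance of [X] from 1 takes away at most half
    of the lower bound for [1 - Y]. *)
Lemma ct_pair_bound z : exists K0 : nat, exists C : R, 0 <= C /\
  forall p k, nome z != 1 -> (K0 <= k)%N -> (k < p)%N ->
  cabs (p.*2.+1%:R^-1 * (ct ((z + k.+1%:R) / p.*2.+1%:R) +
                         ct ((z - k.+1%:R) / p.*2.+1%:R))) <= C * (k.+1%:R ^+ 2)^-1.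
Proof.
set M := 6 * cabs (tpi * z); have M0 : 0 <= M by rewrite mulr_ge0 ?cabs_ge0.
exists (Num.trunc M).+1, (cabs (tpi : R[i]) * (2 * M)).
split; first by rewrite !mulr_ge0 ?cabs_ge0.
move=> p k z1 hk kp; set n := p.*2.+1.
have nn : n%:R != 0 :> R[i] by rewrite pnatr_eq0.
have N0 : 0 < n%:R :> R by rewrite ltr0n.
have Mk : M <= k.+1%:R.
  by apply: le_trans (ltW (truncnS_gt _)) _; rewrite ler_nat; exact: leqW.
have kn : 2 * k.+1%:R <= n%:R :> R by rewrite -natrM ler_nat /n -muln2; lia.
have k0 : 0 < k.+1%:R :> R by rewrite ltr0n.
set X := nome (z / n%:R); set Y := nome ((k.+1%:R : R) / n%:R)%:C.
have EY : Y = nome (k.+1%:R / n%:R) by rewrite /Y rmorphM fmorphV /= !natC.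
have Xn : X ^+ n = nome z by rewrite nomeX mulrC divfK.
have Yn : Y ^+ n = 1 by rewrite EY nomeX mulrC divfK // nome_nat.
have Y0 : Y != 0 := nome_neq0 _.
have E1 : nome ((z + k.+1%:R) / n%:R) = X * Y by rewrite EY -nomeD -mulrDl.
have E2 : nome ((z - k.+1%:R) / n%:R) = X / Y by rewrite EY -nomeB -mulrBl.
have d1 : X * Y != 1.
  apply: contra z1 => /eqP E; have : (X * Y) ^+ n = 1 by rewrite E expr1n.
  by rewrite exprMn Yn mulr1 Xn => ->.
have d2 : X / Y != 1.
  apply: contra z1 => /eqP E; have : (X / Y) ^+ n = 1 by rewrite E expr1n.
  by rewrite exprMn exprVn Yn invr1 mulr1 Xn => ->.
have d1' : 1 - X * Y != 0 by rewrite subr_eq0 eq_sym.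
have d2' : 1 - X / Y != 0 by rewrite subr_eq0 eq_sym.
have -> : ct ((z + k.+1%:R) / n%:R) + ct ((z - k.+1%:R) / n%:R) =
  - tpi * (1 - X ^+ 2) / ((1 - X * Y) * (1 - X / Y)).
  rewrite !ct_neq1E ?E1 ?E2 //; field.
  rewrite d1' Y0 /= andbT; apply: contra d2' => /eqP H.
  by rewrite -[1](divff Y0) -mulrBl H mul0r.
have hX (w : R[i]) : 6 * cabs (tpi * w) <= 3 * n%:R ->
    cabs (1 - nome (w / n%:R)) <= 6 * cabs (tpi * w) / n%:R.
  move=> hw; rewrite cabsBC -mulrA -[n%:R in leRHS]cabs_nat -cabsV -cabsM -mulrA.
  by apply: nome_sub1_lin; rewrite mulrA cabsM cabsV cabs_nat ler_pdivrMr //; lra.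
have bX : cabs (1 - X) <= M / n%:R by apply: hX; rewrite -/M; lra.
have bX2 : cabs (1 - X ^+ 2) <= 2 * M / n%:R.
  have -> : X ^+ 2 = nome (2 * z / n%:R) by rewrite nomeX mulrA.
  have EM : 6 * cabs (tpi * (2 * z)) = 2 * M.
    by rewrite mulrCA cabsM cabs_nat /M; ring.
  by rewrite -EM; apply: hX; rewrite EM; lra.
have cY : cabs Y = 1 by rewrite cabs_nome /= /rho mulr0 oppr0 expR0.
have bY : 2 * (k.+1%:R / n%:R) <= cabs (1 - Y).
  apply: one_sub_nome_real_lb; rewrite divr_ge0 // ler_pdivrMr //; lra.
have low : k.+1%:R / n%:R <= 2 * (k.+1%:R / n%:R) - M / n%:R.
  have : M / n%:R <= k.+1%:R / n%:R by rewrite ler_wpM2r // invr_ge0 ltW.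
  lra.
have b1 : k.+1%:R / n%:R <= cabs (1 - X * Y).
  have -> : 1 - X * Y = (1 - Y) + (1 - X) * Y by ring.
  apply: le_trans (cabs_lbD _ _); rewrite cabsM cY mulr1; lra.
have b2 : k.+1%:R / n%:R <= cabs (1 - X / Y).
  have -> : 1 - X / Y = - ((1 - Y) - (1 - X)) / Y by field.
  rewrite cabsM cabsV cY invr1 mulr1 cabsN.
  apply: le_trans (cabs_lbB _ _); lra.
have kn0 : 0 < k.+1%:R / n%:R :> R by rewrite divr_gt0.
rewrite cabsM cabsV cabs_nat (cabsM _ (_ ^-1)) (cabsM (- tpi)) cabsN cabsV cabsM.
have -> : cabs (tpi : R[i]) * (2 * M) * (k.+1%:R ^+ 2)^-1 =
  n%:R^-1 * (cabs (tpi : R[i]) * (2 * M / n%:R) * (k.+1%:R / n%:R * (k.+1%:R / n%:R))^-1).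
  by field; rewrite !gt_eqF.
apply: ler_wpM2l; first by rewrite invr_ge0 ltW.
apply: ler_pM; rewrite ?mulr_ge0 ?invr_ge0 ?mulr_ge0 ?cabs_ge0 //.
  by rewrite ler_wpM2l ?cabs_ge0.
rewrite lef_pV2; first by apply: ler_pM => //; exact: ltW.
  by rewrite posrE -cabsM cabs_gt0 mulf_neq0.
by rewrite posrE; apply: mulr_gt0.
Qed.

(* Euler's partial fraction expansion of the cotangent, as the limit of the finite
   identity ct_symsum. *)
Lemma ct_expansion z : nome z != 1 ->
  ccvg (fun p => symsum p (fun m => (z + m%:~R)^-1)) (ct z).
Proof.
move=> z1; have zn (n : int) : z + n%:~R != 0.
  by apply: contra z1 => /eqP E; rewrite -(nomeDint z n) E nome0.
pose a p k := p.*2.+1%:R^-1 * (ct ((z + (k.+1 : int)%:~R) / p.*2.+1%:R) +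
                         ct ((z + (- (k.+1 : int))%:~R) / p.*2.+1%:R)).
pose l k := (z + (k.+1 : int)%:~R)^-1 + (z + (- (k.+1 : int))%:~R)^-1.
have pole w : w != 0 -> ccvg (fun p => p.*2.+1%:R^-1 * ct (w / p.*2.+1%:R)) w^-1.
  move=> /ct_pole; apply: (@ccvg_comp R (fun n => n.+1%:R^-1 * ct (w / n.+1%:R)) _ double).
  by move=> n; rewrite -addnn leq_addr.
have [K0 [C [C0 H]]] := ct_pair_bound z.
have al k : ccvg (a ^~ k) (l k).
  apply: ccvg_ext (ccvgD (pole _ (zn k.+1)) (pole _ (zn (- (k.+1 : int))))) => p.
  by rewrite -mulrDr.
have g0 k : 0 <= C * (k.+1%:R ^+ 2)^-1 by rewrite mulr_ge0 ?invr_ge0 ?sqr_ge0.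
have hT : ccvg (fun p => \sum_(k < p) a p k - \sum_(k < p) l k) 0.
  apply: (tannery (K0 := K0) g0 (sumbdZ C0 (sumbd_invsq R)) al) => p k /andP[Kk kp].
  by rewrite /a mulrNz -!pmulrn; exact: H.
have ctE p : ct z = p.*2.+1%:R^-1 * ct (z / p.*2.+1%:R) + \sum_(k < p) a p k.
  have nn : p.*2.+1%:R != 0 :> R[i] by rewrite pnatr_eq0.
  by apply: (mulfI nn); rewrite -ct_symsum // /symsum mulrDr mulVKf // /a -mulr_sumr mulVKf // mulr0z addr0.
have z0 : z != 0 by have := zn 0; rewrite mulr0z addr0.
(* By [ctE] the inner difference is the sum of the [a p k]; subtracting the expression in [hT]
   replaces it by the sum of the [l k]. *)
have := ccvgB (ccvgD (ccvg_cst z^-1) (ccvgB (ccvg_cst (ct z)) (pole z z0))) hT.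
have -> : z^-1 + (ct z - z^-1) - 0 = ct z by ring.
apply: ccvg_ext => p; rewrite {1}(ctE p) /symsum mulr0z addr0 /l; ring.
Qed.

End Cotangent.

(** * Double series and lower bounds on a lattice *)

Section LatticeSums.
Variable R : realType.
Implicit Types (z w tau : R[i]) (a : int -> int -> R[i]) (g : int -> R).

Lemma symsum_diff_bound (f : int -> R[i]) (b : int -> R) A B : (A <= B)%N ->
  (forall k, cabs (f k) <= b k) ->
  cabs (symsum B f - symsum A f) <=
  \sum_(k < B) (b k.+1 + b (- (k.+1 : int))) - \sum_(k < A) (b k.+1 + b (- (k.+1 : int))).
Proof.
move=> AB fb; rewrite /symsum.
rewrite (sum_ord_split (fun k => f k.+1 + f (- (k.+1 : int))) AB).
rewrite (sum_ord_split (fun k => b k.+1 + b (- (k.+1 : int))) AB).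
have -> (x y u : R[i]) : x + (y + u) - (x + y) = u by ring.
have -> (x y : R) : x + y - x = y by ring.
apply: le_trans (cabs_sum _ _ _) _; apply: ler_sum => k _.
by apply: le_trans (cabsD _ _) _; apply: lerD.
Qed.

Lemma symsum_bound (f : int -> R[i]) (b : int -> R) A :
  (forall k, cabs (f k) <= b k) ->
  cabs (symsum A f) <= b 0 + \sum_(k < A) (b k.+1 + b (- (k.+1 : int))).
Proof.
move=> fb; apply: le_trans (cabsD _ _) _; apply: lerD => //.
apply: le_trans (cabs_sum _ _ _) _; apply: ler_sum => k _.
by apply: le_trans (cabsD _ _) _; apply: lerD.
Qed.

(** The majorant is a product, so truncating row [n] costs [g n] times a tail that is the same for
    all rows; summing over [n] therefore gives one [B0] for every [A]. *)
Lemma symsum_inner_uniform a g (K : R) (Row : int -> R[i]) :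
  0 <= K -> (forall k, 0 <= g k) -> sumbd (fun k => g k.+1 + g (- (k.+1 : int))) ->
  (forall n m, cabs (a n m) <= K * (g n * g m)) ->
  (forall n, ccvg (fun B => symsum B (a n)) (Row n)) ->
  forall e : R, 0 < e -> exists B0, forall A B, (B0 <= B)%N ->
  cabs (symsum A Row - symsum A (fun n => symsum B (a n))) <= e.
Proof.
move=> K0 g0 hg ha hR e e0; set gam := fun k : nat => g k.+1 + g (- (k.+1 : int)).
have [M hM] := hg; set G := g 0 + M.
have gam0 k : 0 <= gam k by rewrite addr_ge0.
have M0 : 0 <= M by have := hM 0%N; rewrite big_ord0.
have G0 : 0 <= G by rewrite addr_ge0.
have KG : 0 < K * G + 1 by have := mulr_ge0 K0 G0; lra.
have e1 : 0 < e / (K * G + 1) by rewrite divr_gt0.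
have [B0 hB0] := sumbd_tail gam0 hg e1.
exists B0 => A B hB.
have row n : cabs (Row n - symsum B (a n)) <= K * (e / (K * G + 1)) * g n.
  have H : ccvg (fun C => symsum C (a n) - symsum B (a n)) (Row n - symsum B (a n)).
    exact: ccvgB (hR n) (ccvg_cst _).
  apply: (ccvg_bound_ev (n0 := B) H) => C BC.
  apply: le_trans (symsum_diff_bound BC (ha n)) _.
  have E m : K * (g n * g m) = K * g n * g m by rewrite mulrA.
  under eq_bigr do rewrite !E -mulrDr.
  under [X in _ - X]eq_bigr do rewrite !E -mulrDr.
  rewrite -!mulr_sumr -mulrBr -mulrA [e / _ * _]mulrC mulrA.
  apply: ler_wpM2l; first exact: mulr_ge0.
  have h1 := hB0 C.
  have h2 : \sum_(k < B0) gam k <= \sum_(k < B) gam k.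
    by rewrite (sum_ord_split gam hB) lerDl sumr_ge0.
  by rewrite -/gam; lra.
rewrite -symsumB; apply: le_trans (symsum_bound A row) _.
under eq_bigr do rewrite -mulrDr.
rewrite -mulr_sumr -mulrDr.
have hA : g 0 + \sum_(k < A) gam k <= G by rewrite lerD2l.
have Ke : 0 <= K * (e / (K * G + 1)) by rewrite mulr_ge0 // ltW.
apply: le_trans (ler_wpM2l Ke hA) _.
have -> : K * (e / (K * G + 1)) * G = (K * G) / (K * G + 1) * e by ring.
rewrite -[leRHS]mul1r ler_wpM2r ?(ltW e0) // ler_pdivrMr //; lra.
Qed.

(** Both iterated limits are compared with the same finite square sum, where the order of summation
    is immaterial. *)
Lemma symsum_iterated a g (K : R) (Row Col : int -> R[i]) LR LC :
  0 <= K -> (forall k, 0 <= g k) -> sumbd (fun k => g k.+1 + g (- (k.+1 : int))) ->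
  (forall n m, cabs (a n m) <= K * (g n * g m)) ->
  (forall n, ccvg (fun B => symsum B (a n)) (Row n)) ->
  (forall m, ccvg (fun A => symsum A (a ^~ m)) (Col m)) ->
  ccvg (fun A => symsum A Row) LR -> ccvg (fun B => symsum B Col) LC -> LR = LC.
Proof.
move=> K0 g0 hg ha hR hC hLR hLC; apply/eqP; rewrite -subr_eq0; apply/eqP.
apply: cabs_le_eps => e e0; have e4 : 0 < e / 4 by lra.
have [B0 h1] := symsum_inner_uniform K0 g0 hg ha hR e4.
have ha' n m : cabs (a m n) <= K * (g n * g m) by rewrite [g n * _]mulrC.
have [A0 h2] := symsum_inner_uniform K0 g0 hg ha' hC e4.
have [n1 h3] := hLR _ e4; have [n2 h4] := hLC _ e4.
set n := maxn (maxn A0 B0) (maxn n1 n2).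
have {}h1 := h1 n n _; have {}h2 := h2 n n _; have {}h3 := h3 n _; have {}h4 := h4 n _.
have hn : [/\ (B0 <= n)%N, (A0 <= n)%N, (n1 <= n)%N & (n2 <= n)%N].
  by rewrite /n; split; lia.
case: hn => /h1 {}h1 /h2 {}h2 /h3 {}h3 /h4 {}h4.
move: h2; rewrite -(symsum_exchange n n a) => h2.
set S := symsum n (fun n0 => symsum n (a n0)) in h1 h2.
have -> : LR - LC = - (symsum n Row - LR) + (symsum n Row - S) - (symsum n Col - S)
  + (symsum n Col - LC) by ring.
apply: le_trans (cabsD _ _) _; apply: le_trans (lerD (cabsB _ _) (lexx _)) _.
apply: le_trans (lerD (lerD (cabsD _ _) (lexx _)) (lexx _)) _.
rewrite cabsN; lra.
Qed.

(** The imaginary part bounds [x], and then the real part bounds [y]; adding the two estimates gives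
    the constant. *)
Lemma lattice_lb tau : 0 < complex.Im tau -> exists2 c : R, 0 < c &
  forall x y : R, c * (`|x| + `|y|) <= cabs (x%:C * tau + y%:C).
Proof.
move=> t0; set t := complex.Im tau in t0 *; set r := `|complex.Re tau|.
have r0 : 0 <= r by rewrite normr_ge0.
have D0 : 0 < t + 1 + r by lra.
exists (t / (t + 1 + r)); first exact: divr_gt0.
move=> x y; set m := cabs _.
have h1 : `|x| * t <= m.
  apply: le_trans (Im_le_cabs _); rewrite ImD ImMr Im_real addr0 normrM.
  by rewrite (ger0_norm (ltW t0)).
have h2 : `|y| - `|x| * r <= m.
  apply: le_trans (Re_le_cabs _); rewrite ReD ReMr Re_real.
  rewrite /r -normrM; set u := x * _.
  by have := ler_normB (u + y) u; rewrite addrAC subrr add0r; lra.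
rewrite mulrAC ler_pdivrMr //; have x0 := normr_ge0 x; nra.
Qed.

(** [s] serves the origin, where the shift itself is nonzero. Elsewhere [mu] is the gap between the
    shifts and the nonzero integers, halved because [1 + |n| + |m|] is at most twice [|n| + |m|]. *)
Lemma shifted_int_lb (al be : R) : `|al| < 1 -> `|be| < 1 -> (al != 0) || (be != 0) ->
  exists2 c : R, 0 < c & forall n m : int,
  c * (1 + `|n%:~R : R| + `|m%:~R : R|) <= `|al + n%:~R| + `|be + m%:~R|.
Proof.
move=> a1 b1 ab; set s := `|al| + `|be|.
have s0 : 0 < s.
  have a0 := normr_ge0 al; have b0 := normr_ge0 be.
  by case/orP: ab; rewrite -normr_gt0 /s => h; lra.
set mu := Num.min (1 - `|al|) (1 - `|be|).
have mu0 : 0 < mu by rewrite lt_min; apply/andP; split; lra.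
have mua : mu <= 1 - `|al| by rewrite /mu ge_min lexx.
have mub : mu <= 1 - `|be| by rewrite /mu ge_min lexx orbT.
exists (Num.min s (mu / 2)); first by rewrite lt_min s0 divr_gt0.
have int1 (n : int) : n != 0 -> 1 <= `|n%:~R : R|.
  by move=> n0; rewrite -intr_norm -[1]/(1%:~R) ler_int -gtz0_ge1 normr_gt0.
have one (x : R) (n : int) : mu <= 1 - `|x| -> mu * `|n%:~R : R| <= `|x + n%:~R|.
  move=> hx; have [->|/int1 n1] := eqVneq n 0.
    by rewrite mulr0z normr0 mulr0 normr_ge0.
  apply: (@le_trans _ _ (`|n%:~R : R| - `|x|)); first by have := normr_ge0 x; nra.
  by have := ler_normB (x + n%:~R) x; rewrite addrAC subrr add0r; lra.
move=> n m; have [nm|nm] := boolP ((n == 0) && (m == 0)).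
  case/andP: nm => /eqP -> /eqP ->; rewrite !mulr0z !addr0 normr0 !addr0 mulr1.
  by rewrite ge_min lexx.
have h : 1 <= `|n%:~R : R| + `|m%:~R : R|.
  have := normr_ge0 (n%:~R : R); have := normr_ge0 (m%:~R : R).
  by move: nm; rewrite negb_and => /orP[/int1|/int1]; lra.
apply: (@le_trans _ _ (mu / 2 * (1 + `|n%:~R : R| + `|m%:~R : R|))).
  apply: ler_wpM2r; first lra.
  by rewrite ge_min lexx orbT.
have := one al n mua; have := one be m mub; nra.
Qed.

Lemma lattice_shift_lb tau (al be : R) : 0 < complex.Im tau ->
  `|al| < 1 -> `|be| < 1 -> (al != 0) || (be != 0) ->
  exists2 c : R, 0 < c & forall n m : int, c * (1 + `|n%:~R : R| + `|m%:~R : R|) <=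
    cabs (al%:C * tau + be%:C + (n%:~R * tau + m%:~R)).
Proof.
move=> t0 a1 b1 ab; have [c1 c10 h1] := lattice_lb t0.
have [c2 c20 h2] := shifted_int_lb a1 b1 ab.
exists (c1 * c2); first exact: mulr_gt0.
move=> n m.
have -> : al%:C * tau + be%:C + (n%:~R * tau + m%:~R) =
  (al + n%:~R)%:C * tau + (be + m%:~R)%:C by rewrite !rmorphD /= !intC; ring.
apply: le_trans (h1 _ _); rewrite -mulrA ler_wpM2l //; exact: ltW.
Qed.

Lemma nome_eq1 w : nome w = 1 -> exists m : int, w = m%:~R.
Proof.
move=> w1; have i0 : complex.Im w = 0.
  by apply/eqP; apply: contra_eqT w1 => /nome_neq1_Im.
have Ew : w = (complex.Re w)%:C by apply: complex_eqP.
set r := complex.Re w in Ew; exists (Num.floor r); rewrite Ew -intC; congr _%:C.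
have /andP[f1 f2] := floor_itv r.
apply/eqP; rewrite -subr_eq0; apply: contra_eqT w1 => h.
rewrite Ew -(nomeDint _ (- Num.floor r)) mulrNz -intC -rmorphB.
apply: nome_real_neq1 => //; rewrite ger0_norm; last by rewrite subr_ge0.
by move: f2; rewrite intrD; lra.
Qed.

End LatticeSums.

(** * The transformation of the zeta function under inversion *)

Section KroneckerZeta.
Variable R : realType.
Implicit Types (z w tau : R[i]).

(* For i = 0 this is the Weierstrass zeta function, corrected to have period 1 and
   divided by - 2 pi i. *)
Definition W (i : nat) z tau : R[i] :=
  h i z + T i z tau + (-1) ^+ i.+1 * T i (- z) tau + (i == 0%N)%:R / 2.

Lemma h0E z : h 0 z = cq z. Proof. by rewrite /h hornerX. Qed.

(** The term at [- n] is folded back into the upper half-plane by [cqN], whose constant [- 1]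
    cancels the two halves coming from [ct]. *)
Lemma ct_symsum_cvg z tau : 0 < complex.Im tau -> `|complex.Im z| < complex.Im tau ->
  ccvg (fun A => symsum A (fun n => ct (z + n%:~R * tau))) (- tpi * W 0 z tau).
Proof.
move=> t0; rewrite ltr_norml => /andP[z1 z2].
have p1 : 0 < complex.Im (z + tau) by rewrite ImD; lra.
have p2 : 0 < complex.Im (- z + tau) by rewrite ImD ImN; lra.
have := ccvgZ (- tpi) (ccvgD (ccvgD (ccvg_cst (h 0 z))
   (ccvgB (T_cvg 0 t0 p1) (T_cvg 0 t0 p2))) (ccvg_cst (1 / 2))).
have -> : - tpi * (h 0 z + (T 0 z tau - T 0 (- z) tau) + 1 / 2) = - tpi * W 0 z tau.
  by rewrite /W /= expr1; ring.
apply: ccvg_ext => A; rewrite /symsum mulr0z mul0r addr0.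
rewrite h0E -sumrB /ct addrAC mulrDr [cq z + _]addrC; congr (_ + _).
rewrite mulr_sumr; apply: eq_bigr => k _.
have hk : 0 < complex.Im (- z + k.+1%:R * tau).
  by apply: lt_le_trans p2 _; exact: Im_translate_ge.
have -> : z + (- (k.+1 : int))%:~R * tau = - (- z + k.+1%:R * tau).
  by rewrite mulrNz -pmulrn; ring.
rewrite cqN; last by apply: nome_neq1_Im; rewrite gt_eqF.
by rewrite !h0E -pmulrn; field.
Qed.

Lemma cq_half : cq (1 / 2 : R[i]) = - (1 / 2).
Proof.
have E : nome (1 / 2 : R[i]) ^+ 2 = 1 by rewrite nomeX mulrC divfK ?nome1 ?pnatr_eq0.
have N : nome (1 / 2 : R[i]) != 1.
  have -> : 1 / 2 = (1 / 2 : R)%:C :> R[i].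
    by rewrite rmorphM fmorphV /= natC.
  apply: nome_real_neq1; first by rewrite div1r invr_eq0 pnatr_eq0.
  by rewrite ger0_norm; lra.
have {}E : nome (1 / 2 : R[i]) = - 1.
  have : (nome (1 / 2 : R[i]) - 1) * (nome (1 / 2 : R[i]) + 1) = 0.
    by rewrite -subr_sqr expr1n E subrr.
  by move/eqP; rewrite mulf_eq0 subr_eq0 (negPf N) /= addr_eq0 => /eqP.
by rewrite /cq E; field.
Qed.

(** [1 / 2] and [- (1 / 2)] differ by a period, so the two series cancel. This is the reference
    value on one side of the inversion; [W0_half_period] supplies the one on the other side. *)
Lemma W0_half tau : W 0 (1 / 2) tau = 0.
Proof.
rewrite /W /= expr1 h0E cq_half -(T_Dint 0 (- (1 / 2)) tau 1).
have -> : - (1 / 2) + 1%:~R = 1 / 2 :> R[i] by field.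
by field.
Qed.

Lemma W0_half_period tau : 0 < complex.Im tau -> W 0 (- (tau / 2)) tau = - (1 / 2).
Proof.
move=> t0.
have E2 : complex.Im (tau / 2) = complex.Im tau / 2.
  by rewrite mulrC -[2%:R]natC -fmorphV ImMr mulrC.
have p : 0 < complex.Im (- (tau / 2) + tau) by rewrite ImD ImN E2; lra.
rewrite /W (T_shift 0 t0 p) expr1 opprK.
have -> : - (tau / 2) + tau = tau / 2 by field.
rewrite !h0E cqN; last by apply: nome_neq1_Im; rewrite E2 gt_eqF ?divr_gt0.
by rewrite /=; field.
Qed.

Lemma sumbd_symsq : sumbd (fun k : nat =>
  ((1 + `|(k.+1 : int)%:~R : R|) ^+ 2)^-1 + ((1 + `|(- (k.+1 : int))%:~R : R|) ^+ 2)^-1).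
Proof.
have h1 : sumbd (fun k : nat => ((1 + k.+1%:R : R) ^+ 2)^-1).
  apply: sumbd_le (sumbd_invsq R) => n.
  have p : 0 < n.+1%:R :> R by rewrite ltr0n.
  have q : 0 < 1 + n.+1%:R :> R by lra.
  rewrite lef_pV2 ?posrE ?(exprn_gt0 _ p) ?(exprn_gt0 _ q) //.
  by apply: lerXn2r; rewrite ?nnegrE; lra.
apply: sumbd_le (sumbdD h1 h1) => k.
by rewrite mulrNz normrN -pmulrn ger0_norm.
Qed.

(** Making the terms even in the lattice point [w] turns them into [1 / ((z + w) * (z - w))], of
    order [|w|^-2], which is not yet summable over a lattice. Subtracting the same expression at
    [z0 = 1 / 2] gives order [|w|^-4], and this is dominated by a product of one-dimensional
    summable terms. Rows then sum to cotangents for [tau] and columns to cotangents for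
    [- tau^-1]. *)
Lemma kronecker_S (al be : R) tau : 0 < complex.Im tau ->
  `|al| < 1 -> `|be| < 1 -> (al != 0) || (be != 0) ->
  W 0 ((al%:C * tau + be%:C) / tau) (- tau^-1) =
  tau * W 0 (al%:C * tau + be%:C) tau - (al%:C * tau + be%:C).
Proof.
move=> t0 a1 b1 ab; set z := al%:C * tau + be%:C.
have tn0 : tau != 0.
  by apply: contraTneq t0 => ->; rewrite /= ltxx.
set tau' := - tau^-1.
have it : complex.Im tau' = complex.Im tau / cabs tau ^+ 2.
  rewrite /tau' ImN; move: tau {t0 tn0} z @tau' => [u v] _ /=.
  by rewrite /cabs /= sqr_sqrtr ?addr_ge0 ?sqr_ge0 // opprK.
have t0' : 0 < complex.Im tau' by rewrite it divr_gt0 // exprn_gt0 // cabs_gt0.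
have z0E : 1 / 2 = (0 : R)%:C * tau + (1 / 2 : R)%:C.
  by rewrite mul0r add0r rmorphM fmorphV /= natC.
have b20 : `|1 / 2 : R| < 1 by rewrite ger0_norm; lra.
have b21 : (0 != 0 :> R) || ((1 / 2 : R) != 0).
  by rewrite div1r invr_eq0 pnatr_eq0 orbT.
have n0 : `|0 : R| < 1 by rewrite normr0.
pose z0 : R[i] := 1 / 2.
(* The double series of pi cot evaluated along rows and along columns. *)
have row x (al' be' : R) : x = al'%:C * tau + be'%:C -> `|al'| < 1 -> `|be'| < 1 ->
  (al' != 0) || (be' != 0) ->
  [/\ x != 0, exists2 c : R, 0 < c & forall n m : int,
      c * (1 + `|n%:~R : R| + `|m%:~R : R|) <= cabs (x + (n%:~R * tau + m%:~R)),
   forall n, ccvg (fun B => symsum B (fun m => ((x + (n%:~R * tau + m%:~R)) * (x - (n%:~R * tau + m%:~R)))^-1))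
     ((ct (x + n%:~R * tau) + ct (x - n%:~R * tau)) / (2 * x)),
   forall m, ccvg (fun A => symsum A (fun n => ((x + (n%:~R * tau + m%:~R)) * (x - (n%:~R * tau + m%:~R)))^-1))
     (tau^-1 * (ct (x / tau - m%:~R * tau') + ct (x / tau + m%:~R * tau')) / (2 * x)) &
   ccvg (fun A => symsum A (fun n => (ct (x + n%:~R * tau) + ct (x - n%:~R * tau)) / (2 * x)))
     (- tpi * W 0 x tau / x) /\
   ccvg (fun A => symsum A (fun m => tau^-1 * (ct (x / tau - m%:~R * tau') + ct (x / tau + m%:~R * tau')) / (2 * x)))
     (tau^-1 * (- tpi * W 0 (x / tau) tau') / x)].
  move=> xE ha hb hab; have [c c0 hc] := lattice_shift_lb t0 ha hb hab.
  rewrite -xE in hc.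
  have nz n m : x + (n%:~R * tau + m%:~R) != 0.
    rewrite -cabs_gt0; apply: lt_le_trans (hc n m); exact: mulr_gt0.
  have nz' n m : x - (n%:~R * tau + m%:~R) != 0.
    have := nz (- n) (- m); rewrite !mulrNz.
    by have -> : x + (- n%:~R * tau - m%:~R) = x - (n%:~R * tau + m%:~R) by ring.
  have x0 : x != 0 by have := nz 0 0; rewrite !mulr0z mul0r !addr0.
  have split n m : ((x + (n%:~R * tau + m%:~R)) * (x - (n%:~R * tau + m%:~R)))^-1 =
    (2 * x)^-1 * ((x + n%:~R * tau + m%:~R)^-1 + (x - n%:~R * tau - m%:~R)^-1).
    have h1 := nz n m; have h2 := nz' n m.
    rewrite -addrA in h1 *; rewrite -[x - _ - _]addrA -opprD.
    by field; rewrite h1 h2 x0.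
  have ne n : nome (x + n%:~R * tau) != 1.
    apply/eqP => /nome_eq1[m E]; have := nz n (- m).
    by rewrite addrA E mulrNz subrr eqxx.
  have ne' m : nome ((x + m%:~R) / tau) != 1.
    apply/eqP => /nome_eq1[n E]; have := nz (- n) m.
    have -> : x + ((- n)%:~R * tau + m%:~R) = ((x + m%:~R) / tau - n%:~R) * tau.
      by rewrite mulrNz; field.
    by rewrite E subrr mul0r eqxx.
  have imx : `|complex.Im x| < complex.Im tau.
    by rewrite xE ImD ImMr Im_real addr0 normrM (ger0_norm (ltW t0)) -[ltRHS]mul1r ltr_pM2r.
  have imx' : `|complex.Im (x / tau)| < complex.Im tau'.
    have -> : x / tau = al'%:C + (- be')%:C * tau'.
      by rewrite xE /tau' rmorphN; field.
    rewrite ImD ImMr Im_real add0r normrM normrN (ger0_norm (ltW t0')).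
    by rewrite -[ltRHS]mul1r ltr_pM2r.
  split=> //; first by exists c.
  - move=> n; have := ccvgZ (2 * x)^-1 (ccvgD (ct_expansion (ne n)) (ct_expansion (ne (- n)))).
    rewrite [(2 * x)^-1 * (ct _ + _)]mulrC mulrNz mulNr; apply: ccvg_ext => B.
    rewrite -[X in _ + X]symsumN -symsumD -symsumZ; apply: eq_symsum => m.
    by rewrite split mulrNz.
  - move=> m.
    have := ccvgZ (tau^-1 / (2 * x)) (ccvgD (ct_expansion (ne' m)) (ct_expansion (ne' (- m)))).
    have -> : (x + m%:~R) / tau = x / tau - m%:~R * tau' by rewrite /tau'; field.
    have -> : (x + (- m)%:~R) / tau = x / tau + m%:~R * tau' by rewrite /tau' mulrNz; field.
    rewrite [tau^-1 / (2 * x) * (ct _ + _)]mulrAC; apply: ccvg_ext => A.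
    rewrite -[X in _ + X]symsumN -symsumD -symsumZ; apply: eq_symsum => n.
    have h1 := nz n m; have h2 := nz' n m.
    have E1 : x / tau - m%:~R * tau' + n%:~R = (x + (n%:~R * tau + m%:~R)) / tau.
      by rewrite /tau'; field.
    have E2 : x / tau + m%:~R * tau' + (- n)%:~R = (x - (n%:~R * tau + m%:~R)) / tau.
      by rewrite /tau' mulrNz; field.
    by rewrite E1 E2; field; rewrite h1 h2 tn0 x0.
  - split.
      have := ccvgZ (2 * x)^-1 (ccvgD (ct_symsum_cvg t0 imx) (ct_symsum_cvg t0 imx)).
      have -> : (2 * x)^-1 * (- tpi * W 0 x tau + - tpi * W 0 x tau) = - tpi * W 0 x tau / x.
        by field.
      apply: ccvg_ext => A.
      rewrite -[X in _ + X]symsumN -symsumD -symsumZ; apply: eq_symsum => n.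
      by rewrite [LHS]mulrC mulrNz mulNr.
    have := ccvgZ (tau^-1 / (2 * x)) (ccvgD (ct_symsum_cvg t0' imx') (ct_symsum_cvg t0' imx')).
    have -> (u : R[i]) : tau^-1 / (2 * x) * (u + u) = tau^-1 * u / x by field; rewrite x0 tn0.
    apply: ccvg_ext => A.
    rewrite -[X in X + _]symsumN -symsumD -symsumZ; apply: eq_symsum => n.
    by rewrite [LHS]mulrAC mulrNz mulNr.
have [x0 [c c0 hc] r1 c1 [lr1 lc1]] := row z al be erefl a1 b1 ab.
have [y0 [d d0 hd] r2 c2 [lr2 lc2]] := row z0 0 (1 / 2) z0E n0 b20 b21.
pose g (k : int) : R := ((1 + `|k%:~R|) ^+ 2)^-1.
have g0 k : 0 <= g k by rewrite invr_ge0 sqr_ge0.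
pose K := cabs (z0 ^+ 2 - z ^+ 2) / (c ^+ 2 * d ^+ 2).
have K0 : 0 <= K by rewrite divr_ge0 ?cabs_ge0 // mulr_ge0 // sqr_ge0.
pose a (n m : int) := ((z + (n%:~R * tau + m%:~R)) * (z - (n%:~R * tau + m%:~R)))^-1
   - ((z0 + (n%:~R * tau + m%:~R)) * (z0 - (n%:~R * tau + m%:~R)))^-1.
have ha n m : cabs (a n m) <= K * (g n * g m).
  set w := n%:~R * tau + m%:~R; set s := 1 + `|n%:~R : R| + `|m%:~R : R|.
  have s0 : 0 < s.
    by have := normr_ge0 (n%:~R : R); have := normr_ge0 (m%:~R : R); rewrite /s; lra.
  have wN : (- n)%:~R * tau + (- m)%:~R = - w by rewrite /w !mulrNz; ring.
  have sN : 1 + `|(- n)%:~R : R| + `|(- m)%:~R : R| = s by rewrite !mulrNz !normrN.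
  have h1 := hc n m; have h2 := hc (- n) (- m).
  have h3 := hd n m; have h4 := hd (- n) (- m).
  rewrite wN sN in h2 h4; rewrite -/w -/s in h1 h3.
  have cs : 0 < c * s by exact: mulr_gt0.
  have ds : 0 < d * s by exact: mulr_gt0.
  have p1 : z + w != 0 by rewrite -cabs_gt0; exact: lt_le_trans h1.
  have p2 : z - w != 0 by rewrite -cabs_gt0; exact: lt_le_trans h2.
  have p3 : z0 + w != 0 by rewrite -cabs_gt0; exact: lt_le_trans h3.
  have p4 : z0 - w != 0 by rewrite -cabs_gt0; exact: lt_le_trans h4.
  have -> : a n m = (z0 ^+ 2 - z ^+ 2) / ((z + w) * (z - w) * ((z0 + w) * (z0 - w))).
    by rewrite /a -/w; field; rewrite p1 p2 p3 p4.
  rewrite cabsM cabsV /K -[leRHS]mulrA; apply: ler_wpM2l; first exact: cabs_ge0.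
  have -> : (c ^+ 2 * d ^+ 2)^-1 * (g n * g m) =
    (c ^+ 2 * d ^+ 2 * ((1 + `|n%:~R|) ^+ 2 * (1 + `|m%:~R|) ^+ 2))^-1.
    by rewrite /g -!invfM.
  have gn0 : 0 < 1 + `|n%:~R : R| by apply: ltr_pwDl.
  have gm0 : 0 < 1 + `|m%:~R : R| by apply: ltr_pwDl.
  have sq (x y : R) : 0 <= x -> 0 <= y -> (1 + x) ^+ 2 <= (1 + x + y) ^+ 2.
    by move=> hx hy; apply: lerXn2r; rewrite ?nnegrE ?lerDl ?addr_ge0.
  have nm : (1 + `|n%:~R : R|) ^+ 2 * (1 + `|m%:~R|) ^+ 2 <= s ^+ 4.
    have -> : s ^+ 4 = s ^+ 2 * s ^+ 2 by ring.
    have e1 : (1 + `|n%:~R : R|) ^+ 2 <= s ^+ 2 by apply: sq.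
    have e2 : (1 + `|m%:~R : R|) ^+ 2 <= s ^+ 2 by rewrite /s addrAC; apply: sq.
    by apply: ler_pM; rewrite ?sqr_ge0.
  rewrite lef_pV2 ?posrE; first last.
  - by rewrite !mulr_gt0 // exprn_gt0.
  - by rewrite cabs_gt0 !mulf_neq0.
  apply: (@le_trans _ _ (c ^+ 2 * d ^+ 2 * s ^+ 4)).
    by rewrite ler_wpM2l // mulr_ge0 ?sqr_ge0.
  have -> : c ^+ 2 * d ^+ 2 * s ^+ 4 = (c * s) * (c * s) * ((d * s) * (d * s)) by ring.
  have cs' := ltW cs; have ds' := ltW ds.
  rewrite !cabsM; apply: ler_pM; [exact: mulr_ge0|exact: mulr_ge0| |];
    by apply: ler_pM.
have rR n := ccvgB (r1 n) (r2 n).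
have cC m := ccvgB (c1 m) (c2 m).
have E := symsum_iterated (a := a) K0 g0 sumbd_symsq ha
  (fun n => ccvg_ext (fun B => esym (symsumB B _ _)) (rR n))
  (fun n => ccvg_ext (fun B => esym (symsumB B _ _)) (cC n))
  (ccvg_ext (fun B => esym (symsumB B _ _)) (ccvgB lr1 lr2))
  (ccvg_ext (fun B => esym (symsumB B _ _)) (ccvgB lc1 lc2)).
(* The reference value vanishes for [tau]; for [tau'] the point [z0 / tau] is [- (tau' / 2)], and
   the value [- (1 / 2)] there produces the term [- z]. *)
move: E; rewrite /z0 W0_half.
have -> : 1 / 2 / tau = - (tau' / 2) by rewrite /tau'; field.
rewrite W0_half_period // => E.
have -> : W 0 (z / tau) tau' = - tau * z / tpi * (tau^-1 * (- tpi * W 0 (z / tau) tau') / z).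
  by field; rewrite tpi_neq0 tn0 x0.
have -> : tau^-1 * (- tpi * W 0 (z / tau) tau') / z =
  - tpi * W 0 z tau / z - tpi * 0 / (1 / 2) + tau^-1 * (- tpi * - (1 / 2)) / (1 / 2).
  by move: E; rewrite !mulr0 !mul0r !subr0 => ->; rewrite subrK.
by field; rewrite tpi_neq0 tn0 x0.
Qed.

End KroneckerZeta.

(** * Eisenstein series attached to torsion points *)

Section KroneckerDerivatives.
Variable R : realType.
Implicit Types (z w tau : R[i]).

Lemma cder_W i z tau : 0 < complex.Im tau -> `|complex.Im z| < complex.Im tau ->
  nome z != 1 -> cder (fun x => W i x tau) z (tpi * W i.+1 z tau).
Proof.
move=> t0; rewrite ltr_norml => /andP[z1 z2] n1.
have p1 : 0 < complex.Im (z + tau) by rewrite ImD; lra.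
have p2 : 0 < complex.Im (- z + tau) by rewrite ImD ImN; lra.
have dT : cder (fun x => T i (- x) tau) z (- (tpi * T i.+1 (- z) tau)).
  have p3 : 0 < complex.Im (-1 * z + 0 + tau) by rewrite mulN1r addr0.
  have := cder_lin (cder_T_z i t0 p3); rewrite !mulN1r addr0.
  by apply: cder_ext => x; rewrite mulN1r addr0.
have := cderD (cderD (cderD (cder_h i n1) (cder_T_z i t0 p1))
  (cderZ ((-1) ^+ i.+1) dT)) (cder_cst ((i == 0%N)%:R / 2) z).
have -> : tpi * h i.+1 z + tpi * T i.+1 z tau
    + (-1) ^+ i.+1 * - (tpi * T i.+1 (- z) tau) + 0 = tpi * W i.+1 z tau.
  by rewrite /W /= mul0r [in RHS]exprS; ring.
by [].
Qed.

Lemma real_coords tau z : 0 < complex.Im tau ->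
  exists al be : R, z = al%:C * tau + be%:C.
Proof.
move=> t0; exists (complex.Im z / complex.Im tau).
exists (complex.Re z - complex.Im z / complex.Im tau * complex.Re tau).
apply: complex_eqP; rewrite ?ReD ?ImD ?ReMr ?ImMr ?Re_real ?Im_real.
  by rewrite addrC subrK.
by rewrite addr0 divfK // gt_eqF.
Qed.

(** Coordinates below 1 keep [z] away from all lattice points other than 0, which is excluded. The
    set is open, as differentiation in [z] requires, and it contains the reduced nonzero torsion
    points. *)
Definition in_cell tau z := exists al be : R,
  [/\ z = al%:C * tau + be%:C, `|al| < 1, `|be| < 1 & (al != 0) || (be != 0)].

Lemma in_cell_open tau z : 0 < complex.Im tau -> in_cell tau z ->
  exists2 d : R, 0 < d & forall k, cabs k <= d -> in_cell tau (z + k).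
Proof.
move=> t0 [al [be [zE a1 b1 ab]]].
have [c c0 hc] := lattice_lb t0.
have z0 : 0 < cabs z.
  rewrite zE; apply: lt_le_trans (hc al be); apply: mulr_gt0 => //.
  have a0 := normr_ge0 al; have b0 := normr_ge0 be.
  by case/orP: ab; rewrite -normr_gt0 => h; lra.
set mu := Num.min (1 - `|al|) (1 - `|be|).
have mu0 : 0 < mu by rewrite lt_min; apply/andP; split; lra.
have mua : mu <= 1 - `|al| by rewrite /mu ge_min lexx.
have mub : mu <= 1 - `|be| by rewrite /mu ge_min lexx orbT.
exists (Num.min (c * mu / 2) (cabs z / 2)).
  by rewrite lt_min !divr_gt0 // mulr_gt0.
move=> k; rewrite le_min => /andP[k1 k2].
have [x [y kE]] := real_coords k t0.
have := hc x y; rewrite -kE => h.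
have hxy : `|x| + `|y| <= mu / 2 by rewrite -(ler_pM2l c0); lra.
have x0 := normr_ge0 x; have y0 := normr_ge0 y.
exists (al + x), (be + y); split.
- by rewrite zE kE !rmorphD /=; ring.
- by apply: le_lt_trans (ler_normD _ _) _; lra.
- by apply: le_lt_trans (ler_normD _ _) _; lra.
rewrite -negb_and; apply/negP => /andP[/eqP e1 /eqP e2].
have : cabs (z + k) = 0.
  have -> : z + k = (al + x)%:C * tau + (be + y)%:C by rewrite zE kE !rmorphD /=; ring.
  by rewrite e1 e2 mul0r addr0 cabs0.
by have := cabs_lbD z k; lra.
Qed.

Lemma Im_Nrecip tau : complex.Im (- tau^-1) = complex.Im tau / cabs tau ^+ 2.
Proof.
rewrite ImN; case: tau => [u v] /=.
by rewrite /cabs /= sqr_sqrtr ?addr_ge0 ?sqr_ge0 // opprK.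
Qed.

Lemma uhp_neq0 tau : 0 < complex.Im tau -> tau != 0.
Proof. by apply: contraTneq => ->; rewrite /= ltxx. Qed.

(** Differentiating [z / tau] brings out [tau^-1], which raises the weight by one. The term [- z]
    becomes a constant, the correction at [i = 1], and has disappeared from [i = 2] on. *)
Lemma W_S i tau z : 0 < complex.Im tau -> in_cell tau z ->
  W i (z / tau) (- tau^-1) =
  tau ^+ i.+1 * W i z tau - (i == 0%N)%:R * z - (i == 1%N)%:R * tau / tpi.
Proof.
move=> t0; have tn0 := uhp_neq0 t0.
have t0' : 0 < complex.Im (- tau^-1).
  by rewrite Im_Nrecip divr_gt0 // exprn_gt0 // cabs_gt0.
elim: i z => [|i IH] z hz.
  have [al [be [-> a1 b1 ab]]] := hz.
  by rewrite kronecker_S //= expr1; ring.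
have [d d0 hd] := in_cell_open t0 hz.
have [al [be [zE a1 b1 ab]]] := hz.
have [c c0 hc] := lattice_shift_lb t0 a1 b1 ab.
rewrite -zE in hc.
have nz n m : z + (n%:~R * tau + m%:~R) != 0.
  rewrite -cabs_gt0; apply: lt_le_trans (hc n m); exact: mulr_gt0.
have ne : nome z != 1.
  apply/eqP => /nome_eq1[m E]; have := nz 0 (- m).
  by rewrite mulr0z mul0r add0r E mulrNz subrr eqxx.
have ne' : nome (z / tau) != 1.
  apply/eqP => /nome_eq1[n E]; have := nz (- n) 0.
  have -> : z + ((- n)%:~R * tau + 0%:~R) = (z / tau - n%:~R) * tau.
    by rewrite mulrNz; field.
  by rewrite E subrr mul0r eqxx.
have imz : `|complex.Im z| < complex.Im tau.
  by rewrite zE ImD ImMr Im_real addr0 normrM (ger0_norm (ltW t0)) -[ltRHS]mul1r ltr_pM2r.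
have imz' : `|complex.Im (z / tau)| < complex.Im (- tau^-1).
  have -> : z / tau = al%:C + (- be)%:C * (- tau^-1).
    by rewrite zE rmorphN; field.
  rewrite ImD ImMr Im_real add0r normrM normrN (ger0_norm (ltW t0')).
  by rewrite -[ltRHS]mul1r ltr_pM2r.
have dl : cder (fun x => W i (x / tau) (- tau^-1)) z
    (tau^-1 * (tpi * W i.+1 (z / tau) (- tau^-1))).
  have e : tau^-1 * z + 0 = z / tau by rewrite addr0 mulrC.
  have := cder_W i (z := tau^-1 * z + 0) t0'; rewrite e => /(_ imz' ne') H.
  rewrite -e in H; have := cder_lin H; rewrite e.
  by apply: cder_ext => x; rewrite addr0 mulrC.
have dr : cder (fun x => tau ^+ i.+1 * W i x tau - (i == 0%N)%:R * x
      - (i == 1%N)%:R * tau / tpi) z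
    (tau ^+ i.+1 * (tpi * W i.+1 z tau) - (i == 0%N)%:R * 1 - 0).
  apply: cderB (cder_cst _ _); apply: cderB; apply: cderZ.
    exact: cder_W.
  exact: cder_id.
have dl' : cder (fun x => tau ^+ i.+1 * W i x tau - (i == 0%N)%:R * x
      - (i == 1%N)%:R * tau / tpi) z (tau^-1 * (tpi * W i.+1 (z / tau) (- tau^-1))).
  by apply: cder_local dl => [|k kd]; [exact: d0|exact: IH (hd k kd)].
have E := cder_unique dl' dr.
have -> : W i.+1 (z / tau) (- tau^-1) =
   tau / tpi * (tau^-1 * (tpi * W i.+1 (z / tau) (- tau^-1))).
  by field; rewrite tpi_neq0 tn0.
have -> : (i.+1 == 0%N)%:R = 0 :> R[i] by [].
rewrite E eqSS; set w := W i.+1 z tau; set e := (i == 0%N)%:R.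
by rewrite [tau ^+ i.+2]exprS; field; rewrite tpi_neq0.
Qed.

Lemma W_Dint i z tau (n : int) : W i (z + n%:~R) tau = W i z tau.
Proof.
rewrite /W hDint T_Dint opprD -[- n%:~R]mulrNz T_Dint //.
Qed.

Lemma W_Dtau i z tau (n : int) : W i z (tau + n%:~R) = W i z tau.
Proof.
have H x : T i x (tau + n%:~R) = T i x tau.
  apply: eq_csum => m; rewrite -[RHS](hDint _ _ ((m.+1 : int) * n)); congr h.
  by rewrite intrM -pmulrn; ring.
by rewrite /W !H.
Qed.

End KroneckerDerivatives.

(** * Rows modulo N under the action of SL2(Z) *)

Section EisensteinSeries.
Variable R : realType.
Variables (N i : nat).
Hypothesis N0 : (0 < N)%N.
Implicit Types (a b c d n : int) (z tau : R[i]).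

(* The Eisenstein series of weight i + 1 attached to the row vector (a, b) mod N. *)
Definition eis a b tau : R[i] :=
  W i ((a %% N)%Z%:~R / N%:R * tau + b%:~R / N%:R) tau
  - (i == 0%N)%:R * (a %% N)%Z%:~R / N%:R.

Let NC : (N%:R : R[i]) != 0. Proof. by rewrite pnatr_eq0 -lt0n. Qed.

Lemma modz_split b : (b%:~R : R[i]) = (b %% N)%Z%:~R + (b %/ N)%Z%:~R * N%:R.
Proof. by rewrite {1}(divz_eq b N) intrD intrM addrC. Qed.

Lemma W_modz z b tau : W i (z + b%:~R / N%:R) tau = W i (z + (b %% N)%Z%:~R / N%:R) tau.
Proof. by rewrite {1}(modz_split b) mulrDl (mulfK NC) addrA W_Dint. Qed.

Lemma eis_per a b a' b' tau : (a = a' %[mod N])%Z -> (b = b' %[mod N])%Z ->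
  eis a b tau = eis a' b' tau.
Proof.
by move=> ha hb; rewrite /eis ha (W_modz _ b) (W_modz _ b') hb.
Qed.

Lemma eis_T a b n tau : eis a b (tau + n%:~R) = eis a (n * a + b) tau.
Proof.
rewrite /eis W_Dtau.
have -> : (a %% N)%Z%:~R / N%:R * tau + (n * a + b)%:~R / N%:R =
    (a %% N)%Z%:~R / N%:R * (tau + n%:~R) + b%:~R / N%:R + (n * (a %/ N)%Z)%:~R.
  rewrite [(n * (a %/ N)%Z)%:~R]intrM [(n * a + b)%:~R]intrD [(n * a)%:~R]intrM.
  have := modz_split a; set u := (a %% N)%Z%:~R; set v := (a %/ N)%Z%:~R => ->.
  by field; exact: NC.
by rewrite W_Dint.
Qed.

(** Excludes only the zero row mod [N], where the torsion point is a pole; the gcd of the entries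
    with [N] may be larger than 1. *)
Definition primitive_row a b := ~~ ((N %| a)%Z && (N %| b)%Z).

(** For [i = 0] the term [- z] of [W_S] is exactly what the corrections in [eis] absorb:
    [- z - a0 / N] equals [- tau * b0 / N]. *)
Lemma eis_S a b tau : 0 < complex.Im tau -> primitive_row a b ->
  eis a b (- tau^-1) = tau ^+ i.+1 * eis b (- a) tau - (i == 1%N)%:R * tau / tpi.
Proof.
move=> t0 ab; have tn0 := uhp_neq0 t0.
set a0 := (a %% N)%Z; set b0 := (b %% N)%Z.
have modlt (x : int) : `|((x %% N)%Z%:~R / N%:R : R)| < 1.
  have x0 : 0 <= (x %% N)%Z%:~R :> R by rewrite ler0z modz_ge0 // -lt0n.
  have x1 : (x %% N)%Z%:~R < N%:R :> R.
    by rewrite -[N%:R]/((N : int)%:~R) ltr_int ltz_pmod // ltz_nat.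
  by rewrite ger0_norm ?divr_ge0 // ltr_pdivrMr ?ltr0n // mul1r.
have toC (x : int) : ((x%:~R / N%:R : R)%:C : R[i]) = x%:~R / N%:R.
  by rewrite rmorphM fmorphV /= intC natC.
have hz : in_cell tau (b0%:~R / N%:R * tau - a0%:~R / N%:R).
  exists (b0%:~R / N%:R), (- (a0%:~R / N%:R)); split.
  - by rewrite rmorphN /= !toC.
  - exact: modlt.
  - by rewrite normrN; exact: modlt.
  - rewrite oppr_eq0 !mulf_eq0 !invr_eq0 !pnatr_eq0 !intr_eq0 (negPf (lt0n_neq0 N0)) !orbF.
    move: ab; rewrite /primitive_row negb_and orbC.
    by case/orP => hx; apply/orP; [left|right]; apply: contra hx => /eqP/dvdz_mod0P.
have -> : eis a b (- tau^-1) =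
  W i ((b0%:~R / N%:R * tau - a0%:~R / N%:R) / tau) (- tau^-1)
  - (i == 0%N)%:R * a0%:~R / N%:R.
  rewrite /eis -/a0 (W_modz _ b) -/b0.
  have -> // : a0%:~R / N%:R * - tau^-1 + b0%:~R / N%:R =
    (b0%:~R / N%:R * tau - a0%:~R / N%:R) / tau.
  by field; rewrite NC tn0.
rewrite (W_S _ t0 hz).
have -> : eis b (- a) tau = W i (b0%:~R / N%:R * tau - a0%:~R / N%:R) tau
   - (i == 0%N)%:R * b0%:~R / N%:R.
  rewrite /eis -/b0.
  have -> : b0%:~R / N%:R * tau + (- a)%:~R / N%:R =
      b0%:~R / N%:R * tau - a0%:~R / N%:R + (- (a %/ N)%Z)%:~R.
    by rewrite !mulrNz (modz_split a) -/a0; field; exact: NC.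
  by rewrite W_Dint.
by case: i => [|k] /=; rewrite ?expr1; field; rewrite ?NC ?tpi_neq0.
Qed.

(** Quantified over all rows, so that the laws of two matrices compose. *)
Definition row_law a b c d := forall x y tau, 0 < complex.Im tau ->
  primitive_row x y ->
  eis x y (moebius a b c d tau) =
    cocycle c d tau ^+ i.+1 * eis (x * a + y * c) (x * b + y * d) tau
    - (i == 1%N)%:R * c%:~R * cocycle c d tau / tpi.

Lemma SL2Z_row_neq0 a b c d tau : SL2Z a b c d -> 0 < complex.Im tau ->
  cocycle c d tau != 0.
Proof.
move=> det t0; rewrite /cocycle; have [c0|c0] := eqVneq c 0.
  rewrite c0 mulr0z mul0r add0r intr_eq0; apply: contra_eqN det => /eqP ->.
  by rewrite c0 !mulr0 subr0.
apply: contraTneq t0 => /(congr1 (@complex.Im R)) /=.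
rewrite -!intC ImD ImMr Im_real addr0 => /eqP; rewrite mulf_eq0 intr_eq0 (negPf c0).
by move=> /eqP ->; rewrite ltxx.
Qed.

Lemma Im_moebius a b c d tau : SL2Z a b c d -> 0 < complex.Im tau ->
  complex.Im (moebius a b c d tau) = complex.Im tau / cabs (cocycle c d tau) ^+ 2.
Proof.
move=> det t0; have Im_div (x y : R[i]) : complex.Im (x / y) =
    (complex.Im x * complex.Re y - complex.Re x * complex.Im y) / cabs y ^+ 2.
  case: x y => [x1 x2] [y1 y2]; rewrite /cabs /= sqr_sqrtr ?addr_ge0 ?sqr_ge0 //.
  by ring.
rewrite /moebius Im_div /cocycle; congr (_ / _).
rewrite -!intC !(ReD, ImD, ReMr, ImMr, Re_real, Im_real) !addr0.
have detR : a%:~R * d%:~R - b%:~R * c%:~R = 1 :> R by rewrite -!intrM -intrB det.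
have := congr1 (fun x => x * complex.Im tau) detR; rewrite mul1r => E.
by rewrite -[RHS]E; ring.
Qed.

Lemma Im_moebius_gt0 a b c d tau : SL2Z a b c d -> 0 < complex.Im tau ->
  0 < complex.Im (moebius a b c d tau).
Proof.
move=> det t0; rewrite Im_moebius // divr_gt0 // exprn_gt0 // cabs_gt0.
exact: SL2Z_row_neq0 det t0.
Qed.

Lemma primitive_row_act a b c d x y : SL2Z a b c d -> primitive_row x y ->
  primitive_row (x * a + y * c) (x * b + y * d).
Proof.
move=> det; apply: contra => /andP[h1 h2].
have ex : x = (x * a + y * c) * d - (x * b + y * d) * c.
  by rewrite -[LHS]mulr1 -det; ring.
have ey : y = (x * b + y * d) * a - (x * a + y * c) * b.
  by rewrite -[LHS]mulr1 -det; ring.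
by apply/andP; split; [rewrite ex|rewrite ey]; apply: rpredB; exact: dvdz_mulr.
Qed.

Lemma SL2Z_mul a b c d a' b' c' d' : SL2Z a b c d -> SL2Z a' b' c' d' ->
  SL2Z (a * a' + b * c') (a * b' + b * d') (c * a' + d * c') (c * b' + d * d').
Proof.
by rewrite /SL2Z => h1 h2; rewrite -[RHS]mulr1 -{1}h1 -h2; ring.
Qed.

Lemma cocycle_mul c d a' b' c' d' tau : SL2Z a' b' c' d' -> 0 < complex.Im tau ->
  cocycle c d (moebius a' b' c' d' tau) * cocycle c' d' tau =
  cocycle (c * a' + d * c') (c * b' + d * d') tau.
Proof.
move=> det t0; have J0 := SL2Z_row_neq0 det t0; move: J0.
rewrite /cocycle /moebius !intrD !intrM => J0; field; exact: J0.
Qed.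

Lemma moebius_mul a b c d a' b' c' d' tau : SL2Z a b c d -> SL2Z a' b' c' d' ->
  0 < complex.Im tau ->
  moebius a b c d (moebius a' b' c' d' tau) =
  moebius (a * a' + b * c') (a * b' + b * d') (c * a' + d * c') (c * b' + d * d') tau.
Proof.
move=> det det' t0; have J0 := SL2Z_row_neq0 det' t0.
have J1 := SL2Z_row_neq0 det (Im_moebius_gt0 det' t0).
have := SL2Z_row_neq0 (SL2Z_mul det det') t0.
move: J0 J1; rewrite /cocycle /moebius !intrD !intrM => J0 J1 J2.
by apply/eqP; rewrite eqr_div //; apply/eqP; field; exact: J0.
Qed.

(** Automorphy factors multiply; that the weight 2 corrections combine as well is the relation [cc],
    which uses the determinant of the second matrix. *)
Lemma row_law_mul a b c d a' b' c' d' : SL2Z a b c d -> SL2Z a' b' c' d' ->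
  row_law a b c d -> row_law a' b' c' d' ->
  row_law (a * a' + b * c') (a * b' + b * d') (c * a' + d * c') (c * b' + d * d').
Proof.
move=> det det' L L' x y tau t0 xy.
rewrite -moebius_mul // L ?L' //; last first.
- exact: Im_moebius_gt0.
- exact: primitive_row_act.
have -> : (x * a + y * c) * a' + (x * b + y * d) * c' =
  x * (a * a' + b * c') + y * (c * a' + d * c') by ring.
have -> : (x * a + y * c) * b' + (x * b + y * d) * d' =
  x * (a * b' + b * d') + y * (c * b' + d * d') by ring.
rewrite -(cocycle_mul c d det' t0) exprMn.
set E := eis _ _ _; set J := cocycle c d _; set J' := cocycle c' d' tau.
case: (i =P 1%N) => [->|_] /=; last by rewrite !mul0r !subr0 mulrA.
have cc : (c * a' + d * c')%:~R * J' = c'%:~R * (J * J') + c%:~R :> R[i].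
  have detC : a'%:~R * d'%:~R - b'%:~R * c'%:~R = 1 :> R[i].
    by rewrite -!intrM -intrB det'.
  rewrite /J (cocycle_mul c d det' t0) /J' /cocycle !intrD !intrM.
  have := congr1 (fun x => c%:~R * x) detC; rewrite mulr1 => cE.
  by rewrite -[X in _ = _ + X]cE; ring.
have -> : 1 * (c * a' + d * c')%:~R * (J * J') = J * ((c * a' + d * c')%:~R * J').
  by ring.
by rewrite cc; field; exact: tpi_neq0.
Qed.

Lemma row_law_eq a b c d a' b' c' d' : a = a' -> b = b' -> c = c' -> d = d' ->
  row_law a b c d -> row_law a' b' c' d'.
Proof. by move=> -> -> -> ->. Qed.

Lemma row_law_T n : row_law 1 n 0 1.
Proof.
move=> x y tau t0 xy; rewrite /moebius /cocycle !mulr0z !mulr1z !mul0r !mul1r add0r.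
rewrite invr1 !mulr1 expr1n mul1r !mulr0 !mul0r subr0 addr0 eis_T.
by rewrite [n * x]mulrC.
Qed.

Lemma row_law_S : row_law 0 (-1) 1 0.
Proof.
move=> x y tau t0 xy; rewrite /moebius /cocycle mulr0z !mulrN1z !mulr1z mul0r !mul1r !addr0.
rewrite sub0r mulN1r eis_S // !mulr1 !mulr0 add0r addr0 mulrN1.
by [].
Qed.

Lemma row_law_N1 : row_law (-1) 0 0 (-1).
Proof.
have dS : SL2Z 0 (-1) 1 0 by [].
by apply: row_law_eq (row_law_mul dS dS row_law_S row_law_S); ring.
Qed.

(** The Euclidean algorithm on the bottom row. With [d = q * c + r] the matrix is a product of one
    with bottom row [(r, - c)], of minus the identity, of the inversion and of the translation by
    [q]; the lower left entry has become smaller. *)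
Lemma row_law_SL2Z a b c d : SL2Z a b c d -> row_law a b c d.
Proof.
have dS : SL2Z 0 (-1) 1 0 by [].
have dN : SL2Z (-1) 0 0 (-1) by [].
have dT n : SL2Z 1 n 0 1 by rewrite /SL2Z; ring.
have [n] := ubnP `|c|%N; elim: n a b c d => // n IH a b c d cn det.
have [c0|c0] := eqVneq c 0.
  have ad : a * d = 1 by move: det; rewrite /SL2Z c0 mulr0 subr0.
  have /eqP := congr1 absz ad; rewrite abszM muln_eq1 => /andP[a1 _].
  have [aE|aE] : a = 1 \/ a = -1 by lia.
    have -> : d = 1 by lia.
    by rewrite aE c0; exact: row_law_T.
  have -> : d = -1 by lia.
  rewrite aE c0.
  by apply: row_law_eq (row_law_mul dN (dT (- b)) row_law_N1 (@row_law_T (- b))); ring.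
set q := (d %/ c)%Z; set r := (d %% c)%Z.
have dE : d = q * c + r := divz_eq d c.
have rc : (`|r| < n)%N.
  apply: leq_trans (_ : `|c| <= n)%N; last by [].
  have := ltz_mod d c0; have := modz_ge0 d c0; rewrite -/r; lia.
have det1 : SL2Z (b - q * a) (- a) r (- c).
  by rewrite /SL2Z -[RHS]det dE; ring.
have L1 := IH _ _ _ _ rc det1.
have det2 := SL2Z_mul det1 dN; have L2 := row_law_mul det1 dN L1 row_law_N1.
have det3 := SL2Z_mul det2 dS; have L3 := row_law_mul det2 dS L2 row_law_S.
by apply: row_law_eq (row_law_mul det3 (dT q) L3 (@row_law_T q)); rewrite ?dE; ring.
Qed.

Lemma eis_bounded a b : bounded_at_ioo (eis a b).
Proof.
set al : R := (a %% N)%Z%:~R / N%:R; set be : R := b%:~R / N%:R.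
have toC (x : int) : ((x%:~R / N%:R : R)%:C : R[i]) = x%:~R / N%:R.
  by rewrite rmorphM fmorphV /= intC natC.
have al0 : 0 <= al by rewrite divr_ge0 // ler0z modz_ge0 // -lt0n.
have al1 : al < 1.
  rewrite ltr_pdivrMr ?ltr0n // mul1r -[N%:R]/((N : int)%:~R) ltr_int.
  by rewrite ltz_pmod // ltz_nat.
(* [- z + tau] has imaginary part [m * Im tau]; reducing the first entry mod [N] is what keeps [m]
   positive and the series at [- z] bounded. *)
set m := 1 - al; have m0 : 0 < m by rewrite /m; lra.
have [B1 H1] := T_bounded i ltr01 (ltr01 : 0 < 1 :> R).
have [B2 H2] := T_bounded i m0 (ltr01 : 0 < 1 :> R).
have [B3 H3] : exists B3 : R, forall tau, 1 <= complex.Im tau ->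
    cabs (h i (al%:C * tau + be%:C)) <= B3.
  (* For [al = 0] the argument does not depend on [tau]; otherwise its imaginary part is at least
     [al] and [h i] decays. *)
  have [->|an] := eqVneq al 0.
    exists (cabs (h i (be%:C : R[i]))) => tau _.
    by rewrite mul0r add0r.
  have ap : 0 < al by rewrite lt_neqAle eq_sym an.
  have [dh _ _] := UD_h R i; have [C C0 HC] := dh _ ap.
  exists C => tau t1.
  have ht : al <= complex.Im (al%:C * tau + be%:C).
    by rewrite ImD ImMr Im_real addr0 ler_peMr.
  apply: le_trans (HC _ ht) _; rewrite -[leRHS]mulr1 ler_wpM2l // rho_le1 //.
  exact: le_trans al0 ht.
exists 1, (B3 + B1 + B2 + 1 + 1) => tau t0 t1.
rewrite normE lecR /eis -!toC -/al -/be -mulrA -toC -/al /W.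
set z := al%:C * tau + be%:C.
have zI : complex.Im z = al * complex.Im tau by rewrite ImD ImMr Im_real addr0.
apply: le_trans (cabsB _ _) _; apply: lerD; last first.
  rewrite cabsM cabs_nat cabs_real ger0_norm //.
  by case: (i == 0%N); rewrite ?mul1r ?mul0r // ltW.
apply: le_trans (cabsD _ _) _; apply: lerD; last first.
  rewrite cabsM cabsV !cabs_nat.
  by case: (i == 0%N); rewrite /= ?mul0r ?ler01 // mul1r invf_le1 ?ler1n.
apply: le_trans (cabsD _ _) _; apply: lerD; last first.
  rewrite cabsM cabsX cabsN cabs1 expr1n mul1r; apply: H2 => //.
  by rewrite ImD ImN zI /m; nra.
apply: le_trans (cabsD _ _) _; apply: lerD; first exact: H3.
by apply: H1 => //; rewrite ImD zI; nra.
Qed.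

(** For a row [(0, b)] the torsion point is constant in [tau], so that only the two series vary. *)
Lemma eis0_hol b tau : 0 < complex.Im tau -> exists l, cder (eis 0 b) tau l.
Proof.
move=> t0; have i0 x : complex.Im (x%:~R / N%:R : R[i]) = 0.
  by rewrite -intC -natC -fmorphV -rmorphM.
have [l1 h1] := cder_T_tau i t0 (i0 b).
have i1 : complex.Im (- (b%:~R / N%:R : R[i])) = 0 by rewrite ImN i0 oppr0.
have [l2 h2] := cder_T_tau i t0 i1.
set z := b%:~R / N%:R in h1 h2 *.
exists (0 + l1 + (-1) ^+ i.+1 * l2 + 0).
have := cderD (cderD (cderD (cder_cst (h i z) tau) h1) (cderZ ((-1) ^+ i.+1) h2))
  (cder_cst ((i == 0%N)%:R / 2) tau).
apply: cder_ext => x; rewrite /eis mod0z mulr0z !mulr0 !mul0r add0r subr0.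
by rewrite /W.
Qed.

End EisensteinSeries.

(** * Mixed-weight quasimodular forms *)

Section QuasimodularAlgebra.
Variable R : realType.
Implicit Types (f g : R[i] -> R[i]) (tau : R[i]).

Lemma holomorphic_cder f : (forall tau, in_uhp tau -> exists l, cder f tau l) ->
  holomorphic_uhp f.
Proof. by move=> H tau /H[l]; exact: cder_derivable. Qed.

Lemma holomorphic_cst (c : R[i]) : holomorphic_uhp (fun=> c).
Proof. by apply: holomorphic_cder => tau _; exists 0; exact: cder_cst. Qed.

Lemma holomorphicD f g : holomorphic_uhp f -> holomorphic_uhp g ->
  holomorphic_uhp (fun tau => f tau + g tau).
Proof. by move=> hf hg tau t0; exact: derivableD (hf _ t0) (hg _ t0). Qed.

Lemma holomorphicM f g : holomorphic_uhp f -> holomorphic_uhp g ->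
  holomorphic_uhp (fun tau => f tau * g tau).
Proof. by move=> hf hg tau t0; exact: derivableM (hf _ t0) (hg _ t0). Qed.

Lemma holomorphic_sum I (r : seq I) (P : pred I) (F : I -> R[i] -> R[i]) :
  (forall i, P i -> holomorphic_uhp (F i)) ->
  holomorphic_uhp (fun tau => \sum_(i <- r | P i) F i tau).
Proof.
move=> H; elim: r => [|i r IH].
  have -> : (fun tau => \sum_(i <- [::] | P i) F i tau) = fun=> 0.
    by apply/funext => tau; rewrite big_nil.
  exact: holomorphic_cst.
have -> : (fun tau => \sum_(j <- i :: r | P j) F j tau) =
    fun tau => (if P i then F i tau else 0) + \sum_(j <- r | P j) F j tau.
  by apply/funext => tau; rewrite big_cons; case: ifP; rewrite ?add0r.
refine (holomorphicD (f := fun tau => if P i then F i tau else 0) _ IH).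
case Pi: (P i); [exact: H|exact: holomorphic_cst].
Qed.

Lemma bounded_cst (c : R[i]) : bounded_at_ioo (fun=> c).
Proof. by exists 0, (cabs c) => tau _ _; rewrite normE lecR. Qed.

Lemma boundedD f g : bounded_at_ioo f -> bounded_at_ioo g ->
  bounded_at_ioo (fun tau => f tau + g tau).
Proof.
move=> [A [B H]] [A' [B' H']]; exists (Num.max A A'), (B + B') => tau t0.
rewrite ge_max => /andP[/(H _ t0) h1 /(H' _ t0) h2].
by apply: le_trans (ler_normD _ _) _; rewrite rmorphD lerD.
Qed.

Lemma boundedM f g : bounded_at_ioo f -> bounded_at_ioo g ->
  bounded_at_ioo (fun tau => f tau * g tau).
Proof.
move=> [A [B H]] [A' [B' H']]; exists (Num.max A A'), (B * B') => tau t0.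
rewrite ge_max => /andP[/(H _ t0) h1 /(H' _ t0) h2].
by rewrite normrM rmorphM ler_pM.
Qed.

Lemma bounded_sum I (r : seq I) (P : pred I) (F : I -> R[i] -> R[i]) :
  (forall i, P i -> bounded_at_ioo (F i)) ->
  bounded_at_ioo (fun tau => \sum_(i <- r | P i) F i tau).
Proof.
move=> H; elim: r => [|i r IH].
  have -> : (fun tau => \sum_(i <- [::] | P i) F i tau) = fun=> 0.
    by apply/funext => tau; rewrite big_nil.
  exact: bounded_cst.
have -> : (fun tau => \sum_(j <- i :: r | P j) F j tau) =
    fun tau => (if P i then F i tau else 0) + \sum_(j <- r | P j) F j tau.
  by apply/funext => tau; rewrite big_cons; case: ifP; rewrite ?add0r.
refine (boundedD (f := fun tau => if P i then F i tau else 0) _ IH).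
case Pi: (P i); [exact: H|exact: bounded_cst].
Qed.

Lemma bounded_uhp f g : (forall tau, in_uhp tau -> f tau = g tau) ->
  bounded_at_ioo f -> bounded_at_ioo g.
Proof. by move=> fg [A [B H]]; exists A, B => tau t0; rewrite -fg //; exact: H. Qed.

Definition principal (M : nat) (n : int) : R[i] := (coprimez n M)%:R.

Lemma principal_character M : dirichlet_character M (principal M).
Proof.
split; rewrite /principal.
- by rewrite coprimezE coprime1n.
- by move=> m n; rewrite coprimezMl -natrM mulnb.
- move=> m n mn; congr (nat_of_bool _)%:R.
  by rewrite /coprimez -(gcdz_modl m) mn gcdz_modl.
- by move=> n; case: coprimez; rewrite ?oner_eq0 ?eqxx.
Qed.

Lemma character_mul M (chi psi : int -> R[i]) : dirichlet_character M chi ->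
  dirichlet_character M psi -> dirichlet_character M (fun n => chi n * psi n).
Proof.
move=> [c1 cM cP c0] [p1 pM pP p0]; split.
- by rewrite c1 p1 mulr1.
- by move=> m n; rewrite cM pM mulrACA.
- by move=> m n mn; rewrite (cP _ _ mn) (pP _ _ mn).
- by move=> n; rewrite mulf_eq0 negb_or c0 p0 andbb.
Qed.

Lemma Gamma0_coprime (M : nat) a b c d : Gamma0 M a b c d -> coprimez d M.
Proof.
move=> [det /dvdzP[q cq]]; apply/coprimezP; exists (a, - b * q) => /=.
by rewrite -det cq; ring.
Qed.

Lemma quasimodular_cst M (c : R[i]) : quasimodular 0 M (principal M) (fun=> c).
Proof.
split; first exact: holomorphic_cst.
  exists 0%N, (fun _ _ => c); split=> [_|a b cc d hG tau t0]; first exact: holomorphic_cst.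
  by rewrite /principal (Gamma0_coprime hG) big_ord1 !expr0 !mul1r mulr1.
move=> a b cc d _; have -> : (fun tau => cocycle cc d tau ^- 0 * c) = fun=> c.
  by apply/funext => tau; rewrite expr0 invr1 mul1r.
exact: bounded_cst.
Qed.

Lemma quasimodularM w w' M chi psi f g : quasimodular w M chi f ->
  quasimodular w' M psi g ->
  quasimodular (w + w') M (fun n => chi n * psi n) (fun tau => f tau * g tau).
Proof.
move=> [hf [s [F [hF F1]]] cf] [hg [s' [G [hG G1]]] cg]; split.
- exact: holomorphicM.
- exists (s + s')%N, (fun (k : 'I_(s + s').+1) tau =>
    \sum_(i < s.+1) \sum_(j < s'.+1 | (i + j == k)%N) F i tau * G j tau); split.
    move=> k; apply: holomorphic_sum => i _; apply: holomorphic_sum => j _.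
    exact: holomorphicM (hF i) (hG j).
  move=> a b c d hGam tau t0; have e1 := F1 _ _ _ _ hGam _ t0; have e2 := G1 _ _ _ _ hGam _ t0.
  rewrite e1 e2 (exprD _ w w'); set X := c%:~R / _ in e1 e2 *; clear e1 e2.
  have -> : \sum_(k < (s + s').+1)
      (\sum_(i < s.+1) \sum_(j < s'.+1 | (i + j == k)%N) F i tau * G j tau) * X ^+ k =
      (\sum_(i < s.+1) F i tau * X ^+ i) * (\sum_(j < s'.+1) G j tau * X ^+ j).
    rewrite mulr_suml; under eq_bigr do rewrite mulr_suml.
    rewrite exchange_big /=; apply: eq_bigr => i _; rewrite mulr_sumr.
    under eq_bigr do rewrite mulr_suml big_mkcond /=.
    rewrite exchange_big /=; apply: eq_bigr => j _.
    have ij : (i + j < (s + s').+1)%N by have := ltn_ord i; have := ltn_ord j; lia.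
    rewrite (bigD1 (Ordinal ij)) //= eqxx big1 ?addr0; last first.
      move=> k kn; case: eqP => // e; case/eqP: kn; exact: val_inj.
    by rewrite exprD; ring.
  by ring.
- move=> a b c d det; have := boundedM (cf _ _ _ _ det) (cg _ _ _ _ det).
  by apply: bounded_uhp => tau _; rewrite exprD invfM; ring.
Qed.

(* All constituents have the same level N, which makes the notion stable under
   products. *)
Inductive mixed (N : nat) : nat -> (R[i] -> R[i]) -> Prop :=
| Mixed_qm K w chi g f of (w <= K)%N & dirichlet_character N chi &
    quasimodular w N chi g & (forall tau, in_uhp tau -> f tau = g tau) :
    mixed N K f
| Mixed_add K f g e of mixed N K f & mixed N K g &
    (forall tau, in_uhp tau -> e tau = f tau + g tau) : mixed N K e.

Lemma mixed_ext N K f g : (forall tau, in_uhp tau -> g tau = f tau) ->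
  mixed N K f -> mixed N K g.
Proof.
move=> gf hf; elim: hf g gf => [K' w chi e f' wK hchi he fe g gf|K' f1 f2 e h1 _ h2 _ E g gf].
  by apply: Mixed_qm wK hchi he _ => tau t0; rewrite gf ?fe.
by apply: Mixed_add h1 h2 _ => tau t0; rewrite gf ?E.
Qed.

Lemma mixed_leq N K K' f : (K <= K')%N -> mixed N K f -> mixed N K' f.
Proof.
move=> KK hf; elim: hf K' KK => [k w chi e f' wK hchi he fe K' KK|k f1 f2 e _ IH1 _ IH2 E K' KK].
  by apply: Mixed_qm (leq_trans wK KK) hchi he fe.
exact: Mixed_add (IH1 _ KK) (IH2 _ KK) E.
Qed.

Lemma mixed_cst N K (c : R[i]) : mixed N K (fun=> c).
Proof.
exact: Mixed_qm (leq0n K) (principal_character N) (quasimodular_cst N c) _.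
Qed.

Lemma mixedD N K f g : mixed N K f -> mixed N K g -> mixed N K (fun tau => f tau + g tau).
Proof. by move=> hf hg; exact: Mixed_add hf hg _. Qed.

Lemma mixedM N K K' f g : mixed N K f -> mixed N K' g ->
  mixed N (K + K') (fun tau => f tau * g tau).
Proof.
move=> hf; elim: hf K' g => [k w chi f0 f' wK hchi hf0 fe|k f1 f2 e _ IH1 _ IH2 E] K' g hg.
  elim: hg => [k' w' psi g0 g' wK' hpsi hg0 ge|k' g1 g2 e _ IH1 _ IH2 E].
    apply: Mixed_qm (leq_add wK wK') (character_mul hchi hpsi) (quasimodularM hf0 hg0) _.
    by move=> tau t0; rewrite fe // ge.
  by apply: Mixed_add IH1 IH2 _ => tau t0; rewrite E // mulrDr.
by apply: Mixed_add (IH1 _ _ hg) (IH2 _ _ hg) _ => tau t0; rewrite E // mulrDl.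
Qed.

Lemma mixedZ N K (c : R[i]) f : mixed N K f -> mixed N K (fun tau => c * f tau).
Proof. by move=> hf; exact: (mixedM (mixed_cst N 0 c) hf). Qed.

Lemma mixed_sum N K I (r : seq I) (P : pred I) (F : I -> R[i] -> R[i]) :
  (forall i, P i -> mixed N K (F i)) -> mixed N K (fun tau => \sum_(i <- r | P i) F i tau).
Proof.
move=> H; elim: r => [|i r IH].
  by apply: mixed_ext (mixed_cst N K 0) => tau _; rewrite big_nil.
have [Pi|nPi] := boolP (P i).
  by apply: mixed_ext (mixedD (H i Pi) IH) => tau _; rewrite big_cons Pi.
by apply: mixed_ext IH => tau _; rewrite big_cons (negPf nPi).
Qed.

Lemma mixedX N K f m : mixed N K f -> mixed N (m * K) (fun tau => f tau ^+ m).
Proof.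
move=> hf; elim: m => [|m IH].
  by apply: mixed_ext (mixed_cst N _ 1) => tau _; rewrite expr0.
by rewrite mulSn; apply: mixed_ext (mixedM hf IH) => tau _; rewrite exprS.
Qed.

Lemma mixed_prod N I (r : seq I) (K : I -> nat) (F : I -> R[i] -> R[i]) :
  (forall i, mixed N (K i) (F i)) ->
  mixed N (\sum_(i <- r) K i) (fun tau => \prod_(i <- r) F i tau).
Proof.
move=> H; elim: r => [|i r IH].
  by apply: mixed_ext (mixed_cst N _ 1) => tau _; rewrite big_nil.
by rewrite big_cons; apply: mixed_ext (mixedM (H i) IH) => tau _; rewrite big_cons.
Qed.

Lemma mixed_mixed_weight N K f : (0 < N)%N -> mixed N K f ->
  mixed_weight_quasimodular K N f.
Proof.
move=> N0; elim=> {K f} [K w chi g f wK hchi hg fg|K f g e _ IH1 _ IH2 E].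
  exists 1%N, (fun=> w), (fun=> N), (fun=> chi), (fun=> g).
  split=> [_|tau t0]; first by split; rewrite ?N0 ?leqnn.
  by rewrite big_ord1 fg.
case: IH1 => r1 [w1 [M1 [c1 [g1 [h1 e1]]]]].
case: IH2 => r2 [w2 [M2 [c2 [g2 [h2 e2]]]]].
pose cs T (u : 'I_r1 -> T) (v : 'I_r2 -> T) (k : 'I_(r1 + r2)) :=
  match fintype.split k with inl i => u i | inr j => v j end.
exists (r1 + r2)%N, (cs _ w1 w2), (cs _ M1 M2), (cs _ c1 c2), (cs _ g1 g2).
split=> [k|tau t0]; first by rewrite /cs; case: (fintype.split k).
rewrite E // e1 // e2 // big_split_ord /=; congr (_ + _); apply: eq_bigr => k _.
  by rewrite /cs (unsplitK (inl k)).
by rewrite /cs (unsplitK (inr k)).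
Qed.

End QuasimodularAlgebra.

Lemma nome_primitive (R : realType) (m : nat) : (0 < m)%N ->
  m.-primitive_root (nome (m%:R^-1 : R[i])).
Proof.
move=> m0; apply/andP; split=> //; apply/forallP => i; rewrite unity_rootE.
have [->|im] := eqVneq i.+1 m; first by rewrite nome_root1 // eqxx.
by rewrite (negPf (nome_root _ _)) //= ltn_neqAle im ltn_ord.
Qed.

(** * Characters as eigenvalues of multiplication by units *)

Section DirichletEigenvectors.
Variable R : realType.
Variable n : nat.
Local Notation N := n.+1.
Implicit Types (d e : int).

Definition residue d : 'I_N := inord `|(d %% N)%Z|.

Lemma residueE d : (residue d : int) = (d %% N)%Z.
Proof.
have d0 : 0 <= (d %% N)%Z by rewrite modz_ge0.
have d1 : (d %% N)%Z < N by rewrite ltz_pmod.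
rewrite /residue inordK; first by rewrite gez0_abs.
by rewrite -ltz_nat gez0_abs.
Qed.

Lemma residue_eqP d e : reflect (d = e %[mod N])%Z (residue d == residue e).
Proof.
apply: (iffP eqP) => [E|E]; last by rewrite /residue E.
by rewrite -!residueE E.
Qed.

Lemma residueK (b : 'I_N) : residue (b : int) = b.
Proof.
have hb : ((b : int) %% N)%Z = b by rewrite modz_nat modn_small.
by apply: val_inj; rewrite /= /residue hb /= inordK.
Qed.

(** On column vectors, seen as functions on the residues, this is [G -> G (d * _)]; the eigenvectors
    below are row vectors. *)
Definition shift_mx d : 'M[R[i]]_N := \matrix_(b, b') (b' == residue (d * b))%:R.

Lemma residueM d (b : int) : residue (d * residue b) = residue (d * b).
Proof. by apply/eqP/residue_eqP; rewrite residueE modzMmr. Qed.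

Lemma shift_mxM d e : shift_mx d *m shift_mx e = shift_mx (d * e).
Proof.
apply/matrixP => b b'; rewrite !mxE (bigD1 (residue (d * b))) //= big1 ?addr0.
  by rewrite !mxE eqxx mul1r residueM mulrA [e * d]mulrC.
by move=> k kd; rewrite !mxE (negPf kd) mul0r.
Qed.

Lemma shift_mx1 : shift_mx 1 = 1%:M.
Proof. by apply/matrixP => b b'; rewrite !mxE mul1r residueK eq_sym. Qed.

Lemma shift_mx_mod d e : (d = e %[mod N])%Z -> shift_mx d = shift_mx e.
Proof.
move=> de; apply/matrixP => b b'; rewrite !mxE; congr (_ == _)%:R.
by apply/eqP/residue_eqP; rewrite -modzMml de modzMml.
Qed.

Lemma shift_mxX d k : shift_mx d ^+ k = shift_mx (d ^+ k).
Proof.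
elim: k => [|k IH]; first by rewrite !expr0 shift_mx1.
by rewrite !exprS -shift_mxM IH.
Qed.

(** Euler's theorem makes ['X^m - 1] with [m = totient N] annihilate the matrix, and over the
    complex numbers this polynomial has distinct roots. *)
Lemma shift_mx_diagonalizable d : coprimez d N -> diagonalizable (shift_mx d).
Proof.
move=> cd; set m := totient N; have m0 : (0 < m)%N by rewrite totient_gt0.
have dm : shift_mx d ^+ m = 1.
  rewrite shift_mxX -[1]shift_mx1; apply: shift_mx_mod.
  set r := `|(d %% N)%Z|%N.
  have rE : (r : int) = (d %% N)%Z by rewrite gez0_abs // modz_ge0.
  have cr : coprime r N.
    by move: cd; rewrite /coprimez -gcdz_modl -rE => /eqP[/eqP].
  rewrite -modzXm -rE -!natz -natrX !natz !modz_nat; congr Posz.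
  exact: cyclic.Euler_exp_totient.
have zm := nome_primitive R m0; set z := nome _ in zm.
apply/mxpoly.diagonalizableP; exists [seq z ^+ k | k <- iota 0 m].
  rewrite map_inj_in_uniq ?iota_uniq // => k l; rewrite !mem_iota /= !add0n => km lm.
  by move/eqP; rewrite (eq_prim_root_expr zm) !modn_small // => /eqP.
have -> : \prod_(x <- [seq z ^+ k | k <- iota 0 m]) ('X - x%:P) = 'X^m - 1.
  by rewrite big_map -(factor_Xn_sub_1 zm) /index_iota subn0.
apply: mxminpoly_min.
by rewrite rmorphB rmorphXn rmorph1 /= horner_mx_X dm subrr.
Qed.

Lemma character_basis : exists (v : 'I_N -> 'I_N -> R[i]) (chi : 'I_N -> int -> R[i]),
  [/\ forall k, dirichlet_character N (chi k),
      forall k d (G : int -> R[i]), coprimez d N ->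
        (forall x y, (x = y %[mod N])%Z -> G x = G y) ->
        \sum_b v k b * G (d * b) = chi k d * \sum_b v k b * G b
    & forall c : 'I_N -> R[i], exists y : 'I_N -> R[i],
        forall b, c b = \sum_k y k * v k b].
Proof.
(* The shift_mx d commute and have finite order, hence are simultaneously
   diagonalizable. *)
pose ds := [seq d : 'I_N <- enum 'I_N | coprime d N].
pose As := [seq shift_mx (d : int) | d : 'I_N <- ds].
have [P Pu /allP PA] : mxpoly.codiagonalizable As.
  apply/mxpoly.codiagonalizableP; split.
    move=> A B /mapP[d _ ->] /mapP[e _ ->].
    by rewrite /comm_mx !shift_mxM mulrC.
  move=> A /mapP[d]; rewrite mem_filter => /andP[cd _] ->.
  exact: shift_mx_diagonalizable.
have diagE d : coprimez d N -> exists D : 'rV_N, P *m shift_mx d = diag_mx D *m P.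
  move=> cd; have -> : shift_mx d = shift_mx (residue d : int).
    by apply: shift_mx_mod; rewrite residueE modz_mod.
  have /PA/diagonalizable_forPex[D /simmxPp H] : shift_mx (residue d : int) \in As.
    apply: map_f; rewrite mem_filter mem_enum andbT.
    by move: cd; rewrite /coprimez -gcdz_modl -residueE => /eqP[/eqP].
  by exists D; apply: H; exact: stablemx_unit.
(* The eigenvalue of the [k]-th row of [P], extended by 0 to integers not prime to [N]. *)
pose chi (k : 'I_N) d := if coprimez d N then (P *m shift_mx d *m invmx P) k k else 0.
have eig d k b : coprimez d N -> (P *m shift_mx d) k b = chi k d * P k b.
  move=> cd; have [D E] := diagE d cd.
  rewrite /chi cd E mulmxK // mul_diag_mx !mxE eqxx mulr1n //.
have row0 k : exists b, P k b != 0.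
  apply: contrapT => H; have := congr1 (fun A : 'M[R[i]]_(N) => A k k) (mulmxV Pu).
  rewrite !mxE eqxx big1 => [/esym/eqP|b _]; first by rewrite oner_eq0.
  have -> : P k b = 0 by apply/eqP/negPn/negP => h; apply: H; exists b.
  by rewrite mul0r.
have chi1 k : chi k 1 = 1.
  by rewrite /chi coprimezE coprime1n shift_mx1 mulmx1 mulmxV // mxE eqxx.
have chiM k d e : chi k (d * e) = chi k d * chi k e.
  have [cd|cd] := boolP (coprimez d N); last first.
    by rewrite /chi coprimezMl (negPf cd) mul0r.
  have [ce|ce] := boolP (coprimez e N); last first.
    by rewrite /chi coprimezMl (negPf ce) andbF mulr0.
  have cde : coprimez (d * e) N by rewrite coprimezMl cd.
  have [b Pb] := row0 k; apply: (mulIf Pb).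
  transitivity ((P *m shift_mx (d * e)) k b); first exact: esym (eig _ _ _ cde).
  rewrite -shift_mxM mulmxA mxE.
  under eq_bigr do rewrite eig // -mulrA.
  rewrite -mulr_sumr -[RHS]mulrA; congr (_ * _).
  by have := eig e k b ce; rewrite mxE.
exists (fun k b => P k b), chi; split.
- move=> k; split; [exact: chi1|exact: chiM| |].
    move=> d e de; rewrite /chi (shift_mx_mod de).
    by rewrite /coprimez -(gcdz_modl d) de gcdz_modl.
  move=> d; have [cd|cd] := boolP (coprimez d N); last by rewrite /chi (negPf cd) eqxx.
  have /coprimezP[[u w] /= uw] := cd.
  have : chi k u * chi k d = 1.
    rewrite -chiM -(chi1 k) /chi.
    have E : (u * d = 1 %[mod N])%Z by rewrite -uw addrC modzMDl.
    by rewrite (shift_mx_mod E) /coprimez -(gcdz_modl (u * d)) E gcdz_modl.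
  by move=> H; apply/eqP => h; move/eqP: H; rewrite h mulr0 eq_sym oner_eq0.
- move=> k d G cd Gper.
  have -> : \sum_b P k b * G (d * b) =
      \sum_b \sum_(b' : 'I_N) P k b * (b' == residue (d * b))%:R * G b'.
    apply: eq_bigr => b _; rewrite (bigD1 (residue (d * b))) //= big1 ?addr0.
      by rewrite eqxx mulr1; congr (_ * _); apply: Gper; rewrite residueE modz_mod.
    by move=> b' nb; rewrite (negPf nb) mulr0 mul0r.
  rewrite exchange_big mulr_sumr /=; apply: eq_bigr => b' _.
  rewrite -mulr_suml mulrA; congr (_ * _).
  have := eig d k b' cd; rewrite mxE => <-.
  by apply: eq_bigr => b _; rewrite mxE.
move=> c; exists (fun k => ((\row_b c b) *m invmx P) 0 k) => b.
have := congr1 (fun A : 'M[R[i]]_(1, N) => A 0 b) (mulmxKV Pu (\row_b c b)).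
by rewrite [in RHS]mxE => <-; rewrite mxE.
Qed.

End DirichletEigenvectors.

(** * Quasimodularity of the Eisenstein series *)

Section EisensteinQuasimodular.
Variable R : realType.
Implicit Types (z tau : R[i]).

(** The law moves to another row, where [eis_bounded] applies. Besides that it leaves a multiple of
    [c / (c tau + d)], and [|c|] is at most [|c tau + d|] once [Im tau] is at least 1. *)
Lemma eis_cusp (N i : nat) (x y : int) : (0 < N)%N -> primitive_row N x y ->
  holomorphic_at_cusps i.+1 (@eis R N i x y).
Proof.
move=> N0 xy a b c d det.
have bc : bounded_at_ioo (fun tau : R[i] => - ((i == 1%N)%:R / tpi) * (c%:~R / cocycle c d tau)).
  apply: boundedM; first exact: bounded_cst.
  exists 1, 1 => tau t0 t1; rewrite normE lecR cabsM cabsV.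
  have J0 := SL2Z_row_neq0 det t0.
  rewrite ler_pdivrMr ?cabs_gt0 // mul1r.
  apply: le_trans (Im_le_cabs _); rewrite /cocycle ImD -!intC ImMr Im_real addr0.
  by rewrite cabs_real normrM ler_peMr // (ger0_norm (ltW t0)).
apply: bounded_uhp _ (boundedD (eis_bounded R i N0 (x * a + y * c) (x * b + y * d)) bc).
move=> tau t0; have J0 := SL2Z_row_neq0 det t0.
rewrite (row_law_SL2Z i N0 det t0 xy); set J := cocycle c d tau in J0 *.
rewrite mulrBr mulKf ?expf_neq0 //; congr (_ + _).
case: (i =P 1%N) => [->|_]; first by rewrite /=; field; rewrite J0 tpi_neq0.
by rewrite !mul0r mulr0 oppr0 mul0r.
Qed.

Lemma bounded_scale (c : R[i]) (f : R[i] -> R[i]) : bounded_at_ioo f ->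
  bounded_at_ioo (fun tau => c * f tau).
Proof. by move=> hf; exact: (boundedM (bounded_cst c) hf). Qed.

Lemma coprimez_primitive (N : nat) (b : int) : (1 < N)%N -> coprimez b N ->
  primitive_row N 0 b.
Proof.
move=> N1 cb; rewrite /primitive_row dvdz0 /=; apply/negP => Nb.
have : (N %| gcdz b N)%Z by rewrite dvdz_gcd Nb dvdzz.
by move: cb => /eqP ->; rewrite dvdz1 /=; lia.
Qed.

Lemma eis_combination_mixed (n i : nat) (c : 'I_n.+2 -> R[i]) :
  (forall b : 'I_n.+2, ~~ coprime b n.+2 -> c b = 0) ->
  mixed n.+2 i.+1 (fun tau => \sum_(b < n.+2) c b * @eis R n.+2 i 0 b tau).
Proof.
move=> c0; set N := n.+2; have N0 : (0 < N)%N by [].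
have [v [chi [hchi hv hc]]] := character_basis R n.+1.
have [y yE] := hc c.
pose F k tau := \sum_(b < N | coprime b N) v k b * @eis R N i 0 b tau.
have E tau : \sum_(b < N) c b * eis N i 0 b tau = \sum_k y k * F k tau.
  under [RHS]eq_bigr do rewrite mulr_sumr.
  rewrite exchange_big /= [RHS]big_mkcond /=; apply: eq_bigr => b _.
  case: ifP => [cb|/negbT/c0 ->]; last by rewrite mul0r.
  by rewrite yE mulr_suml; apply: eq_bigr => k _; rewrite mulrA.
apply: mixed_ext (fun tau _ => E tau) _; apply: mixed_sum => k _; apply: mixedZ.
have cb0 (b : 'I_N) : coprime b N -> primitive_row N 0 b.
  by move=> cb; apply: coprimez_primitive.
(* Setting the value to 0 off the units gives a function of all integers, periodic mod [N], to which
   [character_basis] applies; the pole at [b = 0] is removed at the same time. *)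
pose G tau (b : int) : R[i] := if coprimez b N then eis N i 0 b tau else 0.
have copN (b e : int) : (b = e %[mod N])%Z -> coprimez b N = coprimez e N.
  by move=> be; rewrite /coprimez -(gcdz_modl b) be gcdz_modl.
have Gper tau (b e : int) : (b = e %[mod N])%Z -> G tau b = G tau e.
  by move=> be; rewrite /G (copN _ _ be) (eis_per i N0 tau (erefl (0 %% N)%Z) be).
have FE tau : F k tau = \sum_(b < N) v k b * G tau b.
  rewrite /F big_mkcond /=; apply: eq_bigr => b _; rewrite /G coprimezE !absz_nat.
  by case: ifP; rewrite ?mulr0.
(* Each unit contributes the same weight 2 correction, and [kap] counts them with their
   coefficients. As the indicator of the units is itself invariant under [d], [kap = chi k d * kap],
   so the correction too fits behind the factor [chi k d]. *)
pose kap : R[i] := \sum_(b < N) v k b * (coprimez b N)%:R.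
apply: (@Mixed_qm R N i.+1 i.+1 (chi k) (F k) (F k)) => //; split.
- apply: holomorphic_sum => b cb; apply: holomorphicM; first exact: holomorphic_cst.
  apply: holomorphic_cder => tau t0; exact: eis0_hol.
- exists 1%N, (fun j tau => if j == 0%N :> nat then F k tau else - ((i == 1%N)%:R / tpi) * kap).
  split.
    move=> j; case: (val j == 0%N); last exact: holomorphic_cst.
    apply: holomorphic_sum => b cb; apply: holomorphicM; first exact: holomorphic_cst.
    apply: holomorphic_cder => tau t0; exact: eis0_hol.
  move=> a b cc d hG tau t0; have cd := Gamma0_coprime hG; case: hG => det Ncc.
  have J0 := SL2Z_row_neq0 det t0.
  rewrite !big_ord_recl big_ord0 /= expr0 expr1 addr0 mulr1.
  set J := cocycle cc d tau in J0 *.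
  have GE e : G (moebius a b cc d tau) e =
      J ^+ i.+1 * G tau (d * e) - (i == 1%N)%:R * cc%:~R * J / tpi * (coprimez e N)%:R.
    rewrite /G coprimezMl cd /=; have [ce|_] := boolP (coprimez e N); last first.
      by rewrite !mulr0 subr0.
    rewrite (row_law_SL2Z i N0 det t0 (coprimez_primitive _ ce)) // mulr1.
    congr (_ * _ - _); apply: eis_per => //; rewrite mul0r add0r ?[e * d]mulrC //.
    by apply/eqP; rewrite eqz_mod_dvd subr0 dvdz_mull.
  have vGE e : v k e * G (moebius a b cc d tau) e =
      J ^+ i.+1 * (v k e * G tau (d * e)) -
      (i == 1%N)%:R * cc%:~R * J / tpi * (v k e * (coprimez e N)%:R).
    by rewrite GE mulrBr mulrCA [v k e * (_ * _)]mulrCA.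
  have FM : F k (moebius a b cc d tau) =
      J ^+ i.+1 * (\sum_e v k e * G tau (d * e)) -
      (i == 1%N)%:R * cc%:~R * J / tpi * (\sum_(e < N) v k e * (coprimez e N)%:R).
    by rewrite FE !mulr_sumr -sumrB; exact: eq_bigr (fun e _ => vGE e).
  rewrite FM (hv k d _ cd (Gper tau)) (FE tau).
  have kE : kap = chi k d * kap.
    rewrite {2}/kap -(hv k d (fun e => (coprimez e N)%:R) cd); last first.
      by move=> e f /copN ->.
    by apply: eq_bigr => e _; rewrite coprimezMl cd.
  rewrite -/kap {1}kE; set S := \sum_(b0 < N) _.
  case: (i =P 1%N) => [->|_]; first by rewrite /=; field; rewrite ?J0 ?tpi_neq0.
  by rewrite !mul0r oppr0 ?mul0r !addr0; ring.
- move=> a b cc d det.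
  have H := bounded_sum (index_enum 'I_N) (P := fun e : 'I_N => coprime e N)
    (fun e ce => bounded_scale (v k e) (eis_cusp i N0 (cb0 e ce) det)).
  apply: bounded_uhp _ H => tau _; rewrite /F mulr_sumr; apply: eq_bigr => e _.
  by rewrite mulrCA.
Qed.

End EisensteinQuasimodular.

(** * Level one through the points of order two *)

Section LevelOne.
Variable R : realType.
Implicit Types (z tau : R[i]).

Lemma Im_halfM tau : complex.Im (tau / 2) = complex.Im tau / 2.
Proof. by rewrite mulrC -[2%:R]natC -fmorphV ImMr mulrC. Qed.

Lemma nome_half : nome (1 / 2 : R[i]) = - 1.
Proof.
have := cq_half R; rewrite /cq; set e := nome _ => E.
have e1 : 1 - e != 0.
  apply/eqP => h; move/eqP: E; rewrite h invr0 mulr0 eq_sym oppr_eq0.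
  by rewrite div1r invr_eq0 pnatr_eq0.
have : e = - (1 / 2) * (1 - e) by rewrite -E divfK.
move=> E2; have E3 : 2 * e = e - 1 by rewrite {1}E2; field.
by apply: (addrI e); rewrite -E3 mulr_natl mulr2n.
Qed.

(** For [i = 0] this is an identity of rational functions in [nome z]; each derivative in [z] brings
    another factor 2. *)
Lemma h_duplication i z : 0 < complex.Im z ->
  h i z + h i (z + 1 / 2) = 2 ^+ i.+1 * h i (2 * z).
Proof.
elim: i z => [|i IH] z z0.
  have h1 : nome z != 1 by apply: nome_neq1_Im; rewrite gt_eqF.
  have h2 : nome (z + 1 / 2) != 1.
    by apply: nome_neq1_Im; rewrite ImD Im_halfM /= mul0r addr0 gt_eqF.
  rewrite !h0E /cq nomeD nome_half -nomeX expr1.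
  rewrite nomeD nome_half in h2; set x := nome z in h1 h2 *.
  have p1 : 1 - x != 0 by rewrite subr_eq0 eq_sym.
  have p2 : 1 + x != 0.
    by apply: contra h2 => /eqP; rewrite addrC => /eqP; rewrite addr_eq0 => /eqP ->; rewrite mulrNN mulr1.
  have p3 : 1 - x ^+ 2 != 0.
    have -> : 1 - x ^+ 2 = (1 - x) * (1 + x) by ring.
    exact: mulf_neq0.
  field; rewrite p1 p3 /=.
  by rewrite mulrN1 opprK andbT.
have ne (u : R[i]) : 0 < complex.Im u -> nome u != 1.
  by move=> u0; apply: nome_neq1_Im; rewrite gt_eqF.
have i2 : complex.Im (2 * z + 0) = 2 * complex.Im z by rewrite addr0 Im_nat.
have d1 := cder_h i (ne z z0).
have ih : complex.Im (1 * z + 1 / 2) = complex.Im z.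
  by rewrite mul1r ImD Im_halfM /= mul0r addr0.
have d2 : cder (fun x => h i (x + 1 / 2)) z (tpi * h i.+1 (z + 1 / 2)).
  have z0' : 0 < complex.Im (1 * z + 1 / 2) by rewrite ih.
  have := cder_lin (cder_h i (ne _ z0')); rewrite !mul1r.
  by apply: cder_ext => x; rewrite mul1r.
have d3 : cder (fun x => h i (2 * x)) z (2 * (tpi * h i.+1 (2 * z))).
  have z0' : 0 < complex.Im (2 * z + 0) by rewrite i2 mulr_gt0.
  have := cder_lin (cder_h i (ne _ z0')); rewrite addr0.
  by apply: cder_ext => x; rewrite addr0.
have L := cderD d1 d2.
have L' : cder (fun x => 2 ^+ i.+1 * h i (2 * x)) z (tpi * h i.+1 z + tpi * h i.+1 (z + 1 / 2)).
  apply: (cder_local (d := complex.Im z / 2)) L => [|k hk]; first exact: divr_gt0.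
  apply: IH; have := le_trans (Im_le_cabs k) hk; rewrite ler_norml ImD => /andP[k1 _]; lra.
have E := cder_unique L' (cderZ (2 ^+ i.+1) d3).
apply: (mulfI (tpi_neq0 R)); rewrite mulrDr E [in RHS]exprS; ring.
Qed.

(* The points of order 2 avoid the pole of h i at 0, and by the duplication formula
   their sum is a multiple of T i 0 up to a constant. *)
Lemma sum_eis2 i tau : odd i -> 0 < complex.Im tau ->
  eis 2 i 0 1 tau + eis 2 i 1 0 tau + eis 2 i 1 1 tau =
  h i (1 / 2) + 2 * (2 ^+ i.+1 - 1) * T i 0 tau.
Proof.
move=> oi t0; have i0 : (i == 0%N) = false by case: i oi.
have sgn : (-1) ^+ i.+1 = 1 :> R[i] by rewrite -signr_odd /= oi.
have WE z : W i z tau = h i z + T i z tau + T i (- z) tau.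
  by rewrite /W i0 sgn mul0r addr0 mul1r.
have eisE (x y : int) : (x %% 2)%Z = x ->
    eis 2 i x y tau = W i (x%:~R / 2 * tau + y%:~R / 2) tau.
  by move=> xE; rewrite /eis i0 xE !mul0r subr0.
rewrite !eisE // !mulr0z !mulr1z !mul0r add0r addr0.
have E1 : W i (1 / 2) tau = h i (1 / 2) + 2 * T i (1 / 2) tau.
  rewrite WE -(T_Dint i (- (1 / 2)) tau 1).
  have -> : - (1 / 2) + 1%:~R = 1 / 2 :> R[i] by field.
  ring.
have imh (x : R[i]) : complex.Im (x + 1 / 2) = complex.Im x.
  by rewrite ImD Im_halfM /= mul0r addr0.
have p1 : 0 < complex.Im (- (tau / 2) + tau) by rewrite ImD ImN Im_halfM; lra.
have p2 : 0 < complex.Im (- (tau / 2) + 1 / 2 + tau).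
  by rewrite addrAC imh.
have p3 : 0 < complex.Im (1 / 2 + tau) by rewrite addrC imh.
have E2 : W i (1 / 2 * tau) tau = 2 * T i (- (tau / 2)) tau.
  rewrite WE; have -> : 1 / 2 * tau = tau / 2 by field.
  rewrite (T_shift i t0 p1); have -> : - (tau / 2) + tau = tau / 2 by field.
  ring.
have E3 : W i (1 / 2 * tau + 1 / 2) tau = 2 * T i (- (tau / 2) + 1 / 2) tau.
  rewrite WE; have -> : 1 / 2 * tau = tau / 2 by field.
  have -> : T i (- (tau / 2 + 1 / 2)) tau = T i (- (tau / 2) + 1 / 2) tau.
    have e0 : - (tau / 2 + 1 / 2) + 1%:~R = - (tau / 2) + 1 / 2 :> R[i] by field.
    by rewrite -(T_Dint i (- (tau / 2 + 1 / 2)) tau 1) e0.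
  rewrite (T_shift i t0 p2).
  have -> : - (tau / 2) + 1 / 2 + tau = tau / 2 + 1 / 2 by field.
  ring.
rewrite E1 E2 E3.
suff E : T i (1 / 2) tau + T i (- (tau / 2)) tau + T i (- (tau / 2) + 1 / 2) tau =
    (2 ^+ i.+1 - 1) * T i 0 tau.
  by rewrite -mulrA -E; ring.
have p0 : 0 < complex.Im (0 + tau) by rewrite add0r.
have c1 := ccvgD (ccvgD (T_cvg i t0 p3) (T_cvg i t0 p1)) (T_cvg i t0 p2).
have c2 := T_cvg i t0 p0.
have c3 := ccvg_comp (p := double) (fun m => leq_trans (leq_addr m m) (eq_leq (addnn m))) c2.
apply: (ccvg_unique c1).
have := ccvgB (ccvgZ (2 ^+ i.+1) c3) c2.
have -> : 2 ^+ i.+1 * T i 0 tau - T i 0 tau = (2 ^+ i.+1 - 1) * T i 0 tau by ring.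
apply: ccvg_ext; elim=> [|m IH]; first by rewrite !big_ord0; ring.
rewrite doubleS !big_ord_recr /=; move: IH.
set s1 := \sum_(i0 < m.*2) _; set s2 := \sum_(i0 < m) h i (0 + _).
set s3 := \sum_(i0 < m) _; set s4 := \sum_(i0 < m) _; set s5 := \sum_(i0 < m) _ => IH.
have m0 : 0 < complex.Im (m.+1%:R * tau) by rewrite Im_nat mulr_gt0 ?ltr0n.
have m1 : 0 < complex.Im (m.+1%:R * tau - tau / 2).
  have := Im_translate_ge m t0 (lexx (complex.Im (- (tau / 2) + tau))).
  by rewrite [_ - tau / 2]addrC => H; exact: lt_le_trans p1 H.
have D1 := h_duplication i m0; have D2 := h_duplication i m1.
(* Duplication sends the translate of [1 / 2] to the even index [2m + 2], and the translates of the
   other two points to the odd index [2m + 1]: together they fill the sum up to [2m + 2]. *)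
have X1 : h i (1 / 2 + m.+1%:R * tau) =
    2 ^+ i.+1 * h i (0 + m.*2.+2%:R * tau) - h i (0 + m.+1%:R * tau).
  rewrite !add0r [1 / 2 + _]addrC.
  have -> : m.*2.+2%:R * tau = 2 * (m.+1%:R * tau).
    by rewrite mulrA -natrM mul2n.
  by rewrite -D1; ring.
have X2 : h i (- (tau / 2) + m.+1%:R * tau) + h i (- (tau / 2) + 1 / 2 + m.+1%:R * tau) =
    2 ^+ i.+1 * h i (0 + m.*2.+1%:R * tau).
  rewrite add0r.
  have -> : m.*2.+1%:R * tau = 2 * (m.+1%:R * tau - tau / 2).
    by rewrite -[m.*2.+1%:R]natr1 -mul2n natrM -[m.+1%:R]natr1; field.
  by rewrite -D2 [- (tau / 2) + 1 / 2 + _]addrAC [- (tau / 2) + _]addrC.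
set A := h i (1 / 2 + _) in X1 *; set B := h i (- (tau / 2) + _) in X2 *.
set C := h i (- (tau / 2) + 1 / 2 + _) in X2 *.
have -> : s3 + A + (s4 + B) + (s5 + C) = (s3 + s4 + s5) + A + (B + C) by ring.
by rewrite X1 X2 -IH; ring.
Qed.

(* SL2(Z) permutes the three nonzero row vectors mod 2. *)
Lemma sum_rows_mod2 (V : comNzRingType) (g : int -> int -> V) (a b c d : int) :
  (forall x y x' y', (x = x' %[mod 2])%Z -> (y = y' %[mod 2])%Z -> g x y = g x' y') ->
  SL2Z a b c d ->
  g 0 1 + g 1 0 + g 1 1 = g c d + g a b + g (a + c) (b + d).
Proof.
move=> E det.
have par (x : int) : (x = 0 %[mod 2])%Z \/ (x = 1 %[mod 2])%Z.
  have := modz_ge0 x (erefl : 2 != 0 :> int).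
  have := ltz_pmod x (erefl : 0 < 2 :> int).
  have -> : (0 %% 2)%Z = 0 by [].
  have -> : (1 %% 2)%Z = 1 by [].
  lia.
have D x y x' y' : (x = x' %[mod 2])%Z -> (y = y' %[mod 2])%Z ->
    (x + y = x' + y' %[mod 2])%Z.
  by move=> hx hy; rewrite -modzDml hx modzDml -modzDmr hy modzDmr.
have M x y x' y' : (x = x' %[mod 2])%Z -> (y = y' %[mod 2])%Z ->
    (x * y = x' * y' %[mod 2])%Z.
  by move=> hx hy; rewrite -modzMml hx modzMml -modzMmr hy modzMmr.
have dmod a' b' c' d' : (a = a' %[mod 2])%Z -> (b = b' %[mod 2])%Z ->
    (c = c' %[mod 2])%Z -> (d = d' %[mod 2])%Z ->
    ((a' * d' + b' * c') %% 2)%Z == 1.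
  move=> ha hb hc hd.
  rewrite -(D _ _ _ _ (M _ _ _ _ ha hd) (M _ _ _ _ hb hc)).
  have -> : a * d + b * c = 1 + b * c * 2 by move: det; rewrite /SL2Z; lia.
  by rewrite addrC modzMDl.
have n11 : g 1 (1 + 1) = g 1 0 by exact: E.
have m11 : g (1 + 1) 1 = g 0 1 by exact: E.
(* Of the sixteen parity patterns [dmod] leaves the six matrices that are invertible mod 2. *)
case: (par a) => ha; case: (par b) => hb; case: (par c) => hc; case: (par d) => hd;
  have := dmod _ _ _ _ ha hb hc hd;
  rewrite ?(mul0r, mulr0, mul1r, add0r, addr0) //;
  rewrite (E _ _ _ _ ha hb) (E _ _ _ _ hc hd);
  rewrite (E _ _ _ _ (D _ _ _ _ ha hc) (D _ _ _ _ hb hd));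
  rewrite ?add0r ?addr0 ?n11 ?m11 => _; ring.
Qed.

Lemma quasimodular_sum_eis2 i : odd i ->
  quasimodular i.+1 1 (principal R 1)
    (fun tau => eis 2 i 0 1 tau + eis 2 i 1 0 tau + eis 2 i 1 1 tau).
Proof.
move=> oi; have N0 : (0 < 2)%N by [].
have p1 : primitive_row 2 0 1 by [].
have p2 : primitive_row 2 1 0 by [].
have p3 : primitive_row 2 1 1 by [].
set f := fun tau => _.
(* For the rows [(1, 0)] and [(1, 1)] the torsion point moves with [tau]; [sum_eis2] reduces the sum
   to a series at the fixed point 0. *)
have hf : holomorphic_uhp f.
  apply: holomorphic_cder => tau t0.
  have [l hl] := cder_T_tau i t0 (erefl : complex.Im (0 : R[i]) = 0).
  exists (0 + 2 * (2 ^+ i.+1 - 1) * l).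
  apply: (cder_local (d := complex.Im tau / 2)); last first.
  - exact: cderD (cder_cst (h i (1 / 2)) tau) (cderZ (2 * (2 ^+ i.+1 - 1)) hl).
  - move=> k kd; rewrite /f sum_eis2 // ImD.
    have := le_trans (Im_le_cabs k) kd; rewrite ler_norml => /andP[k1 _].
    by rewrite /in_uhp in t0; lra.
  - exact: divr_gt0.
split=> //.
(* The factor 3: each of the three rows contributes one weight 2 correction. *)
- exists 1%N, (fun j tau => if j == 0%N :> nat then f tau else - ((i == 1%N)%:R / tpi) * 3).
  split.
    by move=> j; case: (val j == 0%N); last exact: holomorphic_cst.
  move=> a b c d [det _] tau t0; have J0 := SL2Z_row_neq0 det t0.
  rewrite /principal coprimezE coprimen1 !big_ord_recl big_ord0 /= expr0 expr1 addr0 !mulr1.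
  rewrite mul1r {1}/f !(row_law_SL2Z i N0 det t0) //; set J := cocycle c d tau in J0 *.
  have -> : f tau = eis 2 i (0 * a + 1 * c) (0 * b + 1 * d) tau
     + eis 2 i (1 * a + 0 * c) (1 * b + 0 * d) tau
     + eis 2 i (1 * a + 1 * c) (1 * b + 1 * d) tau.
    rewrite !mul0r !mul1r !add0r !addr0 /f.
    apply: (sum_rows_mod2 (g := fun x y => eis 2 i x y tau) _ det).
    by move=> x y x' y' hx hy; exact: (eis_per i N0 tau hx hy).
  case: (i =P 1%N) => [->|_]; first by rewrite /=; field; rewrite ?J0 ?tpi_neq0.
  by rewrite !mul0r oppr0 ?mul0r !addr0; ring.
- move=> a b c d det.
  have H := boundedD (boundedD (eis_cusp R i N0 p1 det) (eis_cusp R i N0 p2 det))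
    (eis_cusp R i N0 p3 det).
  apply: bounded_uhp _ H => tau _; rewrite /f.
  move: (_ ^- _) (eis _ _ _ _ _) (eis _ _ _ _ _) (eis _ _ _ _ _) => u A B C.
  by rewrite !mulrDr.
Qed.

Lemma T0_mixed i : odd i -> mixed 1 i.+1 (T i (0 : R[i])).
Proof.
move=> oi; have P : 2 ^+ i.+1 - 1 != 0 :> R[i].
  rewrite subr_eq0 -natrX -[1]/(1%:R) eqr_nat.
  by rewrite -[X in _ != X](expn0 2) eqn_exp2l.
have H := mixedZ (2 * (2 ^+ i.+1 - 1))^-1 (mixedD
  (Mixed_qm (leqnn i.+1) (principal_character R 1) (quasimodular_sum_eis2 oi) (fun tau _ => erefl))
  (mixed_cst 1 i.+1 (- h i (1 / 2 : R[i])))).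
apply: mixed_ext H => tau t0.
have p0 : 2 * (2 ^+ i.+1 - 1) != 0 :> R[i] by rewrite mulf_neq0 // pnatr_eq0.
apply: (mulfI p0); rewrite (mulVKf p0).
apply: etrans (congr1 (fun x => x - h i (1 / 2)) (esym (sum_eis2 oi t0))).
by rewrite addrAC subrr add0r.
Qed.

End LevelOne.

(** * Partial fractions of U_term *)

Section PartialFractions.
Variable F : fieldType.
Implicit Types (P : {poly F}) (s : seq F).

(** Both families multiply to ['X^n - 1] over the divisors of [n]; strong induction cancels the
    proper divisors. *)
Lemma map_Cyclotomic n (z : F) : n.-primitive_root z ->
  map_poly intr 'Phi_n = cyclotomic z n.
Proof.
elim/ltn_ind: n z => n IH z zn; have n0 := prim_order_gt0 zn.
have nd : n \in divisors n by rewrite -dvdn_divisors.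
have E1 := congr1 (map_poly (intr : int -> F)) (prod_Cyclotomic n0).
have E2 := prod_cyclotomic zn.
rewrite rmorph_prod rmorphB rmorphXn rmorph1 /= map_polyX (big_rem n nd) /= in E1.
rewrite (big_rem n nd) /= divnn n0 expr1 in E2.
have E3 : \prod_(d <- rem n (divisors n)) map_poly (intr : int -> F) 'Phi_d =
    \prod_(d <- rem n (divisors n)) cyclotomic (z ^+ (n %/ d)) d.
  apply: eq_big_seq => d; rewrite mem_rem_uniq ?divisors_uniq // inE -dvdn_divisors //.
  move=> /andP[dn dvd]; apply: IH; first by rewrite ltn_neqAle dn dvdn_leq.
  exact: dvdn_prim_root.
rewrite E3 in E1; move: E1; rewrite E2; apply: mulIf.
apply: contraTneq (monic_neq0 (monicXnsubC (1 : F) n0)) => h.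
by rewrite E2 h mulr0 eqxx.
Qed.

(** [s] lists the poles with multiplicity. For a pole [a], [T] collects the other factors and [al]
    is chosen so that [P - al *: T] vanishes at [a]. Subtracting [al *: T] thus splits off the term
    of highest order at [a] and lowers the multiplicity by one. *)
Lemma partial_fraction (u s : seq F) (K : nat) P : uniq u -> {subset s <= u} ->
  (forall a, (count_mem a s <= K)%N) -> (size P <= size s)%N ->
  exists c : F -> nat -> F, forall x, x \notin s ->
    P.[x] / \prod_(a <- s) (x - a) = \sum_(a <- u) \sum_(j < K) c a j / (x - a) ^+ j.+1.
Proof.
move=> uu; elim: s P => [|a s IH] P su cs sP.
  exists (fun _ _ => 0) => x _; move: sP; rewrite leqn0 size_poly_eq0 => /eqP ->.
  by rewrite horner0 mul0r big1 // => b _; rewrite big1 // => j _; rewrite mul0r.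
pose T := \prod_(b <- s | b != a) ('X - b%:P); set m := count_mem a s.
have prodE x : \prod_(b <- s) (x - b) = (x - a) ^+ m * T.[x].
  rewrite (bigID (pred1 a)) /= horner_prod; congr (_ * _).
    rewrite (eq_bigr (fun=> x - a)) => [|b /eqP -> //]; rewrite big_const_seq.
    by rewrite -/m; elim: m => [|m' IHm]; rewrite ?expr0 //= IHm exprS.
  by apply: eq_bigr => b _; rewrite hornerXsubC.
have Ta : T.[a] != 0.
  rewrite horner_prod prodf_seq_neq0; apply/allP => b _; apply/implyP => ba.
  by rewrite hornerXsubC subr_eq0 eq_sym.
have sT : (size T <= (size s).+1)%N.
  have -> : T = \prod_(b <- [seq b <- s | b != a]) ('X - b%:P) by rewrite big_filter.
  by rewrite size_prod_XsubC ltnS size_filter count_size.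
set al := P.[a] / T.[a].
have /factor_theorem[P' PE] : root (P - al *: T) a.
  by rewrite rootE hornerD hornerN hornerZ divfK // subrr.
have sP' : (size P' <= size s)%N.
  have [->|P'0] := eqVneq P' 0; first by rewrite size_poly0.
  have : (size (P - al *: T)%R <= (size s).+1)%N.
    rewrite (leq_trans (size_polyD _ _)) // geq_max sP /= size_polyN.
    exact: leq_trans (size_scale_leq _ _) sT.
  by rewrite PE size_Mmonic ?monicXsubC // size_XsubC addn2.
have ms : (m < K)%N by have := cs a; rewrite /= eqxx.
have [] := IH P' _ _ sP'.
- by move=> b bs; apply: su; rewrite inE bs orbT.
- by move=> b; apply: leq_trans (cs b); rewrite /= leq_addl.
move=> c cE; exists (fun b j => c b j + (if (b == a) && (j == m) then al else 0)) => x.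
rewrite inE negb_or => /andP[xa xs].
have xa0 : x - a != 0 by rewrite subr_eq0.
have S0 : \prod_(b <- s) (x - b) != 0.
  rewrite prodf_seq_neq0; apply/allP => b bs; rewrite subr_eq0.
  by apply: contraNneq xs => ->.
under [RHS]eq_bigr do (under eq_bigr do rewrite mulrDl; rewrite big_split /=).
rewrite big_split /= -cE //; set S := (X in _ = _ + X).
have {S}-> : S = al / (x - a) ^+ m.+1.
  rewrite /S (bigD1_seq a) ?su ?mem_head //= (bigD1 (Ordinal ms)) //= !eqxx /=.
  rewrite [X in _ + X + _]big1 ?addr0 => [|j jm]; last first.
    by rewrite -val_eqE /= in jm; rewrite (negPf jm) mul0r.
  by rewrite big1 ?addr0 // => b ba; rewrite big1 // => j _; rewrite (negPf ba) mul0r.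
have -> : P.[x] = al * T.[x] + P'.[x] * (x - a).
  rewrite -[x - a](hornerXsubC a x) -hornerM -PE hornerD hornerN hornerZ.
  by rewrite addrC subrK.
rewrite big_cons; move: S0; rewrite prodE; set w := (x - a) in xa0 *.
rewrite mulf_eq0 negb_or => /andP[_ T0].
rewrite exprS; have := expf_neq0 m xa0; set y := w ^+ m => y0.
by rewrite addrC; field; rewrite xa0 T0 y0.
Qed.

Lemma partial_fraction_pow (s : seq F) k P : uniq s -> (size P <= size s * k)%N ->
  exists c : F -> nat -> F, forall x, x \notin s ->
    P.[x] / (\prod_(a <- s) (x - a)) ^+ k = \sum_(a <- s) \sum_(j < k) c a j / (x - a) ^+ j.+1.
Proof.
move=> us sP; set s' := flatten (nseq k s).
have mem' a : a \in s' -> a \in s.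
  by rewrite /s'; elim: (k) => //= k' IHk; rewrite mem_cat => /orP[].
have prod' x : \prod_(a <- s') (x - a) = (\prod_(a <- s) (x - a)) ^+ k.
  rewrite /s'; elim: (k) => [|k' IHk]; first by rewrite big_nil expr0.
  by rewrite /= big_cat IHk exprS.
have size' : size s' = (size s * k)%N.
  by rewrite /s'; elim: (k) => [|k' IHk]; rewrite ?muln0 //= size_cat IHk mulnS.
have count' a : (count_mem a s' <= k)%N.
  rewrite /s'; elim: (k) => //= k' IHk; rewrite count_cat count_uniq_mem //.
  by rewrite -add1n leq_add // leq_b1.
have [|c cE] := partial_fraction us mem' count' (P := P); first by rewrite size'.
by exists c => x xs; rewrite -prod' cE //; apply: contra xs; exact: mem'.
Qed.

End PartialFractions.

(** * The summand in terms of the functions h_i *)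

Section TermExpansion.
Variable R : realType.
Implicit Types (z tau x : R[i]) (p Q : {poly R[i]}).

Lemma size_eulerP i : (size (eulerP R i) <= i.+2)%N /\ (eulerP R i)`_i.+1 = i`!%:R.
Proof.
elim: i => [|i [IH1 IH2]]; first by rewrite /= size_polyX coefX.
split.
  have sX : (size ('X + 'X^2 : {poly R[i]})%R <= 3)%N.
    by rewrite (leq_trans (size_polyD _ _)) // size_polyX size_polyXn.
  have sd : (size (eulerP R i)^`() <= i.+1)%N.
    by apply/leq_sizeP => j ij; rewrite coef_deriv nth_default ?mul0rn // (leq_trans IH1).
  rewrite /= (leq_trans (size_polyMleq _ _)) // -subn1 leq_subLR.
  exact: leq_trans (leq_add sX sd) _.
rewrite /= mulrDl coefD coefXM coefXnM !coef_deriv subn2 /=.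
by rewrite (nth_default _ IH1) mul0rn add0r IH2 factS natrM mulr_natl.
Qed.

(** [eulerP R i] has degree [i + 1] and leading coefficient [i!], invertible in characteristic 0, so
    the leading terms can be removed one by one. *)
Lemma eulerP_span k p : (size p <= k.+1)%N ->
  exists e : nat -> R[i], p = p.[0]%:P + \sum_(i < k) e i *: eulerP R i.
Proof.
elim: k p => [|k IH] p sp.
  exists (fun=> 0); rewrite big_ord0 addr0; have := size1_polyC sp => pE.
  by rewrite {2}pE hornerC -pE.
have [sE lE] := size_eulerP k.
set a := p`_k.+1 / k`!%:R.
have f0 : k`!%:R != 0 :> R[i] by rewrite pnatr_eq0 -lt0n fact_gt0.
have [|e eE] := IH (p - a *: eulerP R k).
  apply/leq_sizeP => j kj; rewrite coefB coefZ; case: (ltnP k.+1 j) => jk.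
    by rewrite !nth_default ?mulr0 ?subr0 // (leq_trans _ jk).
  have -> : j = k.+1 by lia.
  by rewrite lE divfK // subrr.
exists (fun i => if i == k then a else e i).
rewrite big_ord_recr /= eqxx addrA; apply/eqP; rewrite -subr_eq; apply/eqP.
rewrite {1}eE hornerD hornerN hornerZ eulerP_root0 mulr0 subr0; congr (_ + _).
by apply: eq_bigr => i _; rewrite ltn_eqF.
Qed.

Lemma eulerP_horner_N1 i : (eulerP R i).[-1] = - (i == 0%N)%:R.
Proof.
case: i => [|i] /=; first by rewrite hornerX.
by rewrite hornerM hornerD hornerXn hornerX sqrrN expr1n addrC subrr mul0r oppr0.
Qed.

Variables (k N : nat) (Q : {poly R[i]}).
Hypotheses (N0 : (0 < N)%N) (sQ : (size Q <= totient N * k)%N) (Q0 : Q.[0] = 0).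
Hypothesis fQ : forall x : R[i], x != 0 ->
  Q.[x] = if N == 1%N then (- x) ^+ k * Q.[x^-1] else x ^+ (totient N * k) * Q.[x^-1].

Local Notation zeta := (nome (N%:R^-1 : R[i])).
Let zetaP : N.-primitive_root zeta := nome_primitive R N0.

Let PhiE (z : R[i]) x : N.-primitive_root z ->
  (map_poly intr 'Phi_N).[x] = \prod_(b < N | coprime b N) (x - z ^+ b).
Proof.
move=> zP; rewrite (map_Cyclotomic zP) horner_prod.
by apply: eq_bigr => b _; rewrite hornerXsubC.
Qed.

Let card_coprime : #|[pred b : 'I_N | coprime b N]| = totient N.
Proof.
rewrite totient_count_coprime -big_mkcond big_mkord -sum1_card.
by apply: eq_bigl => b; rewrite coprime_sym.
Qed.

(** Inversion permutes the primitive roots, which gives the relation up to a constant [kap];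
    evaluation at 1, not a root since [N > 1], shows [kap = 1]. *)
Lemma Cyclotomic_reciprocal x : x != 0 -> (1 < N)%N ->
  (map_poly intr 'Phi_N).[x] = x ^+ totient N * (map_poly intr 'Phi_N).[x^-1].
Proof.
move=> x0 N1.
have zVP : N.-primitive_root zeta^-1.
  have -> : zeta^-1 = zeta ^+ N.-1.
    apply: (mulfI (nome_neq0 N%:R^-1)); rewrite divff ?nome_neq0 // -exprS prednK //.
    by rewrite (prim_expr_order zetaP).
  by rewrite (prim_root_exp_coprime _ zetaP) coprimePn.
pose kap : R[i] := \prod_(b < N | coprime b N) (- zeta ^+ b).
have H y : y != 0 -> y ^+ totient N * (map_poly intr 'Phi_N).[y^-1] =
    kap * (map_poly intr 'Phi_N).[y].
  move=> y0.
  have -> : y ^+ totient N = \prod_(b < N | coprime b N) y.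
    by rewrite prodr_const card_coprime.
  rewrite (PhiE _ zetaP) (PhiE _ zVP) -!big_split /=; apply: eq_bigr => b _.
  have := expf_neq0 b (nome_neq0 (N%:R^-1 : R[i])); rewrite exprVn; set w := _ ^+ b => w0.
  by field; rewrite y0 w0.
have k1 : kap = 1.
  have := H 1 (oner_neq0 _); rewrite invr1 expr1n mul1r => /esym/eqP.
  rewrite -subr_eq0 -{2}[_.[1]]mul1r -mulrBl mulf_eq0 => /orP[/eqP/subr0_eq //|].
  rewrite (PhiE _ zetaP) => /prodf_eq0[b cb]; rewrite subr_eq0 eq_sym => /eqP h.
  have : (N %| b)%N by rewrite (prim_order_dvd zetaP) h.
  move=> Nb; move: cb; rewrite /coprime (gcdn_idPr Nb) => /eqP e.
  by move: N1; rewrite e.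
by rewrite H // k1 mul1r.
Qed.

Lemma U_term_inv x : x != 0 -> U_term k N Q x^-1 = U_term k N Q x.
Proof.
move=> x0; rewrite /U_term (fQ x0); case: eqP => [e|/eqP e].
  have PE y : (map_poly (intr : int -> R[i]) 'Phi_N).[y] = y - 1.
    rewrite (PhiE _ zetaP) e (bigD1 (Ordinal (ltn0Sn 0))) //= expr0 big1 ?mulr1 // => i.
    by rewrite ord1.
  (* At the pole [x = 1] both sides are 0 by the convention for division by zero if [k > 0], and for
     [k = 0] there is no denominator. *)
  rewrite !PE; have [->|x1] := eqVneq x 1.
    by rewrite invr1 subrr; case: (k) => [|k']; rewrite ?expr0 ?mul1r // expr0n invr0 !mulr0.
  have xx : x - 1 != 0 by rewrite subr_eq0.
  have -> : x^-1 - 1 = (x - 1) / (- x) by field.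
  by rewrite expr_div_n; field; rewrite ?expf_neq0 ?oppr_eq0 // xx.
have N1 : (1 < N)%N by case: (N) N0 e => [|[]].
rewrite (Cyclotomic_reciprocal x0 N1) exprMn exprM; set w := x ^+ _.
have w0 : w ^+ k != 0 by rewrite !expf_neq0.
by rewrite invfM mulrACA divff // mul1r.
Qed.

Lemma U_term_expansion : exists e : 'I_N -> nat -> R[i],
  (forall (b : 'I_N) i, ~~ coprime b N -> e b i = 0) /\
  forall z, 0 < complex.Im z -> 2 * U_term k N Q (nome z) =
    \sum_(b < N) \sum_(i < k) e b i *
      (h i (z - b%:R / N%:R) + (-1) ^+ i.+1 * h i (z + b%:R / N%:R)).
Proof.
pose rts := [seq zeta ^+ b | b : 'I_N <- enum [pred b : 'I_N | coprime b N]].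
have urts : uniq rts.
  rewrite map_inj_in_uniq ?enum_uniq // => b c _ _ /eqP.
  by rewrite (eq_prim_root_expr zetaP) !modn_small // => /eqP/val_inj.
have srts : size rts = totient N by rewrite size_map -cardE card_coprime.
have [|c cE] := partial_fraction_pow (k := k) (P := Q) urts; first by rewrite srts.
have UE x : x \notin rts -> U_term k N Q x =
    \sum_(b < N | coprime b N) \sum_(j < k) c (zeta ^+ b) j / (x - zeta ^+ b) ^+ j.+1.
  move=> xr; have -> : U_term k N Q x = Q.[x] / (\prod_(a <- rts) (x - a)) ^+ k.
    by rewrite /U_term (PhiE _ zetaP) big_map big_enum.
  by rewrite cE // big_map big_enum.
have w0 (b : 'I_N) : zeta ^+ b != 0 by rewrite expf_neq0 ?nome_neq0.
(* With [w = zeta ^+ b], the function [1 + cq] at the shifted point is [1 / (1 - x / w)], so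
   [1 / (x - w)] is [- w^-1] times it. *)
pose D (b : 'I_N) j := c (zeta ^+ b) j * (- (zeta ^+ b)^-1) ^+ j.+1.
pose p (b : 'I_N) := if coprime b N then \sum_(j < k) D b j *: (1 + 'X) ^+ j.+1 else 0.
have pE (b : 'I_N) y : coprime b N -> (p b).[y] = \sum_(j < k) D b j * (1 + y) ^+ j.+1.
  move=> cb; rewrite /p cb horner_sum; apply: eq_bigr => j _.
  by rewrite hornerZ horner_exp hornerD hornerX hornerC.
(* p_0 and e_0 are the values of the partial fractions at x = 0 and at x = oo, where
   cq is 0 and -1 respectively. *)
have p_0 : \sum_b (p b).[0] = 0.
  have r0 : 0 \notin rts by apply/mapP => -[b _ /eqP]; rewrite eq_sym (negPf (w0 b)).
  have := UE 0 r0; rewrite /U_term Q0 mul0r => U0; rewrite [RHS]U0 [RHS]big_mkcond /=.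
  apply: eq_bigr => b _; case: ifP => cb; last by rewrite /p cb horner0.
  rewrite pE //; apply: eq_bigr => j _.
  by rewrite addr0 expr1n mulr1 /D sub0r -invrN exprVn.
have Imb (b : 'I_N) : complex.Im (b%:R / N%:R : R[i]) = 0.
  by rewrite -!natC -fmorphV -rmorphM Im_real.
have pz z : complex.Im z != 0 ->
    U_term k N Q (nome z) = \sum_b (p b).[cq (z - b%:R / N%:R)].
  move=> z0; have zb (b : 'I_N) : nome (z - b%:R / N%:R) = nome z / zeta ^+ b.
    by rewrite nomeB nomeX.
  have zb1 (b : 'I_N) : nome z / zeta ^+ b != 1.
    by rewrite -zb; apply: nome_neq1_Im; rewrite ImB Imb subr0.
  rewrite UE; last first.
    by apply/mapP => -[b _ h]; have := zb1 b; rewrite h divff ?eqxx.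
  rewrite big_mkcond /=; apply: eq_bigr => b _; case: ifP => cb; last by rewrite /p cb horner0.
  rewrite pE //; apply: eq_bigr => j _; rewrite /D -mulrA -exprMn -exprVn; congr (_ * _ ^+ _).
  rewrite /cq zb; have := zb1 b; have := w0 b; set w := zeta ^+ b; set x := nome z => h0 h1.
  have x0 : x - w != 0 by apply: contra h1; rewrite subr_eq0 => /eqP ->; rewrite divff.
  have x1 : 1 - x / w != 0 by rewrite subr_eq0 eq_sym.
  have x2 : w - x != 0 by rewrite -opprB oppr_eq0.
  by field; rewrite x0 x2 h0.
have /choice[e eE] : forall b : 'I_N, exists e : nat -> R[i], (~~ coprime b N -> forall i, e i = 0) /\
    p b = (p b).[0]%:P + \sum_(i < k) e i *: eulerP R i.
  move=> b; have [cb|cb] := boolP (coprime b N); last first.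
    exists (fun=> 0); split=> //; rewrite /p (negPf cb) horner0 add0r big1 // => i _.
    by rewrite scale0r.
  have [|e eE] := @eulerP_span k (p b); last by exists e.
  rewrite /p cb; apply: (leq_trans (size_sum _ _ _)); apply/bigmax_leqP => j _.
  apply: leq_trans (size_scale_leq _ _) _.
  have -> : 1 + 'X = 'X - (-1)%:P :> {poly R[i]} by rewrite polyCN opprK addrC.
  by rewrite size_exp_XsubC ltnS.
have e_0 : \sum_b \sum_(i < k) e b i * (i == 0%N :> nat)%:R = 0.
  rewrite -[RHS]p_0; apply: eq_bigr => b _.
  have : (p b).[-1] = 0.
    have [cb|cb] := boolP (coprime b N); last by rewrite /p (negPf cb) horner0.
    by rewrite pE // big1 // => j _; rewrite subrr expr0n mulr0.
  have [_ {1}->] := eE b; rewrite hornerD hornerC horner_sum => /eqP.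
  rewrite addr_eq0 => /eqP ->; rewrite -sumrN; apply: eq_bigr => i _.
  by rewrite hornerZ eulerP_horner_N1 mulrN opprK.
have Uh z : complex.Im z != 0 -> U_term k N Q (nome z) =
    \sum_b \sum_(i < k) e b i * h i (z - b%:R / N%:R).
  move=> z0; rewrite pz //.
  transitivity (\sum_b ((p b).[cq (z - b%:R / N%:R)] - (p b).[0])).
    by rewrite sumrB p_0 subr0.
  apply: eq_bigr => b _.
  have [_ {1}->] := eE b; rewrite hornerD hornerC horner_sum addrC addrA addNr add0r.
  by apply: eq_bigr => i _; rewrite hornerZ.
exists e; split=> [b i cb|z z0]; first by have [H _] := eE b; exact: H.
have z0' : complex.Im z != 0 by rewrite gt_eqF.
rewrite mulr_natl mulr2n -{2}(U_term_inv (nome_neq0 z)) -nomeN !Uh ?ImN ?oppr_eq0 //.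
(* The constants that [hN] produces for [i = 0] add up to the sum in [e_0], hence vanish. *)
have -> : \sum_b \sum_(i < k) e b i * h i (- z - b%:R / N%:R) =
    \sum_b \sum_(i < k) e b i * ((-1) ^+ i.+1 * h i (z + b%:R / N%:R)).
  rewrite -[RHS]subr0 -[X in _ - X]e_0 -sumrB; apply: eq_bigr => b _.
  rewrite -sumrB; apply: eq_bigr => i _.
  have -> : - z - b%:R / N%:R = - (z + b%:R / N%:R) by rewrite opprD.
  rewrite hN; first by ring.
  by apply: nome_neq1_Im; rewrite ImD Imb addr0.
rewrite -big_split /=; apply: eq_bigr => b _; rewrite -big_split /=.
by apply: eq_bigr => i _; rewrite mulrDr.
Qed.

End TermExpansion.

(** * The single sums as combinations of Eisenstein series *)

Section EisensteinExpansion.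
Variable R : realType.
Implicit Types (z tau x : R[i]) (Q : {poly R[i]}).

Lemma T_combination_mixed N k (e : 'I_N -> nat -> R[i]) : (0 < N)%N ->
  (forall (b : 'I_N) i, ~~ coprime b N -> e b i = 0) ->
  mixed N k (fun tau => \sum_(b < N) \sum_(i < k) e b i *
    (T i (- (b%:R / N%:R)) tau + (-1) ^+ i.+1 * T i (b%:R / N%:R) tau)).
Proof.
case: N e => [|[|n]] // e _ e0.
  (* In level one the only torsion point is 0, its own opposite, and the sign cancels all even
     [i]. *)
  apply: mixed_ext (fun tau _ => big_ord1 _ _) _; apply: mixed_sum => i _; apply: mixedZ.
  have E tau : T i (- ((0%N)%:R / 1%:R)) tau + (-1) ^+ i.+1 * T i ((0%N)%:R / 1%:R) tau =
      (1 + (-1) ^+ i.+1) * T i 0 tau.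
    by rewrite !mul0r oppr0 mulrDl mul1r.
  apply: mixed_ext (fun tau _ => E tau) _; have [oi|oi] := boolP (odd i).
    exact: mixedZ (mixed_leq (ltn_ord i) (T0_mixed R oi)).
  apply: mixed_ext (mixed_cst 1 k 0) => tau _.
  by rewrite -signr_odd /= oi expr1 subrr mul0r.
set N := n.+2 in e e0 *.
apply: mixed_ext (fun tau _ => exchange_big _ _ _ _ _ _) _; apply: mixed_sum => i _.
(* Multiplication by the sign, whose square is 1, moves it to the series at the opposite point, as
   in [W]. The summands of [W] that are constant in [tau] are subtracted as a constant form. *)
pose c b := e b i * (-1) ^+ i.+1.
have c0 (b : 'I_N) : ~~ coprime b N -> c b = 0 by move=> cb; rewrite /c e0 ?mul0r.
have H := mixedD (mixed_leq (ltn_ord i) (eis_combination_mixed i c0)) (mixed_cst N k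
  (- \sum_(b < N) c b * (h i (b%:R / N%:R) + (i == 0%N :> nat)%:R / 2))).
apply: mixed_ext H => tau _; rewrite -sumrB; apply: eq_bigr => b _.
have sgn : (-1) ^+ i.+1 * (-1) ^+ i.+1 = 1 :> R[i] by rewrite -exprMn mulrNN mulr1 expr1n.
rewrite /eis mod0z !mulr0z !mul0r mulr0 mul0r subr0 add0r /W -pmulrn /c.
move: sgn; set s := (-1) ^+ _; set u := _ / N%:R; set A := T i (- u) tau; set B := T i u tau.
move=> ss; transitivity (e b i * (s * s * A + s * B)); first by rewrite ss mul1r.
by ring.
Qed.

Variables (k N : nat) (Q : {poly R[i]}).
Hypotheses (N0 : (0 < N)%N) (sQ : (size Q <= totient N * k)%N) (Q0 : Q.[0] = 0).
Hypothesis fQ : forall x : R[i], x != 0 ->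
  Q.[x] = if N == 1%N then (- x) ^+ k * Q.[x^-1] else x ^+ (totient N * k) * Q.[x^-1].

Lemma U_term_series_mixed : exists2 F : R[i] -> R[i],
  forall tau, in_uhp tau ->
    ccvg (fun m => \sum_(n < m) U_term k N Q (nome tau ^+ n.+1)) (F tau) &
  mixed N k F.
Proof.
have [e [e0 eE]] := U_term_expansion N0 sQ Q0 fQ.
pose G tau := \sum_(b < N) \sum_(i < k) e b i *
    (T i (- (b%:R / N%:R)) tau + (-1) ^+ i.+1 * T i (b%:R / N%:R) tau).
exists (fun tau => 2^-1 * G tau); last exact: mixedZ (T_combination_mixed k N0 e0).
move=> tau t0; have Imb (b : 'I_N) : complex.Im (b%:R / N%:R : R[i]) = 0.
  by rewrite -!natC -fmorphV -rmorphM Im_real.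
have c1 b i : ccvg (fun m => \sum_(n < m) e b i *
      (h i (- (b%:R / N%:R) + n.+1%:R * tau) + (-1) ^+ i.+1 * h i (b%:R / N%:R + n.+1%:R * tau)))
    (e b i * (T i (- (b%:R / N%:R)) tau + (-1) ^+ i.+1 * T i (b%:R / N%:R) tau)).
  have p1 : 0 < complex.Im (- (b%:R / N%:R) + tau) by rewrite ImD ImN Imb oppr0 add0r.
  have p2 : 0 < complex.Im (b%:R / N%:R + tau) by rewrite ImD Imb add0r.
  have := ccvgZ (e b i) (ccvgD (T_cvg i t0 p1) (ccvgZ ((-1) ^+ i.+1) (T_cvg i t0 p2))).
  by apply: ccvg_ext => m; rewrite -mulr_sumr big_split mulr_sumr.
have c2 b := ccvg_sum (index_enum 'I_k) (P := xpredT) (fun i _ => c1 b i).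
have c3 := ccvg_sum (index_enum 'I_N) (P := xpredT) (fun b _ => c2 b).
apply: ccvg_ext (ccvgZ 2^-1 c3) => m.
under eq_bigr do rewrite exchange_big /=.
rewrite exchange_big mulr_sumr; apply: eq_bigr => n _ /=.
have z0 : 0 < complex.Im (n.+1%:R * tau) by rewrite Im_nat mulr_gt0 // ltr0n.
rewrite nomeX; apply: (mulfI (_ : 2 != 0 :> R[i])); first by rewrite pnatr_eq0.
rewrite eE // mulVKf ?pnatr_eq0 //; apply: eq_bigr => b _; apply: eq_bigr => i _.
by rewrite [- _ + _]addrC [_ / _ + _]addrC.
Qed.

End EisensteinExpansion.

(** * Newton's identities and isobaric polynomials *)

Section SymmetricSums.
Variable A : comNzRingType.
Implicit Types (s : seq A) (x : nat -> A).

Fixpoint esym s (t : nat) : A :=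
  match s with
  | [::] => (t == 0%N)%:R
  | y :: s' => if t is t'.+1 then y * esym s' t' + esym s' t else 1
  end.

(** The inner [fix] lowers [t] while [y] stays available, which is what permits repetitions. *)
Fixpoint hsym s : nat -> A :=
  match s with
  | [::] => fun t => (t == 0%N)%:R
  | y :: s' => fix f t := if t is t'.+1 then y * f t' + hsym s' t else 1
  end.

Definition psym s (i : nat) : A := \sum_(y <- s) y ^+ i.

Lemma esym0 s : esym s 0 = 1. Proof. by case: s. Qed.
Lemma hsym0 s : hsym s 0 = 1. Proof. by case: s. Qed.

(** Induction on the variables. The part of the sum with explicit powers of the new variable [y]
    collapses to [y * esym s t] by [VE]; the part with the old power sums follows from the induction
    hypothesis. *)
Lemma esym_newton s t : t.+1%:R * esym s t.+1 =
  \sum_(i < t.+1) (-1) ^+ i * esym s (t - i) * psym s i.+1.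
Proof.
elim: s t => [|y s IH] t.
  by rewrite /= mulr0 big1 // => i _; rewrite /psym big_nil mulr0.
pose V t := \sum_(i < t.+1) (-1) ^+ i * esym (y :: s) (t - i) * y ^+ i.+1.
have VE n : V n = y * esym s n.
  elim: n => [|n IHn]; first by rewrite /V big_ord1 /= ?esym0; ring.
  rewrite /V big_ord_recl subn0 /= expr0 mul1r expr1.
  have -> : \sum_(i < n.+1) (-1) ^+ bump 0 i * esym (y :: s) (n.+1 - bump 0 i) * y ^+ (bump 0 i).+1
     = - y * V n.
    rewrite /V mulr_sumr; apply: eq_bigr => i _.
    by rewrite /bump /= add1n subSS !exprS; ring.
  by rewrite IHn; ring.
have CE n : \sum_(i < n.+2) (-1) ^+ i * esym (y :: s) (n.+1 - i) * psym s i.+1 =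
    y * (n.+1%:R * esym s n.+1) + n.+2%:R * esym s n.+2.
  rewrite !IH big_ord_recr [X in _ = _ + X]big_ord_recr /= subnn !esym0 [y * \sum_(i < _) _]mulr_sumr addrA -big_split /=.
  congr (_ + _); apply: eq_bigr => i _.
  by rewrite (subSn (_ : i <= n)%N) /= -1?ltnS //; ring.
have pE i : psym (y :: s) i = y ^+ i + psym s i by rewrite /psym big_cons.
under eq_bigr do rewrite pE mulrDr.
rewrite big_split /= -/(V t) VE.
case: t => [|t]; last by rewrite CE -[t.+2%:R]natr1; ring.
rewrite big_ord1 /= !esym0; have := IH 0%N; rewrite big_ord1 /= !esym0 => E.
by rewrite -[in RHS]E; ring.
Qed.

(** The factor [1 ^+ i] gives this the shape of [esym_newton] with [-1] replaced by 1, so that the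
    passage to the limit treats both at once. *)
Lemma hsym_newton s t : t.+1%:R * hsym s t.+1 =
  \sum_(i < t.+1) 1 ^+ i * hsym s (t - i) * psym s i.+1.
Proof.
elim: s t => [|y s IH] t.
  by rewrite /= mulr0 big1 // => i _; rewrite /psym big_nil mulr0.
have pE i : psym (y :: s) i = y ^+ i + psym s i by rewrite /psym big_cons.
have hE n : hsym (y :: s) n.+1 = y * hsym (y :: s) n + hsym s n.+1 by [].
have h0 : hsym (y :: s) 0 = 1 by [].
move: pE hE h0 IH; move: (psym _) (psym _) (hsym (y :: s)) => p q f pE hE h0 IH.
have step n : \sum_(i < n.+1) 1 ^+ i * f (n - i)%N * q i.+1 =
    y * (\sum_(i < n) 1 ^+ i * f (n.-1 - i)%N * q i.+1)
    + y * f n + n.+1%:R * hsym s n.+1.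
  under eq_bigr do rewrite pE mulrDr.
  under [X in y * X]eq_bigr do rewrite pE mulrDr.
  rewrite !big_split /= IH big_ord_recl big_ord_recr [in RHS]big_ord_recr /=.
  rewrite subnn h0 hsym0 subn0 expr0 mul1r expr1 mulrDr !mulr_sumr.
  have -> : \sum_(i < n) 1 ^+ bump 0 i * f (n - bump 0 i)%N * y ^+ (bump 0 i).+1 =
      \sum_(i < n) y * (1 ^+ i * f (n.-1 - i)%N * y ^+ i.+1).
    apply: eq_bigr => i _; rewrite /bump /= add1n subnS -predn_sub !exprS; ring.
  have -> : \sum_(i < n) 1 ^+ i * f (n - i)%N * p i.+1 =
      \sum_(i < n) y * (1 ^+ i * f (n.-1 - i)%N * p i.+1) +
      \sum_(i < n) 1 ^+ i * hsym s (n - i) * p i.+1.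
    rewrite -big_split; apply: eq_bigr => i _ /=.
    have -> : (n - i = (n.-1 - i).+1)%N by have := ltn_ord i; lia.
    by rewrite hE; ring.
  by ring.
elim: t => [|t IHt]; rewrite step; first by rewrite big_ord0 hE h0; ring.
by rewrite -IHt hE -[t.+2%:R]natr1; ring.
Qed.

(** The starting point [a] is free because splitting off the first index moves it. [ltn] from 0 and
    [leq] from 1 give the two multiple sums. *)
Definition path_sum x (r : rel nat) (t a m : nat) : A :=
  \sum_(n : t.-tuple 'I_m.+1 | path r a (map val n)) \prod_(j < t) x (tnth n j).

Lemma path_sum0 x r a m : path_sum x r 0 a m = 1.
Proof.
rewrite /path_sum (bigD1 [tuple]) //= big_ord0 big1 ?addr0 // => n.
by case/andP => _ /eqP[]; exact: tuple0.
Qed.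

Lemma path_sumS x r t a m :
  path_sum x r t.+1 a m = \sum_(i < m.+1 | r a i) x i * path_sum x r t i m.
Proof.
rewrite /path_sum; under [RHS]eq_bigr do rewrite mulr_sumr.
rewrite pair_big_dep /= (reindex (fun p : 'I_m.+1 * t.-tuple 'I_m.+1 => [tuple of p.1 :: p.2])) /=.
  apply: eq_bigr => -[i n] _; rewrite big_ord_recl tnth0; congr (_ * _).
  by apply: eq_bigr => j _; rewrite tnthS.
exists (fun n => (thead n, [tuple of behead n])) => [[i n] _ /=|n _ /=].
  by congr (_, _); apply: val_inj.
by rewrite [n in RHS]tuple_eta.
Qed.

Lemma path_sum_ltn x t a d m : (a + d = m)%N ->
  path_sum x ltn t a m = esym [seq x i | i <- iota a.+1 d] t.
Proof.
elim: d a t => [|d IH] a [|t] am; rewrite ?path_sum0 ?esym0 // path_sumS /=.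
  by rewrite big_pred0 // => i; have := ltn_ord i; lia.
have am' : (a.+1 < m.+1)%N by lia.
rewrite (bigD1 (Ordinal am')) //= IH; last by lia.
congr (_ + _); rewrite -IH; last by lia.
rewrite path_sumS; apply: eq_bigl => i; rewrite -val_eqE /=; lia.
Qed.

Lemma path_sum_leq x t a d m : (a + d = m.+1)%N ->
  path_sum x leq t a m = hsym [seq x i | i <- iota a d] t.
Proof.
elim: d a t => [|d IH] a t am.
  case: t => [|t]; rewrite ?path_sum0 ?hsym0 // path_sumS big_pred0 // => i.
  by have := ltn_ord i; lia.
elim: t => [|t IHt]; first by rewrite path_sum0.
have am' : (a < m.+1)%N by lia.
rewrite path_sumS (bigD1 (Ordinal am')) //= IHt /=.
congr (_ + _); rewrite -IH; last by lia.
rewrite path_sumS; apply: eq_bigl => i; rewrite -val_eqE /=; lia.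
Qed.

End SymmetricSums.

(** * Newton's identities in the limit *)

Section IsobaricLimits.
Variable R : realType.
Implicit Types (tau : R[i]) (V f g : R[i] -> R[i]).

(** Convergence of the multiple sums is deduced here: as [t.+1] is invertible, the recursion
    expresses each sequence through earlier ones and the convergent power sums. *)
Lemma newton_limit (c : R[i]) (u p : nat -> nat -> R[i]) (P : nat -> R[i]) :
  (forall m, u 0%N m = 1) ->
  (forall t m, t.+1%:R * u t.+1 m = \sum_(i < t.+1) c ^+ i * u (t - i)%N m * p i.+1 m) ->
  (forall i, ccvg (p i.+1) (P i.+1)) ->
  let L t : R[i] := limn (u t : nat -> (R[i])^o) in
  (forall t, ccvg (u t) (L t)) /\
  forall t, t.+1%:R * L t.+1 = \sum_(i < t.+1) c ^+ i * L (t - i)%N * P i.+1.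
Proof.
move=> u0 uS pP L.
have cvgS t : (forall n, (n <= t)%N -> ccvg (u n) (L n)) ->
    ccvg (u t.+1) (t.+1%:R^-1 * \sum_(i < t.+1) c ^+ i * L (t - i)%N * P i.+1).
  move=> H; have cv (i : 'I_t.+1) := ccvgM (ccvgZ (c ^+ i) (H _ (leq_subr i t))) (pP i).
  apply: ccvg_ext (ccvgZ t.+1%:R^-1 (ccvg_sum (index_enum 'I_t.+1) (P := xpredT) (fun i _ => cv i))).
  by move=> m; rewrite -uS mulKf // pnatr_eq0.
have cvgL t : ccvg (u t) (L t).
  elim/ltn_ind: t => -[|t] IH.
    have c1 : ccvg (u 0%N) 1 by apply: ccvg_ext (ccvg_cst 1) => m; rewrite u0.
    by rewrite /L (ccvg_limn c1).
  by have cS := cvgS t IH; rewrite [L t.+1](ccvg_limn cS).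
split=> // t; have := ccvg_unique (cvgL t.+1) (cvgS t (fun n _ => cvgL n)) => ->.
by rewrite mulVKf // pnatr_eq0.
Qed.

Variables (t : nat) (V : nat -> R[i] -> R[i]).
Local Notation expo := {ffun 'I_t -> 'I_t.+1}.
Local Notation wt s := (\sum_(j < t) j.+1 * s j)%N.

(** [isobaric_polynomial] with the weight [w] separated from the number [t] of variables, for the
    induction on [w]. *)
Definition isobaric w f := exists a : expo -> R[i],
  forall tau, in_uhp tau ->
    f tau = \sum_(s : expo | wt s == w) a s * \prod_(j < t) V j.+1 tau ^+ s j.

Lemma isobaric_ext w f g : (forall tau, in_uhp tau -> g tau = f tau) ->
  isobaric w f -> isobaric w g.
Proof. by move=> gf [a aE]; exists a => tau t0; rewrite gf ?aE. Qed.

Lemma isobaricZ w c f : isobaric w f -> isobaric w (fun tau => c * f tau).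
Proof.
move=> [a aE]; exists (fun s => c * a s) => tau t0; rewrite aE // mulr_sumr.
by apply: eq_bigr => s _; rewrite mulrA.
Qed.

Lemma isobaric_sum w I (r : seq I) (P : pred I) (F : I -> R[i] -> R[i]) :
  (forall i, P i -> isobaric w (F i)) ->
  isobaric w (fun tau => \sum_(i <- r | P i) F i tau).
Proof.
move=> H; have /choice[a aE] : forall i, exists a : expo -> R[i], P i ->
    forall tau, in_uhp tau ->
    F i tau = \sum_(s : expo | wt s == w) a s * \prod_(j < t) V j.+1 tau ^+ s j.
  move=> i; have [Pi|nPi] := boolP (P i); last by exists (fun=> 0).
  by have [a aE] := H i Pi; exists a.
exists (fun s => \sum_(i <- r | P i) a i s) => tau t0.
under eq_bigr => i Pi do rewrite (aE i Pi tau t0).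
by rewrite exchange_big; apply: eq_bigr => s _; rewrite mulr_suml.
Qed.

Lemma isobaric_monomial w (s : expo) : wt s = w ->
  isobaric w (fun tau => \prod_(j < t) V j.+1 tau ^+ s j).
Proof.
move=> sw; exists (fun s' => (s' == s)%:R) => tau _.
rewrite (bigD1 s) /=; last by rewrite sw.
rewrite eqxx mul1r [X in _ + X]big1 ?addr0 // => s' /andP[_ ss].
by rewrite (negPf ss) mul0r.
Qed.

Lemma isobaricM w w' i f : (w + i.+1 = w')%N -> (w' <= t)%N -> isobaric w f ->
  isobaric w' (fun tau => f tau * V i.+1 tau).
Proof.
move=> <- wt_le [a aE]; have it : (i < t)%N by lia.
apply: (@isobaric_ext _ (fun tau => \sum_(s : expo | wt s == w) a s *
   (\prod_(j < t) V j.+1 tau ^+ s j * V i.+1 tau))) => [tau t0|].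
  by rewrite aE // mulr_suml; apply: eq_bigr => s _; rewrite mulrA.
apply: isobaric_sum => s /eqP sw; apply: isobaricZ.
(* One more factor of the variable with index [i]. [inord] changes nothing, because an exponent is
   at most the weight and the new weight is still at most [t]. *)
pose s' : expo := [ffun j => inord (s j + (j == Ordinal it))%N].
have s'E j : (s' j = s j + (j == Ordinal it) :> nat)%N.
  rewrite ffunE inordK // ltnS (leq_trans _ wt_le) // leq_add //; last by case: (j == _).
  by rewrite -sw (bigD1 j) //= (leq_trans _ (leq_addr _ _)) // leq_pmull.
apply: isobaric_ext (isobaric_monomial (s := s') _) => [tau _|].
  under [RHS]eq_bigr do rewrite s'E exprD.
  rewrite big_split /=; congr (_ * _); rewrite (bigD1 (Ordinal it)) //= eqxx expr1 big1 ?mulr1 // => j ji.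
  by rewrite (negPf ji) expr0.
under eq_bigr do rewrite s'E mulnDr.
rewrite big_split /= sw; congr (_ + _)%N; rewrite (bigD1 (Ordinal it)) //= eqxx muln1 big1 ?addn0 // => j ji.
by rewrite (negPf ji) muln0.
Qed.

Lemma isobaric_newton (c : R[i]) (L : nat -> R[i] -> R[i]) :
  (forall tau, in_uhp tau -> L 0%N tau = 1) ->
  (forall n tau, in_uhp tau ->
    n.+1%:R * L n.+1 tau = \sum_(i < n.+1) c ^+ i * L (n - i)%N tau * V i.+1 tau) ->
  forall w, (w <= t)%N -> isobaric w (L w).
Proof.
move=> L0 LS; elim/ltn_ind => -[|n] IH nt.
  apply: isobaric_ext (isobaric_monomial (s := [ffun=> ord0]) _) => [tau t0|].
    by rewrite L0 // big1 // => j _; rewrite ffunE expr0.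
  by rewrite big1 // => j _; rewrite ffunE muln0.
apply: (@isobaric_ext _ (fun tau => n.+1%:R^-1 *
    \sum_(i < n.+1) c ^+ i * (L (n - i)%N tau * V i.+1 tau))) => [tau t0|].
  rewrite -[LHS](mulKf (_ : n.+1%:R != 0 :> R[i])) ?pnatr_eq0 // LS //; congr (_ * _).
  by apply: eq_bigr => i _; rewrite mulrA.
apply: isobaricZ; apply: isobaric_sum => i _; apply: isobaricZ.
apply: (@isobaricM (n - i) n.+1 i (L (n - i)%N) _ nt); first by rewrite addnS subnK // -ltnS.
by apply: IH; have := ltn_ord i; lia.
Qed.

Lemma isobaric_mixed N k f : (forall j : 'I_t, mixed N (j.+1 * k) (V j.+1)) ->
  isobaric t f -> mixed N (t * k) f.
Proof.
move=> hV [a aE]; apply: mixed_ext aE _; apply: mixed_sum => s /eqP sw; apply: mixedZ.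
have := mixed_prod (index_enum 'I_t) (fun j : 'I_t => mixedX (s j) (hV j)).
rewrite (_ : (\sum_(j < t) s j * (j.+1 * k))%N = (t * k)%N) // -[in RHS]sw big_distrl.
by apply: eq_bigr => j _; rewrite mulnCA mulnA.
Qed.

End IsobaricLimits.

(** * From the multiple sums to symmetric polynomials *)

Section MultipleSums.
Variable R : realType.
Implicit Types (q x tau : R[i]) (Q : {poly R[i]}).

Lemma U_termX k N Q s x : U_term (s * k) N (Q ^+ s) x = U_term k N Q x ^+ s.
Proof. by rewrite /U_term horner_exp expr_div_n -exprM mulnC. Qed.

Definition terms k N Q q m := [seq U_term k N Q (q ^+ n) | n <- iota 1 m].

Lemma U_esym t k N Q q :
  U t k N Q q = limn ((fun m => esym (terms k N Q q m) t) : nat -> (R[i])^o).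
Proof.
rewrite (_ : (fun m => _) = fun m =>
  path_sum (fun n => U_term k N Q (q ^+ n)) ltn t 0 m) //.
by apply/funext => m; rewrite (path_sum_ltn _ _ (add0n m)).
Qed.

Lemma Ustar_hsym t k N Q q :
  Ustar t k N Q q = limn ((fun m => hsym (terms k N Q q m) t) : nat -> (R[i])^o).
Proof.
rewrite (_ : (fun m => _) = fun m =>
  path_sum (fun n => U_term k N Q (q ^+ n)) leq t 1 m) //.
by apply/funext => m; rewrite (path_sum_leq _ _ (add1n m)).
Qed.

Lemma psym_terms k N Q q m s :
  psym (terms k N Q q m) s = \sum_(n < m) U_term (s * k) N (Q ^+ s) (q ^+ n.+1).
Proof.
rewrite /psym big_map; have -> : iota 1 m = index_iota 1 m.+1 by rewrite /index_iota subn1.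
rewrite big_add1 big_mkord.
by apply: eq_bigr => n _; rewrite U_termX.
Qed.

Lemma U1_limit_mixed k N Q : (0 < N)%N -> (size Q <= totient N * k)%N -> Q.[0] = 0 ->
  (forall x, x != 0 -> Q.[x] = if N == 1%N then (- x) ^+ k * Q.[x^-1]
     else x ^+ (totient N * k) * Q.[x^-1]) ->
  (forall tau, in_uhp tau ->
     ccvg (fun m => \sum_(n < m) U_term k N Q (nome tau ^+ n.+1)) (U1 k N Q (nome tau))) /\
  mixed N k (fun tau => U1 k N Q (nome tau)).
Proof.
move=> N0 sQ Q0 fQ; have [F cF mF] := U_term_series_mixed N0 sQ Q0 fQ.
have E tau : in_uhp tau -> U1 k N Q (nome tau) = F tau.
  move=> t0; rewrite /U1 U_esym; apply: ccvg_limn; apply: ccvg_ext (cF tau t0) => m.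
  (* Newton's identity at [t = 0] identifies the first elementary polynomial with the first power
     sum. *)
  have := esym_newton (terms k N Q (nome tau) m) 0.
  by rewrite big_ord1 esym0 !mul1r psym_terms mul1n expr1 => ->.
split; last exact: mixed_ext E mF.
by move=> tau t0; rewrite E //; exact: cF.
Qed.

Lemma power_hypotheses k N Q s : (0 < k)%N -> (0 < N)%N ->
  (size Q <= totient N * k)%N -> Q.[0] = 0 ->
  (forall x, x != 0 -> Q.[x] = if N == 1%N then (- x) ^+ k * Q.[x^-1]
     else x ^+ (totient N * k) * Q.[x^-1]) ->
  [/\ (size (Q ^+ s.+1)%R <= totient N * (s.+1 * k))%N, (Q ^+ s.+1).[0] = 0 &
  forall x, x != 0 -> (Q ^+ s.+1).[x] =
    if N == 1%N then (- x) ^+ (s.+1 * k) * (Q ^+ s.+1).[x^-1]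
    else x ^+ (totient N * (s.+1 * k)) * (Q ^+ s.+1).[x^-1]].
Proof.
move=> k0 N0 sQ Q0 fQ; split.
- apply: leq_trans (size_poly_exp_leq _ _) _.
  (* The size bounds the degree plus one: from [size Q <= b] the power has size at most
     [(b - 1) * s.+1 + 1], and this is at most [b * s.+1]. *)
  have : (0 < totient N * k)%N by rewrite muln_gt0 totient_gt0 N0.
  rewrite mulnCA; move: sQ; set a := size Q; set b := (totient N * k)%N => sQ b0; nia.
- by rewrite horner_exp Q0 expr0n.
move=> x x0; rewrite !horner_exp (fQ _ x0); case: ifP => _; rewrite exprMn -exprM.
  by rewrite [(k * _)%N]mulnC.
by rewrite -mulnA [(k * _)%N]mulnC.
Qed.

End MultipleSums.

Theorem theorem1p1 (R : realType) (t k N : nat) (Q : {poly R[i]})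
    (ht : (0 < t)%N) (hk : (0 < k)%N) (hN : (0 < N)%N)
    (hdeg : (size Q <= totient N * k)%N)
    (hQ0 : Q.[0] = 0)
    (hQ : forall x : R[i], x != 0 ->
       Q.[x] = if N == 1%N then (- x) ^+ k * Q.[x^-1]
               else x ^+ (totient N * k) * Q.[x^-1]) :
  mixed_weight_quasimodular k N (fun tau : R[i] => U1 k N Q (nome tau)) /\
  [/\ isobaric_polynomial t
        (fun (s : nat) (tau : R[i]) => U1 (s * k) N (Q ^+ s) (nome tau))
        (fun tau : R[i] => U t k N Q (nome tau)),
      isobaric_polynomial t
        (fun (s : nat) (tau : R[i]) => U1 (s * k) N (Q ^+ s) (nome tau))
        (fun tau : R[i] => Ustar t k N Q (nome tau)),
      mixed_weight_quasimodular (t * k) N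
        (fun tau : R[i] => U t k N Q (nome tau))
    & mixed_weight_quasimodular (t * k) N
        (fun tau : R[i] => Ustar t k N Q (nome tau))].

Proof.
pose V (s : nat) (tau : R[i]) := U1 (s * k) N (Q ^+ s) (nome tau).
have VP s : (forall tau, in_uhp tau -> ccvg (fun m => psym (terms k N Q (nome tau) m) s.+1)
    (V s.+1 tau)) /\ mixed N (s.+1 * k) (V s.+1).
  have [sQ Q0 fQ] := power_hypotheses s hk hN hdeg hQ0 hQ.
  have [c m] := U1_limit_mixed hN sQ Q0 fQ; split=> // tau t0.
  by apply: ccvg_ext (c tau t0) => n; rewrite psym_terms.
(* Used with [c = -1] for the strict sums and [c = 1] for the weak ones. *)
have iso (c : R[i]) (u : R[i] -> nat -> nat -> R[i]) :
    (forall tau m, u tau 0%N m = 1) ->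
    (forall tau n m, n.+1%:R * u tau n.+1 m =
      \sum_(i < n.+1) c ^+ i * u tau (n - i)%N m * psym (terms k N Q (nome tau) m) i.+1) ->
    isobaric t V t (fun tau => limn (u tau t : nat -> (R[i])^o)).
  move=> u0 uS.
  apply: (@isobaric_newton R t V c (fun n tau => limn (u tau n : nat -> (R[i])^o))) => //.
    move=> tau t0; apply: ccvg_limn; apply: ccvg_ext (ccvg_cst 1) => m.
    by rewrite u0.
  move=> n tau t0.
  by have [_ ->] := @newton_limit R c (u tau)
    (fun i m => psym (terms k N Q (nome tau) m) i) (V ^~ tau) (u0 tau) (uS tau)
    (fun i => (VP i).1 tau t0).
have isoU : isobaric t V t (fun tau => U t k N Q (nome tau)).
  apply: isobaric_ext (iso (-1) (fun tau n m => esym (terms k N Q (nome tau) m) n) _ _) => //.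
  - by move=> tau _; exact: U_esym.
  - by move=> tau m; exact: esym0.
  - by move=> tau n m; exact: esym_newton.
have isoUstar : isobaric t V t (fun tau => Ustar t k N Q (nome tau)).
  apply: isobaric_ext (iso 1 (fun tau n m => hsym (terms k N Q (nome tau) m) n) _ _) => //.
  - by move=> tau _; exact: Ustar_hsym.
  - by move=> tau m; exact: hsym0.
  - by move=> tau n m; exact: hsym_newton.
have mix f : isobaric t V t f -> mixed_weight_quasimodular (t * k) N f.
  move=> hf; apply: mixed_mixed_weight => //.
  by apply: isobaric_mixed hf => j; exact: (VP j).2.
split; first exact: mixed_mixed_weight hN (U1_limit_mixed hN hdeg hQ0 hQ).2.
by split=> //; exact: mix.
Qed.
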